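(* Let $A\to A''$ be a morphism of homotopy Gerstenhaber algebras (hgas) over a commutative ring $\Bbbk$. The family $(f_n)_{n\ge1}$ of maps $f_n\colon\mathbf{B}(A,A,A'')^{\otimes n}\to A''$ defined in the context constitutes an augmented $A_\infty$-morphism $f\colon\mathbf{B}(A,A,A'')\Rightarrow A''$, where $\mathbf{B}(A,A,A'')$ carries the augmented $A_\infty$-structure $(m_n)$ defined in the context. Hence, for any commutative square of hga morphisms formed by $A\to A'$, $A\to A''$, $A'\to\tilde A$, $A''\to\tilde A$, the composition $$\mathbf{B}(A',A,A'')\to\mathbf{B}(\tilde A,\tilde A,\tilde A)\overset{f}{\Longrightarrow}\tilde A$$ (whose first map is the strict morphism induced by naturality) is an augmented $A_\infty$-morphism extending the chain map $\mathbf{B}(A',A,A'')\to\tilde A$, $a'\otimes\mathbf a\otimes a''\mapsto a'\,\epsilon(\mathbf a)\,a''$ (where $a'$ and $a''$ are considered as elements of $\tilde A$).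
   Context: **General conventions.** $\otimes=\otimes_{\Bbbk}$; complexes are cochain complexes; maps on tensor products are evaluated with the Koszul sign rule; $d(f)=d\,f-(-1)^{|f|}f\,d$. **Bar constructions.** Let $A$ be an augmented dga with augmentation $\epsilon$, $\bar A=\ker\epsilon$, $\bar a=a-\epsilon(a)1$. $\mathbf{B}A=\bigoplus_{k\ge0}(s^{-1}\bar A)^{\otimes k}$, with elements $\mathbf a=[a_1|\dots|a_k]$ of length $k$ and degree $\sum_i(|a_i|-1)$, is a coaugmented dgc: the diagonal is deconcatenation, $\Delta\mathbf a=\sum\mathbf a^{(1)}\otimes\mathbf a^{(2)}$; $\mathbf 1=[\,]$; $\epsilon(\mathbf a)=0$ for length $\ge1$, $\epsilon(\mathbf 1)=1$; the differential is the tensor product differential (with $d[a]=-[da]$) plus $\sum_{i=1}^{k-1}(-1)^{\epsilon_i}[a_1|\dots|a_ia_{i+1}|\dots|a_k]$, $\epsilon_i=|a_1|+\dots+|a_i|-i$. Canonical twisting cochain $t\colon\mathbf{B}A\to A$: $[a]\mapsto a$, zero on length $\ne1$. Given morphisms of augmented dgas $A\to A'$, $A\to A''$ (suppressed from the notation), $\mathbf{B}(A',A,A'')=A'\otimes\mathbf{B}A\otimes A''$, with elements $\overleftrightarrow{a}=a'\otimes\mathbf a\otimes a''=a'[a_1|\dots|a_k]a''$ and differential $d\overleftrightarrow{a}=d_\otimes\overleftrightarrow{a}+(-1)^{|a'|}a'a_1[a_2|\dots|a_k]a''-(-1)^{|a'|+\epsilon_{k-1}}a'[a_1|\dots|a_{k-1}]a_ka''$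 (last two terms only if $k\ge1$). Write $\overleftarrow{a}=a'\otimes\mathbf a\in\mathbf{B}(A',A,\Bbbk)$, $\overrightarrow{a}=\mathbf a\otimes a''\in\mathbf{B}(\Bbbk,A,A'')$, and $\sum\overleftarrow{a}^{(1)}\otimes\overrightarrow{a}^{(2)}=\sum_{i}a'[a_1|\dots|a_i]\otimes[a_{i+1}|\dots|a_k]a''$. **Hgas.** An hga is an augmented dga $A$ with an associative product $\mu(\mathbf a,\mathbf b)=\mathbf a\cdot\mathbf b$ on $\mathbf{B}A$ with unit $\mathbf 1$, turning $\mathbf{B}A$ (with the diagonal above) into a dg bialgebra, such that the twisting cochain $\mathbf E=t\,\mu\colon\mathbf{B}A\otimes\mathbf{B}A\to\bar A$ (of degree $1$) satisfies $\mathbf E(\mathbf a,\mathbf b)=0$ if $\mathbf a$ has length $\ge2$. ($\mu$ is determined by $\mathbf E$, and $\mathbf E(\mathbf a,\mathbf 1)=\mathbf E(\mathbf 1,\mathbf a)=t(\mathbf a)$.) Morphisms of hgas are morphisms of augmented dgas compatible with $\mathbf E$. $\Bbbk$ is an hga with $\mathbf E([a],\mathbf b)=0$ whenever $\mathbf b$ has length $\ge1$; augmentations are hga morphisms. **Product on the right bar construction.** For an hga morphism $A\to A''$, $\mathbf{B}(\Bbbk,A,A'')$ is an (associative) augmented dga with product $\overrightarrow{a}\cdot\overrightarrow{b}=\sum(-1)^{|a''||\mathbf b^{(1)}|}\,\mathbf a\cdot\mathbf b^{(1)}\otimes\mathbf E([\bar a''],\mathbf b^{(2)})\,b''+\mathbf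 a\cdot\mathbf b\otimes\epsilon(a'')b''$ (Kadeishvili--Saneblidze). **Maps $S$, $h$, $h_n$, $f_n$** (case $A=A'$): $S\colon\mathbf{B}(A,A,A'')\to\mathbf{B}(\Bbbk,A,A'')$, $a[a_1|\dots|a_k]a''\mapsto[\bar a|a_1|\dots|a_k]a''$ (degree $-1$); $h(\overleftrightarrow{a},\overleftrightarrow{b})=(-1)^{|\overleftrightarrow{a}|}\,a'\otimes\overrightarrow{a}\cdot S(\overleftrightarrow{b})\in\mathbf{B}(A,A,A'')$ (degree $-1$); $h_1=1$, $h_2=h$, $h_n=h_{n-1}(1^{\otimes(n-2)}\otimes h)$ (degree $1-n$); $f_1\colon\mathbf{B}(A,A,A'')\to A''$, $f_1(\overleftrightarrow{a})=a'\,\epsilon(\mathbf a)\,a''$, and $f_n=f_1\,h_n$ for $n\ge2$. **Maps $m_n$** on $\mathbf{B}(A',A,A'')$, of degree $2-n$. For $n\ge2$ set $$\tilde m_n(\overleftrightarrow{a}_1,\dots,\overleftrightarrow{a}_n)=\sum(-1)^{\kappa}\,a_1'\,\mathbf E\bigl(\mathbf a_1^{(1)},S\,h_{n-1}(\overleftarrow{a}_2^{(1)},\dots,\overleftarrow{a}_n^{(1)})\bigr)\otimes\overrightarrow{a}_1^{(2)}\cdots\overrightarrow{a}_n^{(2)},$$ $\kappa=\sum_{1\le i<j\le n}|\overrightarrow{a}_i^{(2)}||\overleftarrow{a}_j^{(1)}|+n|a_1'|+(n-1)|\mathbf a_1^{(1)}|$ (the Koszul sign). Here $\mathbf a_1^{(1)}$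 is considered as an element of $\mathbf{B}A'$, the $\overleftarrow{a}_j^{(1)}$ as elements of $\mathbf{B}(A',A',\Bbbk)$, so that $S\,h_{n-1}(\dots)\in\mathbf{B}A'$, and $\mathbf E$ is that of $A'$. Then $m_2(\overleftrightarrow{a}_1,\overleftrightarrow{a}_2)=\tilde m_2(\overleftrightarrow{a}_1,\overleftrightarrow{a}_2)+a_1'\,\epsilon(a_2')\otimes\overrightarrow{a}_1\cdot\overrightarrow{a}_2$, and $m_n=\tilde m_n$ for $n\ge3$. These maps form an augmented $A_\infty$-structure, natural in the triple $(A',A,A'')$, with unit $1\otimes\mathbf 1\otimes1$ and augmentation $\epsilon(\overleftrightarrow{a})=\epsilon(a')\epsilon(\mathbf a)\epsilon(a'')$. On $\mathbf{B}(A,A,A'')$ one takes $A'=A$ with the identity map. **$A_\infty$.** An $A_\infty$-structure on a cochain complex $A$ is a family $m_n\colon A^{\otimes n}\to A$, $n\ge2$, of degree $2-n$ with $d(m_n)=-\sum_{l=2}^{n-1}\sum_{i=0}^{n-l}(-1)^{i+l(n-i-l)}m_{n-l+1}(1^{\otimes i}\otimes m_l\otimes1^{\otimes(n-i-l)})$. It is strictly unital if there is a cocycle $1$ with $m_2(a,1)=m_2(1,a)=a$ and $m_n$, $n\ge3$, vanishes if some argument is $1$. An augmentation is a chain map $\epsilon\colon A\to\Bbbk$ with $\epsilon(1)=1$, $\epsilon(m_2(a,b))=\epsilon(a)\epsilon(b)$, $\epsilon\,m_n=0$ for $n\ge3$. An $A_\infty$-morphism $f\colon A\Rightarrow B$ from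 an $A_\infty$-algebra to a dga $B$ (product $\mu_B$) is a family $f_n\colon A^{\otimes n}\to B$, $n\ge1$, of degree $1-n$ with $d(f_n)=\sum_{l=1}^{n-1}(-1)^l\mu_B(f_l\otimes f_{n-l})+\sum_{l=2}^{n}\sum_{i=0}^{n-l}(-1)^{i+l(n-i-l)}f_{n-l+1}(1^{\otimes i}\otimes m_l\otimes1^{\otimes(n-i-l)})$ for all $n\ge1$. It is augmented if $f_1(1)=1$, $f_n$ ($n\ge2$) vanishes if some argument is $1$, $\epsilon_Bf_1=\epsilon_A$, and $\epsilon_Bf_n=0$ for $n\ge2$. The composition of $f$ with a strict morphism $g$ into $A$ has components $f_n\,g^{\otimes n}$. *)

(* Defs.v *)
From HB Require Import structures.
From mathcomp Require Import all_boot all_order all_algebra.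
From mathcomp Require Import boolp.
From mathcomp Require Import freeg.

Set Implicit Arguments.
Unset Strict Implicit.
Unset Printing Implicit Defensive.

Import GRing.Theory.
Local Open Scope ring_scope.

Section QuotientModule.
Variables (k : comNzRingType) (M : lmodType k) (R : M -> Prop).

Definition in_span (x : M) : Prop :=
  exists l : seq (k * M),
    (forall p, p \in l -> R p.2) /\ x = \sum_(p <- l) p.1 *: p.2.

Definition span_pred : {pred M} := fun x => `[< in_span x >].

Lemma span_pred0 : 0 \in span_pred.
Proof. by apply/asboolP; exists [::]; split=> //; rewrite big_nil. Qed.

Lemma span_predZD (c : k) (x y : M) :
  x \in span_pred -> y \in span_pred -> c *: x + y \in span_pred.
Proof.
move=> /asboolP [lx [Rx ->]] /asboolP [ly [Ry ->]]; apply/asboolP.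
exists ([seq (c * p.1, p.2) | p <- lx] ++ ly); split.
  move=> p; rewrite mem_cat => /orP [/mapP [q qx ->] /=|]; last exact: (Ry p).
  exact: (Rx q).
rewrite big_cat big_map /= scaler_sumr; congr (_ + _).
by apply: eq_bigr => p _; rewrite scalerA.
Qed.

Lemma span_pred_zmod : zmod_closed span_pred.
Proof.
split=> [|x y Sx Sy]; first exact: span_pred0.
by rewrite addrC -scaleN1r; apply: span_predZD.
Qed.

HB.instance Definition _ := GRing.isZmodClosed.Build M span_pred span_pred_zmod.

Definition qmod := Quotient.quot span_pred.
HB.instance Definition _ := GRing.Zmodule.on qmod.
HB.instance Definition _ := Quotient.on qmod.

Definition qmod_pi (x : M) : qmod := \pi_(Quotient.quot span_pred)%qT x.

Definition qscale (c : k) (x : qmod) : qmod := qmod_pi (c *: repr x).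

Lemma qmod_piP x y : qmod_pi x = qmod_pi y <-> x - y \in span_pred.
Proof.
rewrite Quotient.idealrBE; split=> [e|/eqP //]; exact/eqP.
Qed.

Lemma qmod_piK x : qmod_pi (repr x) = x.
Proof. exact: reprK. Qed.

Lemma qmod_piD x y : qmod_pi (x + y) = qmod_pi x + qmod_pi y.
Proof. exact: raddfD. Qed.

Lemma qmod_piZ c x : qmod_pi (c *: x) = qscale c (qmod_pi x).
Proof.
apply/qmod_piP; rewrite -scalerBr -[c *: _]addr0; apply: span_predZD.
  by apply/qmod_piP; rewrite qmod_piK.
exact: span_pred0.
Qed.

Lemma qscaleA a b v : qscale a (qscale b v) = qscale (a * b) v.
Proof. by rewrite -[v]qmod_piK -!qmod_piZ scalerA. Qed.

Lemma qscale1 : left_id 1 qscale.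
Proof. by move=> v; rewrite -[v in LHS]qmod_piK -qmod_piZ scale1r qmod_piK. Qed.

Lemma qscaleDr : right_distributive qscale +%R.
Proof.
move=> a u v; rewrite -[u]qmod_piK -[v]qmod_piK.
by rewrite -qmod_piD -!qmod_piZ scalerDr qmod_piD.
Qed.

Lemma qscaleDl v : {morph qscale^~ v : a b / a + b}.
Proof.
by move=> a b; rewrite -[v]qmod_piK -!qmod_piZ scalerDl qmod_piD.
Qed.

HB.instance Definition _ :=
  GRing.Zmodule_isLmodule.Build k qmod qscaleA qscale1 qscaleDr qscaleDl.

Lemma qmod_pi_linear : linear qmod_pi.
Proof. by move=> c x y; rewrite qmod_piD qmod_piZ. Qed.

End QuotientModule.

Definition fgen (k : comNzRingType) (X : choiceType) (x : X) : {freeg X / k} :=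
  [freeg [:: (1, x)]].

Section Tensor.
Variables (k : comNzRingType) (M N : lmodType k).
Let F := {freeg (M * N)%type / k}.
Let g (x : M) (y : N) : F := fgen k (x, y).

Inductive tens_rel : F -> Prop :=
| tens_rel_l (c : k) (x x' : M) (y : N) :
    tens_rel (g (c *: x + x') y - (c *: g x y + g x' y))
| tens_rel_r (c : k) (x : M) (y y' : N) :
    tens_rel (g x (c *: y + y') - (c *: g x y + g x y')).

Definition tens : lmodType k := qmod tens_rel.
Definition tensor (x : M) (y : N) : tens := qmod_pi tens_rel (g x y).
End Tensor.

(* (-1)^n *)
Definition sg (k : comNzRingType) (n : int) : k := (-1) ^+ `|n|%N.

(* A homogeneous element together with its degree; only 0 has several degrees. *)
Record helt (T : Type) (H : int -> T -> Prop) := Helt {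
  hval : T; hdeg : int; hvalP : H hdeg hval }.

Arguments sg {k} n.

Section Grading.
Variables (k : comNzRingType) (V : lmodType k) (H : int -> V -> Prop).

(* [H n] is the degree [n] part, and [V] is the direct sum of the [H n]. *)
Record is_grading : Prop := IsGrading {
  grad0 : forall n, H n 0;
  gradZD : forall n (c : k) x y, H n x -> H n y -> H n (c *: x + y);
  grad_sum : forall x, exists (s : seq int) (u : int -> V),
    (forall n, H n (u n)) /\ x = \sum_(n <- s) u n;
  grad_direct : forall (s : seq int) (u : int -> V), uniq s ->
    (forall n, H n (u n)) -> \sum_(n <- s) u n = 0 ->
    forall n, n \in s -> u n = 0 }.
End Grading.

(* Augmented dgas, as graded algebras with an internal grading
   [ahom A n] = elements of degree [n]. *)
Record adga (k : comNzRingType) := Adga {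
  acar :> algType k;
  ahom : int -> acar -> Prop;
  adiff : {linear acar -> acar};
  aeps : {lrmorphism acar -> k^o};
  ahom_grading : is_grading ahom;
  ahom1 : ahom 0 1;
  ahomM : forall m n a b, ahom m a -> ahom n b -> ahom (m + n) (a * b);
  ahom_diff : forall n a, ahom n a -> ahom (n + 1) (adiff a);
  adiffK : forall a, adiff (adiff a) = 0;
  adiffM : forall n a b, ahom n a ->
    adiff (a * b) = adiff a * b + sg n *: (a * adiff b);
  aeps_hom : forall n a, ahom n a -> n != 0 -> aeps a = 0;
  aeps_diff : forall a, aeps (adiff a) = 0 }.

Record adga_mor (k : comNzRingType) (A B : adga k) := AdgaMor {
  amor :> {lrmorphism A -> B};
  amor_hom : forall n a, ahom n a -> ahom n (amor a);
  amor_diff : forall a, amor (adiff A a) = adiff B (amor a);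
  amor_eps : forall a, aeps B (amor a) = aeps A a }.

Section GroundRing.
Variable k : comNzRingType.

Definition khom (n : int) (c : k^o) : Prop := n = 0 \/ c = 0.

Lemma khom_grading : is_grading khom.
Proof.
split=> [n|n c x y hx hy|x|s u us hu s0 n ns]; first by right.
- case: hx => [->|->]; first by left.
  by case: hy => [->|->]; [left | right; rewrite scaler0 addr0].
- exists [:: 0], (fun n => if n == 0 then x else 0); split.
    by move=> n; case: eqP => [->|_]; [left | right].
  by rewrite big_seq1 eqxx.
- case: (hu n) => // n0; rewrite -s0 (bigD1_seq n) //= big1 ?addr0 // => i.
  by case: (hu i) => // ->; rewrite n0 eqxx.
Qed.

Lemma khom1 : khom 0 1.
Proof. by left. Qed.

Lemma khomM m n (a b : k^o) : khom m a -> khom n b -> khom (m + n) (a * b).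
Proof.
move=> [->|->]; last by right; rewrite mul0r.
by move=> [->|->]; [left; rewrite addr0 | right; rewrite mulr0].
Qed.

Definition k_adga : adga k.
Proof.
refine (@Adga k k^o khom \0 idfun khom_grading khom1 khomM _ _ _ _ _) => //=.
- by move=> *; right.
- by move=> *; rewrite mul0r mulr0 scaler0 addr0.
- by move=> n a [->|->].
Defined.

Definition aug_mor (A : adga k) : adga_mor A k_adga.
Proof.
refine (@AdgaMor k A k_adga (aeps A) _ _ _) => //=.
- move=> n a ha; rewrite /ahom /=; have [->|n0] := eqVneq n 0; first by left.
  by right; apply: (aeps_hom ha n0).
- exact: aeps_diff.
Defined.

Definition id_mor (A : adga k) : adga_mor A A :=
  @AdgaMor k A A idfun (fun _ _ h => h) (fun _ => erefl) (fun _ => erefl).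

End GroundRing.

Section AugmentationIdeal.
Variables (k : comNzRingType) (A : adga k).

Definition aker : {pred A} := fun a => aeps A a == 0.

Lemma akerE a : (a \in aker) = (aeps A a == 0).
Proof. by []. Qed.

Lemma aker_submod : subsemimod_closed aker.
Proof.
split; first split.
- by rewrite akerE raddf0.
- move=> x y; rewrite !akerE => /eqP ex /eqP ey.
  by rewrite raddfD /= ex ey addr0.
- by move=> c x; rewrite !akerE => /eqP ex; rewrite linearZ /= ex scaler0.
Qed.
HB.instance Definition _ := GRing.isSubmodClosed.Build k A aker aker_submod.

Record abar := Abar { aval : A; _ : aval \in aker }.
HB.instance Definition _ := [isSub for aval].
HB.instance Definition _ := [Choice of abar by <:].
HB.instance Definition _ := [SubChoice_isSubLmodule of abar by <:].

Lemma red_subproof (a : A) : a - (aeps A a : k) *: 1 \in aker.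
Proof.
by rewrite akerE raddfB /= linearZ /= rmorph1 /GRing.scale /= mulr1 subrr.
Qed.

(* a - eps(a) 1; it also serves to regard in [abar] an element of A on which the
   augmentation vanishes, such as a differential or a product in the kernel. *)
Definition red (a : A) : abar := Abar (red_subproof a).

Definition bhom (n : int) (a : abar) : Prop := ahom n (aval a).

End AugmentationIdeal.

Section BarModule.
Variables (k : comNzRingType) (A' A A'' : adga k).

(* The free module on the symbols a'[a_1|...|a_n]a'' modulo linearity in each
   entry, i.e. the sum over n of A' (x) (abar A)^{(x) n} (x) A''. *)
Let X : choiceType := (A' * seq (abar A) * A'')%type.
Let g (a' : A') (w : seq (abar A)) (a'' : A'') : {freeg X / k} :=
  fgen k (a', w, a'').

Inductive bar_rel : {freeg X / k} -> Prop :=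
| bar_rel_l (c : k) a1 a2 w a'' :
    bar_rel (g (c *: a1 + a2) w a'' - (c *: g a1 w a'' + g a2 w a''))
| bar_rel_m (c : k) a' u a1 a2 v a'' :
    bar_rel (g a' (u ++ (c *: a1 + a2) :: v) a''
             - (c *: g a' (u ++ a1 :: v) a'' + g a' (u ++ a2 :: v) a''))
| bar_rel_r (c : k) a' w a1 a2 :
    bar_rel (g a' w (c *: a1 + a2) - (c *: g a' w a1 + g a' w a2)).

Definition bmod : lmodType k := qmod bar_rel.

Definition bt (a' : A') (w : seq (abar A)) (a'' : A'') : bmod :=
  qmod_pi bar_rel (g a' w a'').

(* Symbols all of whose entries are homogeneous and carry their degrees. *)
Definition bsym : Type :=
  (helt (@ahom k A') * seq (helt (@bhom k A)) * helt (@ahom k A''))%type.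

Definition bval (s : bsym) : bmod :=
  bt (hval s.1.1) (map (@hval _ _) s.1.2) (hval s.2).

End BarModule.

Section Decomposition.
Variables (k : comNzRingType) (A' A A'' : adga k).
Local Notation B := (bmod A' A A'').

Let rel_eq (x y z : {freeg (A' * seq (abar A) * A'')%type / k}) c :
  bar_rel (x - (c *: y + z)) ->
  qmod_pi (@bar_rel k A' A A'') x = c *: qmod_pi (@bar_rel k A' A A'') y
     + qmod_pi (@bar_rel k A' A A'') z.
Proof.
move=> r; rewrite -(qmod_pi_linear (@bar_rel k A' A A'')); apply/qmod_piP.
apply/asboolP; exists [:: (1, x - (c *: y + z))]; split.
  by move=> p; rewrite inE => /eqP ->.
by rewrite big_seq1 scale1r.
Qed.

Lemma bt_l c a1 a2 w a'' :
  bt (c *: a1 + a2) w a'' = c *: bt a1 w a'' + bt a2 w a'' :> B.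
Proof. exact/rel_eq/bar_rel_l. Qed.

Lemma bt_m c a' u a1 a2 v a'' : bt a' (u ++ (c *: a1 + a2) :: v) a''
  = c *: bt a' (u ++ a1 :: v) a'' + bt a' (u ++ a2 :: v) a'' :> B.
Proof. exact/rel_eq/bar_rel_m. Qed.

Lemma bt_r c a' w a1 a2 :
  bt a' w (c *: a1 + a2) = c *: bt a' w a1 + bt a' w a2 :> B.
Proof. exact/rel_eq/bar_rel_r. Qed.

Let D (x : B) : Prop :=
  exists l : seq (k * bsym A' A A''), x = \sum_(p <- l) p.1 *: bval p.2.

Let D_lin c x y : D x -> D y -> D (c *: x + y).
Proof.
move=> [lx ->] [ly ->]; exists ([seq (c * p.1, p.2) | p <- lx] ++ ly).
rewrite big_cat big_map /= scaler_sumr; congr (_ + _).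
by apply: eq_bigr => p _; rewrite scalerA.
Qed.

Let D0 : D 0.
Proof. by exists [::]; rewrite big_nil. Qed.

Let D_sum (T : Type) (F : T -> B) (s : seq T) :
  (forall t, D (F t)) -> D (\sum_(t <- s) F t).
Proof.
move=> DF; elim: s => [|t s IH]; first by rewrite big_nil.
by rewrite big_cons -[F t]scale1r; apply: D_lin.
Qed.

Let lin_sum (V : lmodType k) (F : V -> B) (u : int -> V) s :
  (forall c x y, F (c *: x + y) = c *: F x + F y) ->
  F (\sum_(n <- s) u n) = \sum_(n <- s) F (u n).
Proof.
move=> Fl; have F0 : F 0 = 0.
  by have := Fl (- 1) 0 0; rewrite scaler0 addr0 scaleN1r addNr.
elim: s => [|n s IH]; first by rewrite !big_nil.
by rewrite !big_cons -[u n]scale1r Fl !scale1r IH.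
Qed.

Lemma red_linear : linear (@red k A).
Proof.
move=> c x y; apply/val_inj => /=.
have -> : aeps A (c *: x + y) = c * (aeps A x : k) + (aeps A y : k) :> k.
  by rewrite raddfD /= linearZ.
by rewrite scalerDl -scalerA scalerBr opprD addrACA.
Qed.

Lemma redK (a : abar A) : red (aval a) = a.
Proof.
apply/val_inj => /=; case: a => a /=; rewrite akerE => /eqP ->.
by rewrite scale0r subr0.
Qed.

Lemma bhom_red n (a : A) : ahom n a -> bhom n (red a).
Proof.
move=> ha; rewrite /bhom /=; have [n0|n0] := eqVneq n 0.
  rewrite addrC -scaleNr; apply: (gradZD (ahom_grading A)) => //.
  by rewrite n0; exact: ahom1.
by rewrite (aeps_hom ha n0) scale0r subr0.
Qed.

Let D_r (a' : helt (@ahom k A')) (w : seq (helt (@bhom k A))) a'' :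
  D (bt (hval a') (map (@hval _ _) w) a'').
Proof.
have [s [u [hu ->]]] := grad_sum (ahom_grading A'') a''.
rewrite (lin_sum (F := bt (hval a') (map (@hval _ _) w))); last first.
  by move=> c x y; exact: bt_r.
apply: D_sum => n; exists [:: (1, (a', w, Helt (hu n)))].
by rewrite big_seq1 scale1r.
Qed.

Let D_m (a' : helt (@ahom k A')) v (w : seq (helt (@bhom k A))) a'' :
  D (bt (hval a') (map (@hval _ _) w ++ v) a'').
Proof.
elim: v w => [|a v IH] w; first by rewrite cats0; exact: D_r.
have [s [u [hu au]]] := grad_sum (ahom_grading A) (aval a).
have -> : a = \sum_(n <- s) red (u n).
  rewrite -[a]redK au; elim: (s) => [|n t IHt].
    rewrite !big_nil; have := red_linear (- 1) 0 0.
    by rewrite scaler0 addr0 scaleN1r addNr.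
  by rewrite !big_cons -[u n]scale1r red_linear !scale1r IHt.
rewrite (lin_sum (F := fun b => bt (hval a') (map (@hval _ _) w ++ b :: v) a'')).
  apply: D_sum => n; have := IH (rcons w (Helt (bhom_red (hu n)))).
  by rewrite map_rcons cat_rcons.
by move=> c x y; exact: bt_m.
Qed.

Lemma bar_dec (x : B) :
  exists l : seq (k * bsym A' A A''), x = \sum_(p <- l) p.1 *: bval p.2.
Proof.
rewrite -/(D x) -[x]qmod_piK -[repr x]freeg_sumE.
elim: (dom _) => [|[[a' w] a''] s IH].
  by rewrite big_nil (_ : qmod_pi _ 0 = 0) //; exact: raddf0.
rewrite big_cons; set c := coeff _ _; set y := \sum_(_ <- _) _ in IH *.
have -> : [freeg [:: (c, (a', w, a''))]] = c *: fgen k (a', w, a'').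
  by apply/eqP/freeg_eqP => z; rewrite coeffZ !coeffU mul1r.
rewrite qmod_pi_linear; apply: D_lin => //; rewrite -/(bt a' w a'').
have [t [u [hu ->]]] := grad_sum (ahom_grading A') a'.
rewrite (lin_sum (F := fun b => bt b w a'')); last by move=> *; exact: bt_l.
by apply: D_sum => n; exact: (D_m (Helt (hu n)) w [::]).
Qed.

End Decomposition.

Definition dec (k : comNzRingType) (A' A A'' : adga k) (x : bmod A' A A'') :
  seq (k * bsym A' A A'') := sval (cid (bar_dec x)).

(* [hlift F] is the linear map with [hlift F (bval s) = F s]: it does not depend
   on the chosen decomposition when [F] is linear in every homogeneous entry of
   the symbol, as are all the [F] below. *)
Definition hlift (k : comNzRingType) (A' A A'' : adga k) (N : lmodType k)
    (F : bsym A' A A'' -> N) (x : bmod A' A A'') : N :=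
  \sum_(p <- dec x) p.1 *: F p.2.

Fixpoint mlift (k : comNzRingType) (A' A A'' : adga k) (N : lmodType k)
    (F : seq (bsym A' A A'') -> N) (xs : seq (bmod A' A A'')) : N :=
  if xs is x :: xs' then hlift (fun s => mlift (fun ss => F (s :: ss)) xs') x
  else F [::].

(* the degree of [a_1|...|a_n] *)
Definition wdeg (k : comNzRingType) (A : adga k)
    (w : seq (helt (@bhom k A))) : int := \sum_(a <- w) (hdeg a - 1).

Definition bdeg (k : comNzRingType) (A' A A'' : adga k) (s : bsym A' A A'') :
  int := hdeg s.1.1 + wdeg s.1.2 + hdeg s.2.

Definition hvals (T : Type) (H : int -> T -> Prop) (w : seq (helt H)) : seq T :=
  map (@hval T H) w.

(* The data, without axioms, of a cochain complex with a unit and an augmentation. *)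
Record cpx (k : comNzRingType) := Cpx {
  cmod :> lmodType k;
  chom : int -> cmod -> Prop;
  cdiff : cmod -> cmod;
  cone : cmod;
  ceps : cmod -> k }.

Section TwoSidedBar.
Variables (k : comNzRingType) (A' A A'' : adga k).
Variables (phi' : adga_mor A A') (phi'' : adga_mor A A'').
Local Notation B := (bmod A' A A'').
Local Notation v := (@hvals _ (@bhom k A)).

Definition bar_hom (n : int) (x : B) : Prop :=
  exists l : seq (k * bsym A' A A''),
    all (fun p => bdeg p.2 == n) l /\
    x = \sum_(p <- l) p.1 *: bval p.2.

Definition bar_diff : B -> B := hlift (fun s =>
  let: (a', w, a'') := s in
  bt (adiff A' (hval a')) (v w) (hval a'')
  + \sum_(i < size w) (if drop i w is a :: r then
      sg (hdeg a' + wdeg (take i w)) *: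
        bt (hval a') (v (take i w) ++ - red (adiff A (aval (hval a))) :: v r)
           (hval a'')
      else 0)
  + \sum_(i < size w) (if drop i w is a :: b :: r then
      sg (hdeg a' + wdeg (take i.+1 w)) *:
        bt (hval a')
           (v (take i w) ++ red (aval (hval a) * aval (hval b)) :: v r)
           (hval a'')
      else 0)
  + sg (hdeg a' + wdeg w) *: bt (hval a') (v w) (adiff A'' (hval a''))
  + (if w is a :: r then
       sg (hdeg a') *: bt (hval a' * phi' (aval (hval a))) (v r) (hval a'')
     else 0)
  - (if rev w is a :: r then
       sg (hdeg a' + wdeg (rev r)) *:
         bt (hval a') (v (rev r)) (phi'' (aval (hval a)) * hval a'')
     else 0)).

Definition bar_one : B := bt 1 [::] 1.

Definition bar_eps (x : B) : k := hlift (N := k^o) (fun s =>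
  let: (a', w, a'') := s in
  if w is [::] then (aeps A' (hval a') : k) * (aeps A'' (hval a'') : k) else 0) x.

Definition bar : cpx k := Cpx bar_hom bar_diff bar_one bar_eps.

End TwoSidedBar.

Definition bmap (k : comNzRingType) (A' A A'' B' B B'' : adga k)
    (f' : A' -> B') (f : A -> B) (f'' : A'' -> B'') :
    bmod A' A A'' -> bmod B' B B'' :=
  hlift (fun s => let: (a', w, a'') := s in
    bt (f' (hval a')) [seq red (f (aval a)) | a <- hvals w] (f'' (hval a''))).

(* a' (x) y in A' (x) B(k, A, A''), and x (x) a'' in B(A', A, k) (x) A''. *)
Definition lact (k : comNzRingType) (A' A A'' : adga k) (a' : A')
    (y : bmod (k_adga k) A A'') : bmod A' A A'' :=
  hlift (fun s : bsym (k_adga k) A A'' => let: (c, w, a'') := s in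
    bt ((hval c : k) *: a') (hvals w) (hval a'')) y.

Definition ract (k : comNzRingType) (A' A A'' : adga k)
    (x : bmod A' A (k_adga k)) (a'' : A'') : bmod A' A A'' :=
  hlift (fun s : bsym A' A (k_adga k) => let: (a', w, c) := s in
    bt (hval a') (hvals w) ((hval c : k) *: a'')) x.

Section OneSidedBar.
Variables (k : comNzRingType) (A : adga k).

(* BA = B(k, A, k) *)
Definition BA : cpx k := bar (aug_mor A) (aug_mor A).

Definition word (w : seq (abar A)) : BA := bt (1 : k_adga k) w (1 : k_adga k).

(* The canonical twisting cochain, followed by the inclusion of the kernel in A. *)
Definition twist (x : BA) : A :=
  hlift (fun s : bsym (k_adga k) A (k_adga k) => let: (c, w, c') := s in
    if w is [:: a] then ((hval c : k) * (hval c' : k)) *: aval (hval a)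
    else 0) x.

Definition deconc (x : BA) : tens BA BA :=
  hlift (fun s : bsym (k_adga k) A (k_adga k) => let: (c, w, c') := s in
    ((hval c : k) * (hval c' : k)) *:
      \sum_(i < (size w).+1)
        tensor (word (hvals (take i w))) (word (hvals (drop i w)))) x.
End OneSidedBar.

(* An augmented dga with a product on its bar construction; the hga axioms are
   in [is_hga]. *)
Record hga_data (k : comNzRingType) := HgaData {
  hadga :> adga k;
  hmu : BA hadga -> BA hadga -> BA hadga }.

Section Hga.
Variable k : comNzRingType.

Definition hE (A : hga_data k) (x y : BA A) : A := twist (hmu x y).

Record is_hga (A : hga_data k) : Prop := IsHga {
  hmu_linl : forall y : BA A, linear (fun x => hmu x y);
  hmu_linr : forall x : BA A, linear (hmu x);
  hmuA : forall x y z : BA A, hmu x (hmu y z) = hmu (hmu x y) z;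
  hmu1l : forall x : BA A, hmu (cone (BA A)) x = x;
  hmu1r : forall x : BA A, hmu x (cone (BA A)) = x;
  hmu_hom : forall m n (x y : BA A),
    chom m x -> chom n y -> chom (m + n) (hmu x y);
  hmu_diff : forall m (x y : BA A), chom m x ->
    cdiff (hmu x y) = hmu (cdiff x) y + sg m *: hmu x (cdiff y);
  hmu_deconc : forall u w : seq (helt (@bhom k A)),
    deconc (hmu (word (hvals u)) (word (hvals w))) =
    \sum_(i < (size u).+1) \sum_(j < (size w).+1)
      sg (wdeg (drop i u) * wdeg (take j w)) *:
        tensor (hmu (word (hvals (take i u))) (word (hvals (take j w))))
               (hmu (word (hvals (drop i u))) (word (hvals (drop j w))));
  hmu_eps : forall x y : BA A, ceps (hmu x y) = ceps x * ceps y;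
  hE_ge2 : forall (u : seq (abar A)) (y : BA A),
    (2 <= size u)%N -> hE (word u) y = 0 }.

Definition is_hga_mor (A B : hga_data k) (phi : adga_mor A B) : Prop :=
  forall x y : BA A, phi (hE x y) = hE (bmap id phi id x) (bmap id phi id y).

(* The ground ring: B k = k, so that E([a], b) = 0 for b of length at least 1. *)
Definition k_hga : hga_data k :=
  @HgaData k (k_adga k) (fun x y => ceps x *: y).

End Hga.

Section RightBarProduct.
Variables (k : comNzRingType) (A A'' : hga_data k) (phi : adga_mor A A'').
Local Notation K := (k_adga k).
Local Notation BR := (bmod K A A'').

Definition rprod (x y : BR) : BR :=
  hlift (fun s : bsym K A A'' => hlift (fun t : bsym K A A'' =>
    let: (c, u, a'') := s in let: (e, w, b'') := t in
    ((hval c : k) * (hval e : k)) *: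
    (\sum_(i < (size w).+1) sg (hdeg a'' * wdeg (take i w)) *:
       ract (hmu (word (hvals u)) (word (hvals (take i w))))
            (hE (word [:: red (hval a'')])
                (bmap id phi id (word (hvals (drop i w)))) * hval b'')
     + ract (hmu (word (hvals u)) (word (hvals w)))
            ((aeps A'' (hval a'') : k) *: hval b''))) y) x.

(* y_1 ... y_n, for n >= 1 *)
Definition rprods (ys : seq BR) : BR :=
  if ys is y :: ys' then foldl rprod y ys' else bt 1 [::] 1.

Local Notation B := (bmod A A A'').

Definition Smap (x : B) : BR :=
  hlift (fun s => let: (a, w, a'') := s in
    bt (1 : K) (red (hval a) :: hvals w) (hval a'')) x.

Definition h2 (x y : B) : B :=
  hlift (fun s : bsym A A A'' => let: (a', w, a'') := s in
    sg (bdeg s) *: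
      lact (hval a') (rprod (bt (1 : K) (hvals w) (hval a'')) (Smap y))) x.

(* x |-> (-1)^|x| x *)
Definition ksign (x : B) : B := hlift (fun s => sg (bdeg s) *: bval s) x.

(* [hrec m] is h_{m+1}: the Koszul sign of 1^{(x) m} (x) h, with h of odd degree,
   is carried by the first m arguments. *)
Fixpoint hrec (m : nat) (xs : seq B) : B :=
  if m is m'.+1 then
    hrec m' (rcons (map ksign (take m' xs)) (h2 (nth 0 xs m') (nth 0 xs m'.+1)))
  else nth 0 xs 0.

Definition hn (xs : seq B) : B := hrec (size xs).-1 xs.

Definition f1 (x : B) : A'' :=
  hlift (fun s => let: (a', w, a'') := s in
    if w is [::] then phi (hval a') * hval a'' else 0) x.

(* f_n, where n is the length of the list of arguments *)
Definition fn (xs : seq B) : A'' := f1 (hn xs).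

End RightBarProduct.

Section AinfStructure.
Variables (k : comNzRingType) (A' A A'' : hga_data k).
Variables (phi' : adga_mor A A') (phi'' : adga_mor A A'').
Local Notation K := (k_adga k).
Local Notation B := (bmod A' A A'').
Local Notation hA := (helt (@bhom k A)).

(* A cut a'[a_1|...|a_i] , [a_(i+1)|...|a_n]a'' of a symbol. *)
Definition cut : Type :=
  ((helt (@ahom k A') * seq hA) * (seq hA * helt (@ahom k A'')))%type.

Definition cuts (s : bsym A' A A'') : seq cut :=
  let: (a', w, a'') := s in
  [seq ((a', take i w), (drop i w, a'')) | i <- iota 0 (size w).+1].

Fixpoint all_cuts (ss : seq (bsym A' A A'')) : seq (seq cut) :=
  if ss is s :: ss' then [seq c :: cs | c <- cuts s, cs <- all_cuts ss']
  else [:: [::]].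

Definition cut_ldeg (c : cut) : int := hdeg c.1.1 + wdeg c.1.2.
Definition cut_rdeg (c : cut) : int := wdeg c.2.1 + hdeg c.2.2.

(* the sum over i < j of |right part of c_i| |left part of c_j| *)
Fixpoint cross_deg (cs : seq cut) : int :=
  if cs is c :: cs' then
    cut_rdeg c * (\sum_(c' <- cs') cut_ldeg c') + cross_deg cs'
  else 0.

Definition push_word (w : seq hA) : seq (abar A') :=
  [seq red (phi' (aval a)) | a <- hvals w].

(* the left part of a cut, in B(A', A', k) *)
Definition cut_left (c : cut) : bmod A' A' (k_hga k) :=
  bt (hval c.1.1) (push_word c.1.2) 1.

(* the right part of a cut, in B(k, A, A'') *)
Definition cut_right (c : cut) : bmod K A A'' :=
  bt 1 (hvals c.2.1) (hval c.2.2).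

Definition mtilde_sym (ss : seq (bsym A' A A'')) : B :=
  \sum_(cs <- all_cuts ss)
    (if cs is c1 :: cs' then
       sg (cross_deg cs + (size cs)%:Z * hdeg c1.1.1
           + ((size cs)%:Z - 1) * wdeg c1.1.2) *:
       lact (hval c1.1.1 *
             hE (word (push_word c1.1.2))
                (Smap (hn (aug_mor A' : adga_mor A' (k_hga k)) (map cut_left cs'))))
            (rprods phi'' (map cut_right cs))
     else 0).

Definition m_sym (ss : seq (bsym A' A A'')) : B :=
  mtilde_sym ss +
  (if ss is [:: (a1', w1, a1''); (a2', w2, a2'')] then
     lact ((aeps A' (hval a2') : k) *: hval a1')
       (rprod phi'' (bt 1 (hvals w1) (hval a1'')) (bt 1 (hvals w2) (hval a2'')))
   else 0).

(* m_n, where n >= 2 is the length of the list of arguments *)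
Definition mn (xs : seq B) : B := mlift m_sym xs.

End AinfStructure.

Section AinfMorphism.
Variable k : comNzRingType.

(* A family of maps B^{(x) n} -> A, n >= 1, is a function on lists that is linear
   in every argument, the length of the list being n. *)
Definition multilinear (V W : lmodType k) (f : seq V -> W) : Prop :=
  forall l r : seq V, linear (fun x => f (l ++ x :: r)).

Definition hdegs (T : Type) (H : int -> T -> Prop) (xs : seq (helt H)) : int :=
  \sum_(x <- xs) hdeg x.

(* Augmented A_infty-morphisms from [B] with operations [m] to the dga [A]. The
   relations are evaluated on homogeneous arguments x_1, ..., x_n; a map of degree
   q moved past x_1, ..., x_i contributes the sign (-1)^{q(|x_1| + ... + |x_i|)}. *)
Record is_aug_ainf_mor (B : cpx k) (m : seq B -> B) (A : adga k)
    (f : seq B -> A) : Prop := IsAugAinfMor {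
  ainf_multilinear : multilinear f;
  ainf_hom : forall xs : seq (helt (@chom k B)), (0 < size xs)%N ->
    ahom (hdegs xs + 1 - (size xs)%:Z) (f (hvals xs));
  ainf_rel : forall xs : seq (helt (@chom k B)), (0 < size xs)%N ->
    let n := size xs in
    let D i := hdegs (take i xs) in
    let x := hvals xs in
    adiff A (f x) -
      sg (1 - n%:Z) *: \sum_(0 <= i < n) sg (D i) *:
        f (take i x ++ map (@cdiff k B) (take 1 (drop i x)) ++ drop i.+1 x)
    = \sum_(1 <= l < n) sg (l%:Z + (1 - (n%:Z - l%:Z)) * D l) *:
        (f (take l x) * f (drop l x))
      + \sum_(2 <= l < n.+1) \sum_(0 <= i < (n - l)%N.+1)
          sg (i%:Z + l%:Z * (n%:Z - i%:Z - l%:Z) + (2 - l%:Z) * D i) *: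
          f (take i x ++ m (take l (drop i x)) :: drop (i + l)%N x);
  ainf_one : f [:: cone B] = 1;
  ainf_unit : forall l r : seq B, (0 < size l + size r)%N ->
    f (l ++ cone B :: r) = 0;
  ainf_eps1 : forall x : B, aeps A (f [:: x]) = ceps x;
  ainf_eps : forall xs : seq B, (2 <= size xs)%N -> aeps A (f xs) = 0 }.

Record is_strict_mor (B : cpx k) (m : seq B -> B) (C : cpx k) (m' : seq C -> C)
    (g : B -> C) : Prop := IsStrictMor {
  strict_linear : linear g;
  strict_hom : forall n x, chom n x -> chom n (g x);
  strict_diff : forall x, g (cdiff x) = cdiff (g x);
  strict_ainf : forall xs, (2 <= size xs)%N -> g (m xs) = m' (map g xs);
  strict_one : g (cone B) = cone C;
  strict_eps : forall x, ceps (g x) = ceps x }.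

End AinfMorphism.

(* Main.v *)
(* Let R = B(k, A, A''). The operation a <| y = E([a], y) + eps(a) eps(y) is a right
   action of the algebra BA on A'', and the hga axioms turn R into the smash product
   of BA and A''; hence R is an associative dga and deconcatenation R -> BA (x) R is
   multiplicative. Now B(A, A, A'') is a right R-module, h(x, y) = +-x.S(y), and
   d S + S d = eps (x) 1 - iota f_1 for the inclusion iota of A'' in R. This gives
   d(h)(x, y) = m_2(x, y) - x.iota f_1(y).
   Deconcatenating h_n(x_1, ..., x_n) amounts to cutting x_1, ..., x_l for some l and
   multiplying the right parts by S h_{n-l}(x_{l+1}, ..., x_n). Hence
   m_2(x_1, h_{n-1}(x_2, ..., x_n)) = sum_l +-h_{n-l+1}(m_l(x_1, ..., x_l), ...),
   and by induction d(h_n) is the sum of the terms +-h_l(...).iota f_{n-l}(...) and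
   +-h_{n-l+1}(..., m_l(...), ...). Applying f_1, a chain map that is linear over A'',
   gives the relations for (f_n). The map of the second part is strict because every
   ingredient is natural: the products on the bar constructions are determined by E. *)

Require Import Defs.
From HB Require Import structures.
From mathcomp Require Import all_boot all_order all_algebra.
From mathcomp Require Import boolp freeg zify ring.

Set Implicit Arguments.
Unset Strict Implicit.
Unset Printing Implicit Defensive.

Import GRing.Theory.
Local Open Scope ring_scope.

(** * Linearity on homogeneous elements *)

(** What shapes the proof is that [hlift] evaluates a formula on a decomposition picked by choice,
    so a formula is usable only once it is known to be linear in each homogeneous entry of a symbol.
    Signs depend on degrees; hence this linearity is asked within one degree at a time ([elin],
    [wlin], [slin]). Formulas without signs come from the universal property of the quotient and
    hold on all symbols.

    Coproducts are paired with a bilinear [G] ([cop], [coR]) instead of being written in a tensor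
    product. A sum over all cuts can then be defined by recursion with [G] as accumulator, and the
    Koszul sign of an operator moved past an element becomes the linear map [bsg n].

    Each law of the action a <| y has its own source: associativity of mu for the first, the
    Maurer-Cartan equation of the canonical twisting cochain, at [a|b].w and at [a].w, for the other
    two. In the Leibniz rule of R, the one correction term of d(a <| y) without a counterpart in the
    factors cancels against the counit part of E.

    Relations are proved on symbols and carried over to homogeneous arguments with the degrees in
    the signs held fixed. *)

Section Linear.
Variables (k : comNzRingType) (U V W : lmodType k).

Lemma islin_id : linear (fun x : V => x).
Proof. by []. Qed.

Lemma islin_comp (g : V -> W) (f : U -> V) :
  linear g -> linear f -> linear (fun x => g (f x)).
Proof. by move=> gl fl c x y; rewrite fl gl. Qed.

Lemma islin_add (f g : V -> W) :
  linear f -> linear g -> linear (fun x => f x + g x).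
Proof. by move=> fl gl c x y; rewrite fl gl scalerDr addrACA. Qed.

Lemma islin_scale (a : k) (f : V -> W) :
  linear f -> linear (fun x => a *: f x).
Proof. by move=> fl c x y; rewrite fl scalerDr !scalerA mulrC. Qed.

Lemma islin_opp (f : V -> W) : linear f -> linear (fun x => - f x).
Proof. by move=> fl c x y; rewrite fl opprD scalerN. Qed.

Lemma islin_zero : linear (fun _ : V => 0 : W).
Proof. by move=> c x y; rewrite scaler0 addr0. Qed.

Lemma islin_sum (I : Type) (s : seq I) (P : pred I) (F : I -> V -> W) :
  (forall i, linear (F i)) -> linear (fun x => \sum_(i <- s | P i) F i x).
Proof.
move=> Fl c x y; rewrite scaler_sumr -big_split /=.
by apply: eq_bigr => i _; rewrite Fl.
Qed.

Variables (f : V -> W) (fl : linear f).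

Lemma lin0 : f 0 = 0.
Proof. by have := fl (- 1) 0 0; rewrite scaler0 addr0 scaleN1r addNr. Qed.

Lemma linZ c x : f (c *: x) = c *: f x.
Proof. by have := fl c x 0; rewrite lin0 !addr0. Qed.

Lemma linD x y : f (x + y) = f x + f y.
Proof. by have := fl 1 x y; rewrite !scale1r. Qed.

Lemma linN x : f (- x) = - f x.
Proof. by rewrite -scaleN1r linZ scaleN1r. Qed.

Lemma linB x y : f (x - y) = f x - f y.
Proof. by rewrite linD linN. Qed.

Lemma lin_sum (I : Type) (s : seq I) (P : pred I) (F : I -> V) :
  f (\sum_(i <- s | P i) F i) = \sum_(i <- s | P i) f (F i).
Proof.
elim: s => [|i s IH]; first by rewrite !big_nil lin0.
by rewrite !big_cons; case: (P i) => //; rewrite linD IH.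
Qed.

End Linear.

(** * Signs and parities *)

Section Sign.
Variable k : comNzRingType.
Implicit Types m n : int.

Definition par n := odd `|n|%N.

Lemma sgE n : sg n = (-1) ^+ par n :> k.
Proof. by rewrite /sg signr_odd. Qed.

Lemma parN n : par (- n) = par n.
Proof. by rewrite /par abszN. Qed.

Lemma parD m n : par (m + n) = par m (+) par n.
Proof. rewrite /par; lia. Qed.

Lemma parM m n : par (m * n) = par m && par n.
Proof. by rewrite /par abszM oddM. Qed.

Lemma parS (n : nat) : par n.+1 = ~~ par n.
Proof. by []. Qed.

Lemma parDn (m n : nat) : par (m + n)%N = par m (+) par n.
Proof. by rewrite /par /= oddD. Qed.

Lemma par0 : par 0 = false. Proof. by []. Qed.

Lemma par1 : par 1 = true. Proof. by []. Qed.

Lemma par_eq m n : par m = par n -> sg m = sg n :> k.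
Proof. by rewrite !sgE => ->. Qed.

Lemma sgD m n : sg (m + n) = sg m * sg n :> k.
Proof. by rewrite !sgE parD signr_addb. Qed.

Lemma sg0 : sg 0 = 1 :> k.
Proof. by []. Qed.

Lemma sg_sq n : sg n * sg n = 1 :> k.
Proof. by rewrite -sgD (@par_eq (n + n) 0) // parD addbb. Qed.

Lemma sgZK n (V : lmodType k) (x : V) : sg n *: (sg n *: x) = x.
Proof. by rewrite scalerA sg_sq scale1r. Qed.

Lemma sgN m : sg (m + 1) = - sg m :> k.
Proof. by rewrite sgD !sgE /= mulrN1. Qed.

End Sign.

(** Parity turns sums into exclusive or and products into conjunction, so an equality of two sign
    exponents is a boolean identity in the parities of the atoms and is checked by cases. *)
Ltac par_solve :=
  rewrite ?(parD, parM, parN, parS, parDn, par0, par1);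
  repeat match goal with |- context [par ?x] => case: (par x) end; by [].

(** * Extending degreewise linear maps from homogeneous elements *)

Section Extension.
Variables (k : comNzRingType) (V : lmodType k) (H : int -> V -> Prop).
Hypothesis gH : is_grading H.

Lemma H_sum (I : Type) (s : seq I) (P : pred I) (u : I -> V) n :
  (forall i, P i -> H n (u i)) -> H n (\sum_(i <- s | P i) u i).
Proof.
move=> hu; elim: s => [|i s IH]; first by rewrite big_nil; exact: grad0 gH n.
rewrite big_cons; case: ifP => [/hu Pi|_] //.
by rewrite -[u i]scale1r; apply: gradZD gH n _ _ _ Pi IH.
Qed.

Lemma gradZ n c x : H n x -> H n (c *: x).
Proof. by move=> hx; rewrite -[_ *: _]addr0; apply: gradZD => //; exact: grad0 gH n. Qed.

Lemma hdec_exists (x : V) : exists l : seq (helt H), x = \sum_(h <- l) hval h.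
Proof.
have [s [u [hu ->]]] := grad_sum gH x.
by exists [seq Helt (hu n) | n <- s]; rewrite big_map.
Qed.

Definition hdec (x : V) : seq (helt H) := sval (cid (hdec_exists x)).

Lemma hdecE x : \sum_(h <- hdec x) hval h = x.
Proof. by rewrite /hdec; case: cid => l /= ->. Qed.

(* Linearity is only asked within a fixed degree, so that [F] may involve signs
   depending on the degree of its argument. *)
Definition elin (N : lmodType k) (F : helt H -> N) := forall c (h h1 h2 : helt H),
  hdeg h1 = hdeg h -> hdeg h2 = hdeg h -> hval h = c *: hval h1 + hval h2 ->
  F h = c *: F h1 + F h2.

Section Elin.
Variables (N : lmodType k) (F : helt H -> N).
Hypothesis eF : elin F.

Lemma elin0 h : hval h = 0 -> F h = 0.
Proof.
move=> h0; have := @eF (-1) h h h erefl erefl; rewrite h0 scaler0 addr0.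
by rewrite scaleN1r addNr; exact.
Qed.

Lemma elin_deg (l : seq (helt H)) n h : hdeg h = n ->
  hval h = \sum_(x <- l | hdeg x == n) hval x ->
  \sum_(x <- l | hdeg x == n) F x = F h.
Proof.
elim: l h => [|x l IH] h hn; first by rewrite !big_nil => /elin0 ->.
rewrite !big_cons; case: ifP => [/eqP xn|_]; last exact: IH.
have hs : H n (\sum_(x <- l | hdeg x == n) hval x).
  by apply: H_sum => y /eqP <-; exact: hvalP.
move=> hx; rewrite (IH (Helt hs)) // -[F x]scale1r; symmetry; apply: eF.
- by rewrite xn.
- by rewrite hn.
- by rewrite scale1r.
Qed.

Lemma sum_by_deg (T : lmodType k) (f : helt H -> T) (l : seq (helt H)) :
  \sum_(h <- l) f h = \sum_(n <- undup (map (@hdeg _ _) l)) \sum_(h <- l | hdeg h == n) f h.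
Proof.
set D := undup _; have: all (fun h => hdeg h \in D) l.
  by rewrite -(all_map _ (fun n => n \in D)); apply/allP => n; rewrite mem_undup.
have uD : uniq D by exact: undup_uniq.
elim: {1 2 3}l => [|h s IH] /=; first by rewrite big_nil big1 // => n; rewrite big_nil.
move=> /andP[hD sD]; rewrite big_cons IH // (bigD1_seq _ hD uD).
rewrite [in RHS](bigD1_seq _ hD uD) /= big_cons eqxx -addrA; congr (_ + (_ + _)).
by apply: eq_bigr => n /negbTE nh; rewrite big_cons eq_sym nh.
Qed.

(** [grad_direct] splits a relation between elements of mixed degrees into one relation per degree,
    and within one degree [F] is linear. *)
Lemma elin_sum0 (l : seq (helt H)) :
  \sum_(h <- l) hval h = 0 -> \sum_(h <- l) F h = 0.
Proof.
rewrite !sum_by_deg => l0; rewrite big_seq big1 // => n nl.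
have hs m : H m (\sum_(x <- l | hdeg x == m) hval x).
  by apply: H_sum => y /eqP <-; exact: hvalP.
rewrite (@elin_deg l n (Helt (hs n))) //; apply: elin0 => /=.
exact: (grad_direct gH (undup_uniq _) hs l0).
Qed.

Definition ext (x : V) : N := \sum_(h <- hdec x) F h.

Definition hscale (c : k) (h : helt H) : helt H :=
  Helt (gradZ c (hvalP h)).

Lemma elinZ c h : F (hscale c h) = c *: F h.
Proof.
have h0 : H (hdeg h) 0 by exact: grad0 gH _.
rewrite (@eF c (hscale c h) h (Helt h0)) //=; last by rewrite addr0.
by rewrite [X in _ + X]elin0 // addr0.
Qed.

(** Together with the negative of the given list, obtained by [hscale (-1)], the list chosen by
    [hdec] is a decomposition of 0. *)
Lemma ext_unique (l : seq (helt H)) x : x = \sum_(h <- l) hval h ->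
  ext x = \sum_(h <- l) F h.
Proof.
move=> xl; apply/eqP; rewrite -subr_eq0 -scaleN1r scaler_sumr /ext.
under [X in _ + X]eq_bigr do rewrite -elinZ.
rewrite -(big_map (hscale (-1)) predT) -big_cat; apply/eqP/elin_sum0.
rewrite big_cat big_map /= hdecE -scaler_sumr -xl.
by rewrite scaleN1r subrr.
Qed.

Lemma ext_hval h : ext (hval h) = F h.
Proof. by rewrite (@ext_unique [:: h]) big_seq1. Qed.

Lemma ext_linear : linear ext.
Proof.
move=> c x y.
rewrite (@ext_unique (map (hscale c) (hdec x) ++ hdec y)).
  by rewrite big_cat big_map /= scaler_sumr; congr (_ + _); apply: eq_bigr => h _; rewrite elinZ.
by rewrite big_cat big_map /= -scaler_sumr !hdecE.
Qed.

End Elin.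

Lemma elin_sum (N : lmodType k) (I : Type) (s : seq I) (P : pred I) (F : I -> helt H -> N) :
  (forall i, elin (F i)) -> elin (fun h => \sum_(i <- s | P i) F i h).
Proof.
move=> eF c h h1 h2 d1 d2 hh; rewrite scaler_sumr -big_split /=.
by apply: eq_bigr => i _; apply: eF.
Qed.

Lemma elin_comp (N P : lmodType k) (L : N -> P) (F : helt H -> N) :
  linear L -> elin F -> elin (fun h => L (F h)).
Proof. by move=> Ll eF c h h1 h2 d1 d2 hh; rewrite (eF c h h1 h2) // Ll. Qed.

Lemma elin_hval (N : lmodType k) (L : V -> N) :
  linear L -> elin (fun h => L (hval h)).
Proof. by move=> Ll c h h1 h2 d1 d2 ->; rewrite Ll. Qed.

Lemma elin_add (N : lmodType k) (F G : helt H -> N) :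
  elin F -> elin G -> elin (fun h => F h + G h).
Proof.
by move=> eF eG c h h1 h2 ? ? ?; rewrite (eF c h h1 h2) // (eG c h h1 h2) // scalerDr addrACA.
Qed.

Lemma elin_scale (N : lmodType k) (a : int -> k) (F : helt H -> N) :
  elin F -> elin (fun h => a (hdeg h) *: F h).
Proof.
move=> eF c h h1 h2 d1 d2 hh; rewrite (eF c h h1 h2) // d1 d2 scalerDr.
by rewrite !scalerA mulrC.
Qed.

Lemma elin0F (N : lmodType k) : elin (fun _ => 0 : N).
Proof. by move=> c h h1 h2 *; rewrite scaler0 addr0. Qed.

Fixpoint hdecw (w : seq V) : seq (seq (helt H)) :=
  if w is a :: w' then [seq h :: hs | h <- hdec a, hs <- hdecw w'] else [:: [::]].

Definition wlin (N : lmodType k) (F : seq (helt H) -> N) :=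
  forall u v, elin (fun h => F (u ++ h :: v)).

Definition extw (N : lmodType k) (F : seq (helt H) -> N) (w : seq V) : N :=
  \sum_(hs <- hdecw w) F hs.

Lemma extw_cons (N : lmodType k) (F : seq (helt H) -> N) a w :
  extw F (a :: w) = ext (fun h => extw (fun hs => F (h :: hs)) w) a.
Proof. by rewrite /extw /= big_allpairs_dep. Qed.

Lemma wlin_head (N : lmodType k) (F : seq (helt H) -> N) w :
  wlin F -> elin (fun h => extw (fun hs => F (h :: hs)) w).
Proof. by move=> wF; apply: elin_sum => hs; exact: (wF [::] hs). Qed.

Lemma wlin_tail (N : lmodType k) (F : seq (helt H) -> N) h :
  wlin F -> wlin (fun hs => F (h :: hs)).
Proof. by move=> wF u v; exact: (wF (h :: u) v). Qed.

Lemma extw_map (N : lmodType k) (F : seq (helt H) -> N) (hs : seq (helt H)) :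
  wlin F -> extw F (map (@hval _ _) hs) = F hs.
Proof.
elim: hs F => [|h hs IH] F wF; first by rewrite /extw big_seq1.
rewrite map_cons extw_cons ext_hval; last exact: wlin_head.
exact: (IH (fun hs => F (h :: hs)) (wlin_tail h wF)).
Qed.

Lemma extw_linear (N : lmodType k) (F : seq (helt H) -> N) u v :
  wlin F -> linear (fun x => extw F (u ++ x :: v)).
Proof.
elim: u F => [|a u IH] F wF /=.
  move=> c x y; rewrite !extw_cons; apply: ext_linear; exact: wlin_head.
move=> c x y; rewrite !extw_cons /ext scaler_sumr -big_split /=.
by apply: eq_bigr => h _; exact: (IH (fun hs => F (h :: hs)) (wlin_tail h wF) c x y).
Qed.

End Extension.

(** * Universal properties of the quotient modules *)

Section Universal.
Variable k : comNzRingType.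

Lemma freeg_lift (X : choiceType) (N : lmodType k) (g : X -> N) :
  exists L : {freeg X / k} -> N, linear L /\ forall x, L (fgen k x) = g x.
Proof.
have add D E : fglift g (D + E) = fglift g D + fglift g E.
  (* [lift_is_additive] concerns differences, so the sum is read as D - (- E), and the value at - E
     is taken from 0 - E. *)
  have := lift_is_additive g D (- E); rewrite opprK => ->; congr (_ + _).
  have /eqP := lift_is_additive g 0 E; have := lift_is_additive g E E.
  rewrite subrr sub0r subrr => ->; rewrite sub0r => /eqP ->.
  by rewrite opprK.
have sm (s : seq X) (F : X -> {freeg X / k}) :
    fglift g (\sum_(x <- s) F x) = \sum_(x <- s) fglift g (F x).
  elim: s => [|x s IH]; last by rewrite !big_cons add IH.
  by rewrite !big_nil -(subrr (0 : {freeg X / k})) lift_is_additive subrr.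
exists (fglift g); split=> [c D E|x]; last by rewrite liftU scale1r.
rewrite add; congr (_ + _); rewrite -{2}[D]freeg_sumE sm [c *: D]/(fgscale c D) sm.
by rewrite scaler_sumr; apply: eq_bigr => x _; rewrite !liftU scalerA.
Qed.

Lemma qmod_lift (M N : lmodType k) (R : M -> Prop) (f : M -> N) :
  linear f -> (forall x, R x -> f x = 0) ->
  exists L : qmod R -> N, linear L /\ forall x, L (qmod_pi R x) = f x.
Proof.
move=> fl f0; have fpi x y : qmod_pi R x = qmod_pi R y -> f x = f y.
  move=> /qmod_piP /asboolP [l [Rl xy]]; apply/eqP; rewrite -subr_eq0 -(linB fl) xy.
  rewrite (lin_sum fl) big_seq big1 // => p pl.
  by rewrite (linZ fl) f0 ?scaler0 //; exact: Rl.
exists (fun x => f (repr x)); split=> [c x y|x]; last by apply: fpi; rewrite qmod_piK.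
by rewrite -fl; apply: fpi; rewrite qmod_pi_linear !qmod_piK.
Qed.

Definition bilin (U V W : lmodType k) (f : U -> V -> W) : Prop :=
  (forall y, linear (f^~ y)) /\ (forall x, linear (f x)).

Lemma tens_lift (M N P : lmodType k) (f : M -> N -> P) : bilin f ->
  exists L : tens M N -> P, linear L /\ forall x y, L (tensor x y) = f x y.
Proof.
move=> [fl fr]; have [g [gl gE]] := freeg_lift (fun p : M * N => f p.1 p.2).
have [|L [Ll LE]] := @qmod_lift _ _ (@tens_rel k M N) g gl.
  move=> _ [c x x' y|c x y y']; rewrite (linB gl) gl !gE /=.
    by rewrite fl subrr.
  by rewrite fr subrr.
by exists L; split=> // x y; rewrite /tensor LE gE.
Qed.

(** The universal property of the bar module, for formulas without degree-dependent signs. It gives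
    the values on all symbols [bt], not only on those with homogeneous entries. *)
Lemma bmod_lift (A' A A'' : adga k) (N : lmodType k)
    (G : A' -> seq (abar A) -> A'' -> N) :
  (forall w a'', linear (fun a' => G a' w a'')) ->
  (forall a' u v a'', linear (fun x => G a' (u ++ x :: v) a'')) ->
  (forall a' w, linear (G a' w)) ->
  exists L : bmod A' A A'' -> N, linear L /\ forall a' w a'', L (bt a' w a'') = G a' w a''.
Proof.
move=> Gl Gm Gr.
have [g [gl gE]] := freeg_lift (fun p : A' * seq (abar A) * A'' => G p.1.1 p.1.2 p.2).
have [|L [Ll LE]] := @qmod_lift _ _ (@bar_rel k A' A A'') g gl.
  move=> _ [c a1 a2 w a''|c a' u a1 a2 v a''|c a' w a1 a2]; rewrite (linB gl) gl !gE /=.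
  - by rewrite Gl subrr.
  - by rewrite Gm subrr.
  - by rewrite Gr subrr.
by exists L; split=> // a' w a''; rewrite /bt LE gE.
Qed.

Lemma bhom_grading (A : adga k) : is_grading (@bhom k A).
Proof.
split=> [n|n c x y hx hy|x|s u us hu s0 n ns].
- exact: (grad0 (ahom_grading A)).
- exact: (gradZD (ahom_grading A) c hx hy).
- have [s [u [hu xE]]] := grad_sum (ahom_grading A) (aval x).
  exists s, (fun n => red (u n)); split; first by move=> n; exact: bhom_red.
  by rewrite -(lin_sum (@red_linear _ A)) -xE redK.
- apply/val_inj; rewrite /= -[LHS]/(\val (u n)).
  have := grad_direct (ahom_grading A) (u := fun n => aval (u n)) us hu _ ns; apply.
  by move/(congr1 val): s0; rewrite raddf_sum.
Qed.

End Universal.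

(** * Evaluating [hlift] on symbols *)

Section Hlift.
Variables (k : comNzRingType) (A' A A'' : adga k).
Local Notation B := (bmod A' A A'').

Definition slin (N : lmodType k) (F : bsym A' A A'' -> N) : Prop :=
  [/\ forall w a'', elin (fun a' => F (a', w, a'')),
      forall a' a'', wlin (fun w => F (a', w, a''))
    & forall a' w, elin (fun a'' => F (a', w, a''))].

Lemma bval_slin : slin (@bval k A' A A'').
Proof.
split=> [w a''|a' a'' u v|a' w] c h h1 h2 d1 d2 hh.
- by rewrite /bval /= hh bt_l.
- by rewrite /bval /= !map_cat /= hh bt_m.
- by rewrite /bval /= hh bt_r.
Qed.

Lemma slin_comp (N P : lmodType k) (L : N -> P) (F : bsym A' A A'' -> N) :
  linear L -> slin F -> slin (fun s => L (F s)).
Proof.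
move=> Ll [F1 F2 F3]; split=> [w a''|a' a'' u v|a' w].
- exact: elin_comp Ll (F1 w a'').
- exact: elin_comp Ll (F2 a' a'' u v).
- exact: elin_comp Ll (F3 a' w).
Qed.

Lemma slin_sum (N : lmodType k) (I : Type) (s : seq I) (P : pred I)
    (F : I -> bsym A' A A'' -> N) :
  (forall i, slin (F i)) -> slin (fun x => \sum_(i <- s | P i) F i x).
Proof.
move=> Fl; split=> [w a''|a' a'' u v|a' w]; apply: elin_sum => i; case: (Fl i) => // _ F2 _.
exact: F2.
Qed.

Lemma decE (x : B) : \sum_(p <- dec x) p.1 *: bval p.2 = x.
Proof. by rewrite /dec; case: cid => l /= <-. Qed.

Section Sym.
Variables (N : lmodType k) (F : bsym A' A A'' -> N).
Hypothesis Fs : slin F.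

(** [F] is extended from homogeneous entries to arbitrary ones slot by slot, and the result respects
    the relations of the quotient. Any such [L] agrees with [hlift F], whatever decomposition was
    picked. *)
Lemma hlift_ex : exists L : B -> N, linear L /\ forall s, L (bval s) = F s.
Proof.
have [F1 F2 F3] := Fs; have gA' := ahom_grading A'; have gA'' := ahom_grading A''.
have gb := bhom_grading A.
pose G a' w a'' := ext gA' (fun h => extw gb (fun hs => ext gA'' (fun h'' => F (h, hs, h'')) a'') w) a'.
have e3 h hs : linear (ext gA'' (fun h'' => F (h, hs, h''))).
  by apply: ext_linear; exact: F3.
have e2 h a'' : wlin (fun hs => ext gA'' (fun h'' => F (h, hs, h'')) a'').
  by move=> u v; apply: elin_sum => h''; exact: F2.
have e1 w a'' : elin (fun h => extw gb (fun hs => ext gA'' (fun h'' => F (h, hs, h'')) a'') w).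
  by apply: elin_sum => hs; apply: elin_sum => h''; exact: F1.
have [w a''|a' u v a''|a' w|L [Ll LE]] := @bmod_lift _ A' A A'' N G.
- exact: ext_linear.
- move=> c x y; rewrite /G /ext scaler_sumr -big_split /=; apply: eq_bigr => h _.
  exact: (extw_linear gb u v (e2 h a'') c x y).
- move=> c x y; rewrite /G /ext /extw scaler_sumr -big_split /=; apply: eq_bigr => h _.
  rewrite scaler_sumr -big_split /=; apply: eq_bigr => hs _; exact: (e3 h hs c x y).
exists L; split=> // -[[a' w] a'']; rewrite /bval LE /= /G ext_hval // extw_map //.
exact: ext_hval.
Qed.

Lemma hlift_linear : linear (hlift F).
Proof.
have [L [Ll LE]] := hlift_ex; have hE x : hlift F x = L x.
  rewrite -[in RHS](decE x) (lin_sum Ll); apply: eq_bigr => p _.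
  by rewrite (linZ Ll) LE.
by move=> c x y; rewrite !hE Ll.
Qed.

Lemma hliftE s : hlift F (bval s) = F s.
Proof.
have [L [Ll LE]] := hlift_ex; rewrite -LE -[in RHS](decE (bval s)).
by rewrite (lin_sum Ll); apply: eq_bigr => p _; rewrite (linZ Ll) LE.
Qed.

End Sym.

(** A linear map that is already at hand absorbs the chosen decomposition. In this way maps given by
    sign-free formulas are identified with the output of [bmod_lift]. *)
Lemma hlift_lin (N : lmodType k) (L : B -> N) (F : bsym A' A A'' -> N) :
  linear L -> (forall s, F s = L (bval s)) -> hlift F = L.
Proof.
move=> Ll FE; apply: funext => x; rewrite -[in RHS](decE x).
by rewrite (lin_sum Ll); apply: eq_bigr => p _; rewrite (linZ Ll) FE.
Qed.

Lemma lin_bval_eq (N : lmodType k) (L L' : B -> N) :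
  linear L -> linear L' -> (forall s, L (bval s) = L' (bval s)) -> L = L'.
Proof. by move=> Ll Ll' LL'; rewrite -(hlift_lin Ll' LL'); apply/esym/hlift_lin. Qed.

End Hlift.

(** * Deconcatenation of words *)

Section Splits.
Variable T : Type.
Implicit Types u v w : seq T.

(** Recursion on the word replaces the indices of [take] and [drop], so that sums over cuts can be
    treated by induction. *)
Fixpoint splits w : seq (seq T * seq T) :=
  ([::], w) :: (if w is a :: w' then [seq (a :: p.1, p.2) | p <- splits w'] else [::]).

Lemma splits_iota w : [seq (take i w, drop i w) | i <- iota 0 (size w).+1] = splits w.
Proof.
elim: w => // a w IH; rewrite [splits _]/= -IH -map_comp.
by rewrite -[iota 0 _]/(0%N :: iota 1 (size w).+1) (iotaDl 1 0) map_cons -map_comp.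
Qed.

Variables (k : comNzRingType) (N : lmodType k).

Lemma sum_splits (F : seq T -> seq T -> N) w :
  \sum_(i < (size w).+1) F (take i w) (drop i w) = \sum_(p <- splits w) F p.1 p.2.
Proof. by rewrite -splits_iota big_map -(big_mkord xpredT (fun i => F (take i w) (drop i w))) /index_iota subn0. Qed.

(** The sums in [bar_diff] stop before [i = size w]; the vanishing of [F u [::]] allows the last
    index to be added. *)
Lemma sum_splits_lt (F : seq T -> seq T -> N) w : (forall u, F u [::] = 0) ->
  \sum_(i < size w) F (take i w) (drop i w) = \sum_(p <- splits w) F p.1 p.2.
Proof. by move=> F0; rewrite -sum_splits big_ord_recr /= drop_size F0 addr0. Qed.

Lemma splits_cons (F : seq T -> seq T -> N) a w :
  \sum_(p <- splits (a :: w)) F p.1 p.2 =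
  F [::] (a :: w) + \sum_(p <- splits w) F (a :: p.1) p.2.
Proof. by rewrite /= big_cons big_map. Qed.

Lemma splits_nil (F : seq T -> seq T -> N) :
  \sum_(p <- splits [::]) F p.1 p.2 = F [::] [::].
Proof. by rewrite big_seq1. Qed.

(** Coassociativity of deconcatenation. *)
Lemma splitsA (F : seq T -> seq T -> seq T -> N) w :
  \sum_(p <- splits w) \sum_(q <- splits p.1) F q.1 q.2 p.2 =
  \sum_(p <- splits w) \sum_(q <- splits p.2) F p.1 q.1 q.2.
Proof.
elim: w F => [|a w IH] F; first by rewrite !big_seq1.
rewrite (splits_cons (fun u v => \sum_(q <- splits u) F q.1 q.2 v)).
rewrite (splits_cons (fun u v => \sum_(q <- splits v) F u q.1 q.2)) big_seq1 /=.
rewrite (splits_cons (F [::])) -(IH (fun x y z => F (a :: x) y z)) -addrA; congr (_ + _); rewrite -big_split /=.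
by apply: eq_bigr => p _; rewrite (splits_cons (fun x y => F x y p.2)).
Qed.

End Splits.

Section SplitsLinear.
Variables (k : comNzRingType) (V N : lmodType k) (H : int -> V -> Prop).
Implicit Types u v w : seq (helt H).

Lemma wlin_splits (G : seq (helt H) -> seq (helt H) -> N) :
  (forall v, wlin (G^~ v)) -> (forall u, wlin (G u)) ->
  wlin (fun w => \sum_(p <- splits w) G p.1 p.2).
Proof.
move=> Gl Gr u v; elim: u G Gl Gr => [|a u IH] G Gl Gr /=.
  have e1 : elin (fun h => G [::] (h :: v)) by exact: (Gr [::] [::]).
  have e2 : elin (fun h => \sum_(p <- splits v) G (h :: p.1) p.2).
    by apply: elin_sum => p; exact: (Gl _ [::]).
  move=> c h h1 h2 d1 d2 hh; rewrite !(splits_cons G).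
  exact: (elin_add e1 e2).
have e1 : elin (fun h => G [::] (a :: u ++ h :: v)) by exact: (Gr [::] (a :: u)).
have e2 : elin (fun h => \sum_(p <- splits (u ++ h :: v)) G (a :: p.1) p.2).
  by apply: (IH (fun x y => G (a :: x) y)) => [v'|u']; [move=> x y; exact: (Gl v' (a :: x))|exact: Gr].
move=> c h h1 h2 d1 d2 hh; rewrite !(splits_cons G).
exact: (elin_add e1 e2).
Qed.

Lemma wlin_scale (a : seq int -> k) (F : seq (helt H) -> N) :
  wlin F -> wlin (fun w => a (map (@hdeg _ _) w) *: F w).
Proof.
move=> Fl u v c h h1 h2 d1 d2 hh; rewrite (Fl u v c h h1 h2) // !map_cat /= d1 d2.
by rewrite scalerDr !scalerA mulrC.
Qed.

Lemma wlin_add (F G : seq (helt H) -> N) : wlin F -> wlin G -> wlin (fun w => F w + G w).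
Proof. by move=> Fl Gl u v; exact: elin_add. Qed.

End SplitsLinear.

(** * Maps on bar modules *)

Section BasicMaps.
Variables (k : comNzRingType).

Section Bt.
Variables (A' A A'' : adga k).
Local Notation B := (bmod A' A A'').

Lemma bt_linl w a'' : linear (fun a' => bt a' w a'' : B).
Proof. by move=> c x y; exact: bt_l. Qed.

Lemma bt_linm a' u v a'' : linear (fun a => bt a' (u ++ a :: v) a'' : B).
Proof. by move=> c x y; exact: bt_m. Qed.

Lemma bt_linh a' v a'' : linear (fun a => bt a' (a :: v) a'' : B).
Proof. by move=> c x y; exact: (bt_m _ _ [::]). Qed.

Lemma bt_linr a' w : linear (fun a'' => bt a' w a'' : B).
Proof. by move=> c x y; exact: bt_r. Qed.

Lemma bt_wlin (N : lmodType k) (L : B -> N) a' a'' :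
  linear L -> wlin (fun w : seq (helt (@bhom k A)) => L (bt a' (hvals w) a'')).
Proof.
move=> Ll u v c h h1 h2 _ _ hh; rewrite /hvals !map_cat /= hh.
by rewrite bt_m Ll.
Qed.
End Bt.

Section KLeft.
Variables (A A'' : adga k).
Local Notation K := (k_adga k).
Local Notation R := (bmod K A A'').

Lemma bt1 (c : K) w a'' : bt c w a'' = (c : k) *: (bt (1 : K) w a'' : R).
Proof. by rewrite -(linZ (bt_linl w a'')) /GRing.scale /= mulr1. Qed.

Lemma R_lin_eq (N : lmodType k) (L L' : R -> N) : linear L -> linear L' ->
  (forall (w : seq (helt (@bhom k A))) (a'' : helt (@ahom k A'')),
     L (bt (1 : K) (hvals w) (hval a'')) = L' (bt (1 : K) (hvals w) (hval a''))) ->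
  L = L'.
Proof.
move=> Ll Ll' LL'; apply: lin_bval_eq => // -[[c w] a''].
by rewrite /bval /= bt1 (linZ Ll) (linZ Ll'); congr (_ *: _); exact: LL'.
Qed.

Lemma slin_R (N : lmodType k) (F : seq (helt (@bhom k A)) -> helt (@ahom k A'') -> N) :
  (forall a'', wlin (F^~ a'')) -> (forall w, elin (F w)) ->
  slin (fun s : bsym K A A'' => let: (c, w, a'') := s in (hval c : k) *: F w a'').
Proof.
move=> F2 F3; split=> [w a''|c a'' u v|c w].
- by move=> c h h1 h2 _ _ ->; rewrite scalerDl scalerA.
- move=> e h h1 h2 d1 d2 hh; rewrite (F2 a'' u v e h h1 h2) // scalerDr !scalerA.
  by rewrite mulrC.
- move=> e h h1 h2 d1 d2 hh; rewrite (F3 w e h h1 h2) // scalerDr !scalerA.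
  by rewrite mulrC.
Qed.
End KLeft.

Lemma bt1r (A' A : adga k) a' w (c : k_adga k) :
  bt a' w c = (c : k) *: bt a' w (1 : k_adga k) :> bmod A' A (k_adga k).
Proof. by rewrite -(linZ (bt_linr a' w)) /GRing.scale /= mulr1. Qed.

Lemma BA_lin_eq (A : adga k) (N : lmodType k) (L L' : BA A -> N) : linear L -> linear L' ->
  (forall w : seq (helt (@bhom k A)), L (word (hvals w)) = L' (word (hvals w))) -> L = L'.
Proof.
move=> Ll Ll' LL'; apply: lin_bval_eq => // -[[c w] c']; rewrite /bval /= bt1 bt1r.
rewrite !(linZ Ll) !(linZ Ll').
by do 2 congr (_ *: _); exact: LL'.
Qed.

Section Lact.
Variables (A' A A'' : adga k).
Local Notation K := (k_adga k).
Local Notation B := (bmod A' A A'').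
Local Notation R := (bmod K A A'').

Lemma lact_spec (a' : A') : linear (lact a' : R -> B) /\
  forall (c : K) w a'', lact a' (bt c w a'' : R) = bt ((c : k) *: a') w a''.
Proof.
have [w a''|c u v a''|c w|L [Ll LE]] :=
  @bmod_lift k K A A'' B (fun c w a'' => bt ((c : k) *: a') w a'').
- by move=> e x y; rewrite scalerDl -scalerA bt_l.
- exact: bt_linm.
- exact: bt_linr.
suff -> : lact a' = L by [].
by apply: hlift_lin => // -[[c w] a'']; rewrite /bval LE.
Qed.

Lemma lact_linr a' : linear (lact a' : R -> B).
Proof. by have [] := lact_spec a'. Qed.

Lemma lactE a' w a'' : lact a' (bt (1 : K) w a'' : R) = bt a' w a'' :> B.
Proof. by have [_ ->] := lact_spec a'; rewrite scale1r. Qed.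

(** Both sides are linear in [y], so it suffices to compare them on symbols. [ract_linr], [pre_linl]
    and [Qm_linr] follow the same pattern. *)
Lemma lact_linl (y : R) : linear (fun a' => lact a' y : B).
Proof.
move=> c a1 a2; pose L y : B := c *: lact a1 y + lact a2 y; rewrite -[RHS]/(L y).
suff -> : L = lact (c *: a1 + a2) by [].
apply: R_lin_eq => [||w a'']; [|exact: lact_linr|by rewrite /L !lactE bt_l].
by apply: islin_add; [apply: islin_scale|]; exact: lact_linr.
Qed.

Lemma ract_spec (a'' : A'') : linear (fun x : bmod A' A K => ract x a'' : B) /\
  forall a' w (c : K), ract (bt a' w c : bmod A' A K) a'' = bt a' w ((c : k) *: a'').
Proof.
have [w c|a' u v c|a' w|L [Ll LE]] :=
  @bmod_lift k A' A K B (fun a' w c => bt a' w ((c : k) *: a'')).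
- exact: bt_linl.
- exact: bt_linm.
- by move=> e x y; rewrite -bt_r scalerA -scalerDl.
have E : (fun x => ract x a'') = L; last first.
  rewrite E; split=> // a' w c; rewrite -LE.
  exact: (congr1 (@^~ _) E).
by apply: hlift_lin => // -[[a' w] c]; rewrite /bval LE.
Qed.

Lemma ract_linl a'' : linear (fun x : bmod A' A K => ract x a'' : B).
Proof. by have [] := ract_spec a''. Qed.

Lemma ractE a' w a'' : ract (bt a' w (1 : K) : bmod A' A K) a'' = bt a' w a'' :> B.
Proof. by have [_ ->] := ract_spec a''; rewrite scale1r. Qed.

End Lact.

Lemma ract_linr (A A'' : adga k) (x : BA A) :
  linear (fun a'' => ract x a'' : bmod (k_adga k) A A'').
Proof.
move=> c a1 a2; pose L x : bmod (k_adga k) A A'' := c *: ract x a1 + ract x a2.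
rewrite -[RHS]/(L x).
suff -> : L = (fun x => ract x (c *: a1 + a2)) by [].
apply: BA_lin_eq => [||w]; [|exact: ract_linl|by rewrite /L /word !ractE bt_r].
by apply: islin_add; [apply: islin_scale|]; exact: ract_linl.
Qed.

Section Bmap.
Variables (A' A A'' B' B B'' : adga k).
Variables (f' : A' -> B') (f : A -> B) (f'' : A'' -> B'').
Hypotheses (fl' : linear f') (fl : linear f) (fl'' : linear f'').

Lemma bmap_spec : linear (bmap f' f f'') /\
  forall a' w a'', bmap f' f f'' (bt a' w a'') = bt (f' a') [seq red (f (aval a)) | a <- w] (f'' a'').
Proof.
have [w a''|a' u v a''|a' w|L [Ll LE]] :=
  @bmod_lift k A' A A'' _ (fun a' w a'' => bt (f' a') [seq red (f (aval a)) | a <- w] (f'' a'')).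
- by move=> c x y; rewrite fl' bt_l.
- by move=> c x y; rewrite !map_cat /= fl red_linear bt_m.
- by move=> c x y; rewrite fl'' bt_r.
suff -> : bmap f' f f'' = L by [].
by apply: hlift_lin => // -[[a' w] a'']; rewrite /bval LE.
Qed.

Lemma bmap_linear : linear (bmap f' f f'').
Proof. by have [] := bmap_spec. Qed.

Lemma bmapE a' w a'' :
  bmap f' f f'' (bt a' w a'') = bt (f' a') [seq red (f (aval a)) | a <- w] (f'' a'').
Proof. by have [_ ->] := bmap_spec. Qed.
End Bmap.

Section Twist.
Variable A : adga k.
Local Notation K := (k_adga k).

Lemma twist_spec : linear (@twist k A) /\ forall w : seq (abar A),
  twist (word w) = if w is [:: a] then aval a else 0.
Proof.
have [w c'|c u v c'|c w|L [Ll LE]] := @bmod_lift k K A K A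
  (fun c w c' => if w is [:: a] then ((c : k) * (c' : k)) *: aval a else 0).
- case: w => [|a [|b w]]; try exact: islin_zero.
  move=> e x y; rewrite scalerA mulrA -scalerDl -mulrDl; congr (_ *: _).
- case: u => [|a [|b u]]; case: v => [|b' v]; try exact: islin_zero.
  by move=> e x y /=; rewrite scalerDr !scalerA [_ * e]mulrC.
- case: w => [|a [|b w]]; try exact: islin_zero.
  move=> e x y; rewrite scalerA mulrCA -scalerDl -mulrDr; congr (_ *: _).
have -> : @twist k A = L.
  by apply: hlift_lin => // -[[c w] c']; rewrite /bval LE; case: w => [|a [|b w]].
by split=> // w; rewrite LE; case: w => [|a [|b w]] //; rewrite mulr1 scale1r.
Qed.

Lemma twist_linear : linear (@twist k A).
Proof. by have [] := twist_spec. Qed.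

Lemma twistE (w : seq (abar A)) : twist (word w) = if w is [:: a] then aval a else 0.
Proof. by have [_ ->] := twist_spec. Qed.

Lemma aeps_aval (a : abar A) : aeps A (aval a) = 0.
Proof. by case: a => a /= /eqP. Qed.

Lemma twist_eps (x : BA A) : aeps A (twist x) = 0.
Proof.
have el : linear (fun x => aeps A (twist x)).
  by move=> c u v; rewrite twist_linear raddfD /= linearZ.
rewrite -[LHS]/((fun x => aeps A (twist x)) x) (BA_lin_eq el (@islin_zero k (BA A) k^o)) // => w.
by rewrite twistE; case: w => [|a [|b w]] /=; rewrite ?aeps_aval ?raddf0.
Qed.
End Twist.

Section Eps.
Variables (A' A A'' : adga k).
Variables (phi' : adga_mor A A') (phi'' : adga_mor A A'').
Local Notation B := (bmod A' A A'').

Lemma bar_eps_spec : linear (@bar_eps k A' A A'' : B -> k^o) /\ forall a' w a'',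
  bar_eps (bt a' w a'' : B) = if w is [::] then (aeps A' a' : k) * (aeps A'' a'' : k) else 0.
Proof.
have [w a''|a' u v a''|a' w|L [Ll LE]] := @bmod_lift k A' A A'' k^o
  (fun a' w a'' => if w is [::] then (aeps A' a' : k) * (aeps A'' a'' : k) else 0).
- case: w => [|a w]; last exact: islin_zero.
  by move=> c x y; rewrite raddfD /= linearZ /= mulrDl /GRing.scale /= mulrA.
- by case: u => [|b u]; exact: islin_zero.
- case: w => [|a w]; last exact: islin_zero.
  by move=> c x y; rewrite raddfD /= linearZ /= mulrDr /GRing.scale /= mulrCA.
have -> : @bar_eps k A' A A'' = L.
  by apply: (@hlift_lin _ _ _ _ k^o) => // -[[a' w] a'']; rewrite /bval LE; case: w.
by split.
Qed.

Lemma bar_eps_linear : linear (@bar_eps k A' A A'' : B -> k^o).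
Proof. by have [] := bar_eps_spec. Qed.

Lemma bar_epsE a' w a'' : bar_eps (bt a' w a'' : B) =
  if w is [::] then (aeps A' a' : k) * (aeps A'' a'' : k) else 0.
Proof. by have [_ ->] := bar_eps_spec. Qed.
End Eps.

Section Ksign.
Variables (A' A A'' : adga k).

Lemma ksign_slin : slin (fun s : bsym A' A A'' => sg (bdeg s) *: bval s).
Proof.
have [F1 F2 F3] := @bval_slin k A' A A''; split=> [w a''|a' a''|a' w].
- exact: (elin_scale (fun n => sg (n + wdeg w + hdeg a''))).
- move=> u v c h h1 h2 d1 d2 hh; rewrite (F2 _ _ u v c h h1 h2) // scalerDr !scalerA.
  by rewrite /bdeg /wdeg !big_cat !big_cons /= d1 d2 mulrC.
- exact: (elin_scale (fun n => sg (hdeg a' + wdeg w + n))).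
Qed.
End Ksign.

(** The sign involution for arbitrary coefficients; on B(A, A, A'') it is convertible with [ksign],
    which [hrec_cons] exploits. *)
Definition bsign (A' A A'' : adga k) (x : bmod A' A A'') : bmod A' A A'' :=
  hlift (fun s => sg (bdeg s) *: bval s) x.

Section Hom.
Variables (A' A A'' : adga k).
Local Notation B := (bmod A' A A'').

Lemma bsign_linear : linear (@bsign A' A A'').
Proof. exact/hlift_linear/ksign_slin. Qed.

Lemma bsignE s : bsign (bval s : B) = sg (bdeg s) *: bval s.
Proof. exact: (hliftE (@ksign_slin _ _ _)). Qed.

Lemma bsignK (x : B) : bsign (bsign x) = x.
Proof.
suff E : (fun x : B => bsign (bsign x)) = id by exact: (congr1 (@^~ x) E).
apply: lin_bval_eq => [||s].
- exact: islin_comp bsign_linear bsign_linear.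
- exact: islin_id.
by rewrite bsignE (linZ bsign_linear) bsignE scalerA sg_sq scale1r.
Qed.

Lemma bar_hom_bval (s : bsym A' A A'') : bar_hom (bdeg s) (bval s).
Proof. by exists [:: (1, s)]; rewrite /= eqxx big_seq1 scale1r. Qed.

Lemma bar_homZD n c (x y : B) : bar_hom n x -> bar_hom n y -> bar_hom n (c *: x + y).
Proof.
move=> [lx [dx ->]] [ly [dy ->]]; exists ([seq (c * p.1, p.2) | p <- lx] ++ ly); split.
  by rewrite all_cat all_map dy andbT.
rewrite big_cat big_map /= scaler_sumr; congr (_ + _).
by apply: eq_bigr => p _; rewrite scalerA.
Qed.

Lemma bar_hom0 n : bar_hom n (0 : B).
Proof. by exists [::]; rewrite big_nil. Qed.

Lemma bar_homD n (x y : B) : bar_hom n x -> bar_hom n y -> bar_hom n (x + y).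
Proof. by move=> hx hy; rewrite -[x]scale1r; exact: bar_homZD. Qed.

Lemma bar_homZ n c (x : B) : bar_hom n x -> bar_hom n (c *: x).
Proof. by move=> hx; rewrite -[_ *: _]addr0; apply: bar_homZD => //; exact: bar_hom0. Qed.

Lemma bar_homN n (x : B) : bar_hom n x -> bar_hom n (- x).
Proof. by move=> hx; rewrite -scaleN1r; exact: bar_homZ. Qed.

Lemma bar_hom_ind n (P : B -> Prop) (x : B) : bar_hom n x ->
  P 0 -> (forall c x y, P x -> P y -> P (c *: x + y)) ->
  (forall s, bdeg s = n -> P (bval s)) -> P x.
Proof.
move=> [l [dl ->]] P0 PZD Ps; elim: l dl => [|[c s] l IH] /=; first by rewrite big_nil.
by move=> /andP[/eqP ds dl]; rewrite big_cons; apply: PZD; [exact: Ps|exact: IH].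
Qed.

Lemma bar_hom_lin_eq n (N : lmodType k) (L L' : B -> N) : linear L -> linear L' ->
  (forall s, bdeg s = n -> L (bval s) = L' (bval s)) -> forall x, bar_hom n x -> L x = L' x.
Proof.
move=> Ll Ll' LL' x hx; apply: (bar_hom_ind (P := fun x => L x = L' x) hx) => //.
  by rewrite (lin0 Ll) (lin0 Ll').
by move=> c y z Ey Ez; rewrite Ll Ll' Ey Ez.
Qed.

Lemma bsign_hom n (x : B) : bar_hom n x -> bsign x = sg n *: x.
Proof.
apply: bar_hom_lin_eq; first exact: bsign_linear.
  by apply: islin_scale; exact: islin_id.
by move=> s <-; exact: bsignE.
Qed.

Lemma bar_hom_bt m n (a' : A') (w : seq (helt (@bhom k A))) (a'' : A'') :
  ahom m a' -> ahom n a'' -> bar_hom (m + wdeg w + n) (bt a' (hvals w) a'' : B).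
Proof. by move=> h' h''; exact: (bar_hom_bval (Helt h', w, Helt h'')). Qed.

End Hom.

Lemma bar_hom_linear (A' A A'' B' B B'' : adga k) (L : bmod A' A A'' -> bmod B' B B'') n e x :
  linear L -> (forall s, bar_hom (bdeg s + e) (L (bval s))) ->
  bar_hom n x -> bar_hom (n + e) (L x).
Proof.
move=> Ll Ls hx; apply: (bar_hom_ind (P := fun x => bar_hom (n + e) (L x)) hx) => //.
- by rewrite (lin0 Ll); exact: bar_hom0.
- by move=> c y z hy hz; rewrite Ll; exact: bar_homZD.
- by move=> s <-.
Qed.

End BasicMaps.

Section WordLinear.
Variables (k : comNzRingType) (V N : lmodType k) (H : int -> V -> Prop).

Lemma wlin_cons (G : helt H -> seq (helt H) -> N) :
  (forall r, elin (G^~ r)) -> (forall a, wlin (G a)) ->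
  wlin (fun v => if v is a :: r then G a r else 0).
Proof. by move=> Gl Gr [|a u] v; [exact: Gl|exact: Gr]. Qed.

Lemma wlin_cons2 (G : helt H -> helt H -> seq (helt H) -> N) :
  (forall b r, elin (fun a => G a b r)) -> (forall a r, elin (fun b => G a b r)) ->
  (forall a b, wlin (G a b)) ->
  wlin (fun v => if v is a :: b :: r then G a b r else 0).
Proof.
move=> G1 G2 G3 [|a [|b u]] v; [|exact: G2|exact: G3].
by case: v => [|b r]; [exact: elin0F|exact: G1].
Qed.

Lemma wlin_seq1 (G : helt H -> N) :
  elin G -> wlin (fun v => if v is [:: a] then G a else 0).
Proof.
move=> Gl [|a [|b u]] [|c v]; try exact: elin0F; exact: Gl.
Qed.

Lemma wlin0 : wlin (fun _ : seq (helt H) => 0 : N).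
Proof. by move=> u v; exact: elin0F. Qed.
End WordLinear.

(** Exactly one split has a single letter as its second part, the one that detaches the last letter.
    Access through [rev] thus becomes a sum over splits, which is open to induction and
    coassociativity. *)
Lemma last_splits (T : Type) (k : comNzRingType) (N : lmodType k) (F : seq T -> T -> N) w :
  (if rev w is a :: r then F (rev r) a else 0) =
  \sum_(p <- splits w) (if p.2 is [:: a] then F p.1 a else 0).
Proof.
case/lastP: w => [|w a]; first by rewrite big_seq1.
rewrite rev_rcons revK; elim: w F => [|b w IH] F.
  by rewrite (splits_cons (fun u v => if v is [:: a] then F u a else 0)) big_seq1 addr0.
rewrite rcons_cons (splits_cons (fun u v => if v is [:: a] then F u a else 0)) /=.
by rewrite -(IH (fun u x => F (b :: u) x)); case: (w) => [|c r]; rewrite add0r.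
Qed.

Section Degrees.
Variables (k : comNzRingType) (A : adga k).
Implicit Types u v w : seq (helt (@bhom k A)).

Lemma wdeg_nil : wdeg ([::] : seq (helt (@bhom k A))) = 0.
Proof. exact: big_nil. Qed.

Lemma wdeg_cons a w : wdeg (a :: w) = hdeg a - 1 + wdeg w.
Proof. exact: big_cons. Qed.

Lemma wdeg_cat u v : wdeg (u ++ v) = wdeg u + wdeg v.
Proof. exact: big_cat. Qed.

Lemma splits_wdeg w : all (fun p => wdeg p.1 + wdeg p.2 == wdeg w) (splits w).
Proof.
elim: w => [|a w IH] /=; first by rewrite wdeg_nil.
rewrite wdeg_nil add0r eqxx all_map; apply: sub_all IH => p /= /eqP E.
by rewrite !wdeg_cons -E addrA.
Qed.

Lemma eq_splits (N : lmodType k) (F G : seq (helt (@bhom k A)) -> seq (helt (@bhom k A)) -> N) w :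
  (forall u v, wdeg u + wdeg v = wdeg w -> F u v = G u v) ->
  \sum_(p <- splits w) F p.1 p.2 = \sum_(p <- splits w) G p.1 p.2.
Proof.
move=> FG; have := splits_wdeg w; elim: (splits w) => [|p s IH] /=; first by rewrite !big_nil.
by move=> /andP[/eqP dp ds]; rewrite !big_cons FG // IH.
Qed.

Definition dhelt (a : helt (@bhom k A)) : helt (@bhom k A) :=
  Helt (bhom_red (ahom_diff (hvalP a))).

Definition mhelt (a b : helt (@bhom k A)) : helt (@bhom k A) :=
  Helt (bhom_red (ahomM (hvalP a) (hvalP b))).

End Degrees.

Lemma aval_red (k : comNzRingType) (A : adga k) (a : A) : aeps A a = 0 -> aval (red a) = a.
Proof. by move=> a0; rewrite /= a0 scale0r subr0. Qed.

Lemma red1 (k : comNzRingType) (A : adga k) : red (1 : A) = 0.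
Proof. by apply/val_inj; rewrite /= rmorph1 scale1r subrr. Qed.

Lemma adiff_linear (k : comNzRingType) (A : adga k) : linear (adiff A).
Proof. by move=> c x y; rewrite linearP. Qed.

Lemma amor_linear (k : comNzRingType) (A B : adga k) (f : adga_mor A B) : linear f.
Proof. by move=> c x y; rewrite linearP. Qed.

Lemma aval_linear (k : comNzRingType) (A : adga k) : linear (@aval k A).
Proof. by []. Qed.

Lemma mul_linl (k : comNzRingType) (A : algType k) (y : A) : linear (fun x : A => x * y).
Proof. by move=> c u v; rewrite mulrDl scalerAl. Qed.

Lemma mul_linr (k : comNzRingType) (A : algType k) (x : A) : linear (fun y : A => x * y).
Proof. by move=> c u v; rewrite mulrDr scalerAr. Qed.

(** * The differential of the two-sided bar construction *)

Section Differential.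
Variables (k : comNzRingType) (A' A A'' : adga k).
Variables (phi' : adga_mor A A') (phi'' : adga_mor A A'').
Local Notation B := (bmod A' A A'').
Local Notation v := (@hvals _ (@bhom k A)).
Local Notation h' := (helt (@ahom k A')).
Local Notation h'' := (helt (@ahom k A'')).
Implicit Types (w u r : seq (helt (@bhom k A))).

(** Except for [dleft], each part of the differential is a sum over splits, with the letters acted
    upon at the head of the second half. Linearity then follows from [wlin_splits], and the
    recursion [dBA_cons] from [splits_cons]. *)
Definition dtens (a' : h') w (a'' : h'') : B := \sum_(p <- splits w)
  (if p.2 is a :: r then sg (hdeg a' + wdeg p.1) *:
     bt (hval a') (v p.1 ++ - red (adiff A (aval (hval a))) :: v r) (hval a'') else 0).

Definition dbar (a' : h') w (a'' : h'') : B := \sum_(p <- splits w)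
  (if p.2 is a :: b :: r then sg (hdeg a' + (wdeg p.1 + (hdeg a - 1))) *:
     bt (hval a') (v p.1 ++ red (aval (hval a) * aval (hval b)) :: v r) (hval a'') else 0).

Definition dleft (a' : h') w (a'' : h'') : B := if w is a :: r then
  sg (hdeg a') *: bt (hval a' * phi' (aval (hval a))) (v r) (hval a'') else 0.

Definition dright (a' : h') w (a'' : h'') : B := \sum_(p <- splits w)
  (if p.2 is [:: a] then sg (hdeg a' + wdeg p.1) *:
     bt (hval a') (v p.1) (phi'' (aval (hval a)) * hval a'') else 0).

Definition dsym (s : bsym A' A A'') : B := let: (a', w, a'') := s in
  bt (adiff A' (hval a')) (v w) (hval a'') + dtens a' w a'' + dbar a' w a''
  + sg (hdeg a' + wdeg w) *: bt (hval a') (v w) (adiff A'' (hval a''))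
  + dleft a' w a'' - dright a' w a''.

Lemma bar_diffE0 x : bar_diff phi' phi'' x = hlift dsym x.
Proof.
rewrite /bar_diff; congr (hlift _ x); apply: funext => -[[a' w] a''].
rewrite /dsym; congr (_ + _ + _ + _ + _ - _).
- pose F u z : B := if z is a :: r then sg (hdeg a' + wdeg u) *:
    bt (hval a') (v u ++ - red (adiff A (aval (hval a))) :: v r) (hval a'') else 0.
  by rewrite (sum_splits_lt (F := F)).
- pose F u z : B := if z is a :: b :: r then sg (hdeg a' + (wdeg u + (hdeg a - 1))) *:
     bt (hval a') (v u ++ red (aval (hval a) * aval (hval b)) :: v r) (hval a'') else 0.
  rewrite -[RHS](sum_splits_lt (F := F)) //; apply: eq_bigr => -[i iw] _ /=.
  rewrite /F; case E: (drop i w) => [|a [|b r]] //; congr (sg (_ + _) *: _).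
  (* The sign counts the prefix up to and including [a], whereas the split ends before [a]. *)
  have -> : take i.+1 w = rcons (take i w) a.
    by rewrite (take_nth a iw); congr rcons; rewrite -[i]addn0 -nth_drop E.
  by rewrite -cats1 wdeg_cat wdeg_cons wdeg_nil addr0.
- pose F r (a : helt (@bhom k A)) : B := sg (hdeg a' + wdeg r) *: bt (hval a') (v r) (phi'' (aval (hval a)) * hval a'').
  exact: (last_splits F).
Qed.

Lemma bt_wlin1 (a' : h') (a'' : h'') (b : abar A) u : wlin (fun r => bt (hval a') (v u ++ b :: v r) (hval a'') : B).
Proof.
move=> x y c h h1 h2 d1 d2 hh; rewrite /hvals !map_cat /= hh -!cat_cons !catA; exact: bt_m.
Qed.

Lemma bt_wlin2 (a' : h') (a'' : h'') (b : seq (abar A)) : wlin (fun u => bt (hval a') (v u ++ b) (hval a'') : B).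
Proof.
move=> x y c h h1 h2 d1 d2 hh; rewrite /hvals !map_cat /= hh -!catA !cat_cons; exact: bt_m.
Qed.

Lemma elin_bt (a' : A') (u r : seq (abar A)) (a'' : A'') (f : abar A -> abar A) : linear f ->
  elin (fun h : helt (@bhom k A) => bt a' (u ++ f (hval h) :: r) a'' : B).
Proof. by move=> fl c h h1 h2 _ _ ->; rewrite fl bt_m. Qed.

Lemma elin_zmod (N : lmodType k) (V : lmodType k) (H : int -> V -> Prop) (F : helt H -> N) a :
  elin F -> elin (fun h => a *: F h).
Proof. by move=> eF; exact: (elin_scale (fun _ => a)). Qed.

Lemma wlin_zmod (N : lmodType k) (V : lmodType k) (H : int -> V -> Prop) (F : seq (helt H) -> N) a :
  wlin F -> wlin (fun h => a *: F h).
Proof. by move=> eF; exact: (wlin_scale (fun _ => a)). Qed.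

Lemma wlin_deg (N : lmodType k) (f : int -> k) (F : seq (helt (@bhom k A)) -> N) :
  wlin F -> wlin (fun w => f (wdeg w) *: F w).
Proof.
move=> eF; have E w : wdeg w = \sum_(n <- map (@hdeg _ _) w) (n - 1) by rewrite big_map.
rewrite (funext (fun w => congr1 (fun n => f n *: F w) (E w))).
exact: (wlin_scale (fun s => f (\sum_(n <- s) (n - 1)))).
Qed.

Lemma dtens_slin : slin (fun s => let: (a', w, a'') := s in dtens a' w a'').
Proof.
split=> [w a''|a' a''|a' w]; rewrite /dtens.
- apply: elin_sum => -[u [|a r]] /=; first exact: elin0F.
  apply: (elin_scale (fun n => sg (n + wdeg u))); exact: (elin_hval (bt_linl _ _)).
- apply: (wlin_splits (G := fun u z => if z is a :: r then sg (hdeg a' + wdeg u) *: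
     bt (hval a') (v u ++ - red (adiff A (aval (hval a))) :: v r) (hval a'') else 0)) => [[|a r]|u].
  + exact: wlin0.
  + apply: (wlin_deg (fun n => sg (hdeg a' + n))); exact: bt_wlin2.
  + apply: wlin_cons => [r|a]; last by apply: wlin_zmod; exact: bt_wlin1.
    apply: elin_zmod; apply: (elin_bt _ _ _ _ (f := fun a => - red (adiff A (aval a)))).
    by apply: islin_opp => c x y; rewrite aval_linear adiff_linear red_linear.
- apply: elin_sum => -[u [|a r]] /=; first exact: elin0F.
  by apply: elin_zmod; exact: (elin_hval (bt_linr _ _)).
Qed.

Lemma dbar_slin : slin (fun s => let: (a', w, a'') := s in dbar a' w a'').
Proof.
split=> [w a''|a' a''|a' w]; rewrite /dbar.
- apply: elin_sum => -[u [|a [|b r]]] /=; try exact: elin0F.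
  apply: (elin_scale (fun n => sg (n + (wdeg u + (hdeg a - 1))))); exact: (elin_hval (bt_linl _ _)).
- apply: (wlin_splits (G := fun u z => if z is a :: b :: r then
     sg (hdeg a' + (wdeg u + (hdeg a - 1))) *:
     bt (hval a') (v u ++ red (aval (hval a) * aval (hval b)) :: v r) (hval a'') else 0))
    => [[|a [|b r]]|u]; try exact: wlin0.
  + apply: (wlin_deg (fun n => sg (hdeg a' + (n + (hdeg a - 1))))); exact: bt_wlin2.
  + apply: wlin_cons2 => [b r|a r|a b]; last by apply: wlin_zmod; exact: bt_wlin1.
      apply: (elin_scale (fun n => sg (hdeg a' + (wdeg u + (n - 1))))).
      apply: (elin_bt _ _ _ _ (f := fun a => red (aval a * aval (hval b)))).
      by move=> c x y; rewrite aval_linear mul_linl red_linear.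
    apply: elin_zmod; apply: (elin_bt _ _ _ _ (f := fun b => red (aval (hval a) * aval b))).
    by move=> c x y; rewrite aval_linear mul_linr red_linear.
- apply: elin_sum => -[u [|a [|b r]]] /=; try exact: elin0F.
  by apply: elin_zmod; exact: (elin_hval (bt_linr _ _)).
Qed.

Lemma dleft_slin : slin (fun s => let: (a', w, a'') := s in dleft a' w a'').
Proof.
split=> [w a''|a' a''|a' w]; rewrite /dleft.
- case: w => [|a r]; first exact: elin0F.
  apply: (elin_scale sg); apply: (elin_hval (L := fun a' => bt (a' * _) _ _)).
  exact: islin_comp (bt_linl _ _) (mul_linl _).
- apply: wlin_cons => [r|a]; apply: elin_zmod || apply: wlin_zmod.
    apply: (elin_hval (L := fun a => bt (_ * phi' (aval a)) _ _)).
    by move=> c x y; rewrite aval_linear amor_linear mul_linr bt_l.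
  exact: (bt_wlin _ _ (@islin_id _ _)).
- case: w => [|a r]; first exact: elin0F.
  by apply: elin_zmod; exact: (elin_hval (bt_linr _ _)).
Qed.

Lemma dright_slin : slin (fun s => let: (a', w, a'') := s in dright a' w a'').
Proof.
split=> [w a''|a' a''|a' w]; rewrite /dright.
- apply: elin_sum => -[u [|a [|b r]]] /=; try exact: elin0F.
  apply: (elin_scale (fun n => sg (n + wdeg u))); exact: (elin_hval (bt_linl _ _)).
- apply: (wlin_splits (G := fun u z => if z is [:: a] then sg (hdeg a' + wdeg u) *:
     bt (hval a') (v u) (phi'' (aval (hval a)) * hval a'') else 0)) => [[|a [|b r]]|u];
     try exact: wlin0.
  + apply: (wlin_deg (fun n => sg (hdeg a' + n))); exact: (bt_wlin _ _ (@islin_id _ _)).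
  + apply: wlin_seq1; apply: elin_zmod; apply: (elin_hval (L := fun a => bt _ _ (phi'' (aval a) * _))).
    by move=> c x y; rewrite aval_linear amor_linear mul_linl bt_r.
- apply: elin_sum => -[u [|a [|b r]]] /=; try exact: elin0F.
  apply: elin_zmod; apply: (elin_hval (L := fun a'' => bt _ _ (_ * a''))).
  exact: islin_comp (bt_linr _ _) (mul_linr _).
Qed.

Lemma slin_add (N : lmodType k) (F G : bsym A' A A'' -> N) :
  slin F -> slin G -> slin (fun s => F s + G s).
Proof.
move=> [F1 F2 F3] [G1 G2 G3]; split=> *; [exact: elin_add|exact: wlin_add|exact: elin_add].
Qed.

Lemma dsym_slin : slin dsym.
Proof.
have d1 : slin (fun s : bsym A' A A'' => let: (a', w, a'') := s in
    bt (adiff A' (hval a')) (v w) (hval a'') : B).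
  split=> [w a''|a' a''|a' w].
  - apply: (elin_hval (L := fun a' => bt (adiff A' a') _ _)).
    exact: islin_comp (bt_linl _ _) (@adiff_linear _ _).
  - exact: (bt_wlin _ _ (@islin_id _ _)).
  - exact: (elin_hval (bt_linr _ _)).
have d2 : slin (fun s : bsym A' A A'' => let: (a', w, a'') := s in
    sg (hdeg a' + wdeg w) *: bt (hval a') (v w) (adiff A'' (hval a'')) : B).
  split=> [w a''|a' a''|a' w].
  - apply: (elin_scale (fun n => sg (n + wdeg w))); exact: (elin_hval (bt_linl _ _)).
  - apply: (wlin_deg (fun n => sg (hdeg a' + n))); exact: (bt_wlin _ _ (@islin_id _ _)).
  - apply: elin_zmod; apply: (elin_hval (L := fun a'' => bt _ _ (adiff A'' a''))).
    exact: islin_comp (bt_linr _ _) (@adiff_linear _ _).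
have d3 := slin_comp (islin_opp (@islin_id k B)) dright_slin.
have := slin_add (slin_add (slin_add (slin_add (slin_add d1 dtens_slin) dbar_slin) d2) dleft_slin) d3.
by congr slin; apply: funext => -[[a' w] a''].
Qed.

Lemma bar_diff_linear : linear (bar_diff phi' phi'').
Proof. by move=> c x y; rewrite !bar_diffE0 (hlift_linear dsym_slin). Qed.

Lemma bar_diffE s : bar_diff phi' phi'' (bval s) = dsym s.
Proof. by rewrite bar_diffE0 (hliftE dsym_slin). Qed.

End Differential.

Lemma islin_scalel (k : comNzRingType) (V W : lmodType k) (f : V -> k^o) (w : W) :
  linear f -> linear (fun x => (f x : k) *: w).
Proof. by move=> fl c x y; rewrite fl scalerDl scalerA. Qed.

Lemma aeps_linear (k : comNzRingType) (A : adga k) : linear (aeps A).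
Proof. by move=> c x y; rewrite linearP. Qed.

Lemma A_lin_eq (k : comNzRingType) (A : adga k) (N : lmodType k) (L L' : A -> N) :
  linear L -> linear L' ->
  (forall a : helt (@ahom k A), L (hval a) = L' (hval a)) -> L = L'.
Proof.
move=> Ll Ll' E; apply: funext => a; rewrite -(hdecE (ahom_grading A) a).
by rewrite (lin_sum Ll) (lin_sum Ll'); apply: eq_bigr.
Qed.

(* [lin] proves linearity of composites; besides the hypotheses of the goal it uses
   the local facts recorded by [Let], so these may be needed without being named. *)
Ltac lin_hyp := match goal with
  | H : @GRing.linear_for _ _ _ _ ?h |- @GRing.linear_for _ _ _ _ ?f => constr_eq h f; exact: H
  | H : @GRing.linear_for _ _ _ _ ?h |- @GRing.linear_for _ _ _ _ (fun x => ?f x) =>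
      constr_eq h f; exact: H
  | H : forall y, @GRing.linear_for _ _ _ _ (?h y) |- @GRing.linear_for _ _ _ _ (?f ?z) =>
      constr_eq h f; exact: (H z)
  | H : forall y, @GRing.linear_for _ _ _ _ (?h y) |- @GRing.linear_for _ _ _ _ (fun x => ?f ?z x) =>
      constr_eq h f; exact: (H z)
  end.

Ltac lin_op f := match f with
  | (fun x => bt (@?g x) ?w ?c) => refine (@islin_comp _ _ _ _ _ g (bt_linl w c) _)
  | (fun x => bt ?c ?w (@?g x)) => refine (@islin_comp _ _ _ _ _ g (bt_linr c w) _)
  | (fun x => bt ?c ((@?g x) :: ?w) ?d) => refine (@islin_comp _ _ _ _ _ g (bt_linh c w d) _)
  | (fun x => lact (@?g x) ?c) => refine (@islin_comp _ _ _ _ _ g (lact_linl c) _)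
  | (fun x => lact ?c (@?g x)) => refine (@islin_comp _ _ _ _ _ g (@lact_linr _ _ _ _ c) _)
  | (fun x => ract (@?g x) ?c) => refine (@islin_comp _ _ _ _ _ g (ract_linl c) _)
  | (fun x => ract ?c (@?g x)) => refine (@islin_comp _ _ _ _ _ g (ract_linr c) _)
  | (fun x => twist (@?g x)) => refine (@islin_comp _ _ _ _ _ g (@twist_linear _ _) _)
  | (fun x => bar_eps (@?g x)) => refine (@islin_comp _ _ _ _ _ g (@bar_eps_linear _ _ _ _) _)
  | (fun x => bsign (@?g x)) => refine (@islin_comp _ _ _ _ _ g (@bsign_linear _ _ _ _) _)
  | (fun x => bar_diff ?p ?q (@?g x)) => refine (@islin_comp _ _ _ _ _ g (@bar_diff_linear _ _ _ _ p q) _)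
  | (fun x => aval (@?g x)) => refine (@islin_comp _ _ _ _ _ g (@aval_linear _ _) _)
  | (fun x => red (@?g x)) => refine (@islin_comp _ _ _ _ _ g (@red_linear _ _) _)
  | (fun x => GRing.mul (@?g x) ?y) => refine (@islin_comp _ _ _ _ _ g (@mul_linl _ _ y) _)
  | (fun x => GRing.mul ?y (@?g x)) => refine (@islin_comp _ _ _ _ _ g (@mul_linr _ _ y) _)
  | (fun x => GRing.scale (@?g x) ?y) => refine (@islin_scalel _ _ _ g y _)
  | (fun x => ?h (@?g x)) => refine (@islin_comp _ _ _ _ h g _ _);
      [solve [lin_hyp | exact: adiff_linear | exact: amor_linear | exact: aeps_linear] |]
  end.

Ltac lin_op1 f := fail.
Ltac lin_op2 f := fail.

Ltac lin_step := cbv beta; match goal with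
  | |- bilin _ => split=> ?
  | H : bilin ?G |- @GRing.linear_for _ _ _ _ (?F ?a) => constr_eq F G; exact: (proj2 H a)
  | H : bilin ?G |- @GRing.linear_for _ _ _ _ (fun x => ?F ?a (@?g x)) => constr_eq F G;
      refine (@islin_comp _ _ _ _ _ g (proj2 H a) _)
  | H : bilin ?G |- @GRing.linear_for _ _ _ _ (fun x => ?F (@?g x) ?b) => constr_eq F G;
      refine (@islin_comp _ _ _ _ _ g (proj1 H b) _)
  | |- @GRing.linear_for _ _ _ _ ?f => first
    [ lin_hyp | exact: islin_id
    | lazymatch f with
      | (fun x => 0) => exact: islin_zero
      | (fun x => GRing.add (@?g x) (@?h x)) => refine (@islin_add _ _ _ g h _ _)
      | (fun x => GRing.opp (@?g x)) => refine (@islin_opp _ _ _ g _)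
      | (fun x => \sum_(i <- ?s | ?P) (@?F x i)) =>
          refine (@islin_sum _ _ _ _ s _ (fun i x => F x i) _) => ?
      end
    | match f with
      | (fun x => GRing.scale ?a (@?g x)) => refine (@islin_scale _ _ _ a g _)
      end
    | lin_op f | lin_op1 f | lin_op2 f ]
  end.
Ltac lin := repeat lin_step.

(** * Coproduct and coaction, paired with a bilinear map *)

Section Coaction.
Variables (k : comNzRingType) (A A'' : adga k).
Local Notation K := (k_adga k).
Local Notation R := (bmod K A A'').
Implicit Types (w : seq (helt (@bhom k A))).

(* x |-> sum of G(x1, x2) over the left coaction of BA on B(k, A, A''). *)
Definition coR (N : lmodType k) (G : BA A -> R -> N) (r : R) : N :=
  hlift (fun s : bsym K A A'' => let: (c, w, a'') := s in
    (hval c : k) *: \sum_(p <- splits w) G (word (hvals p.1)) (bt (1 : K) (hvals p.2) (hval a''))) r.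

Section CoR.
Variables (N : lmodType k) (G : BA A -> R -> N).
Hypothesis Gb : bilin G.

Lemma coR_slin : slin (fun s : bsym K A A'' => let: (c, w, a'') := s in
    (hval c : k) *: \sum_(p <- splits w) G (word (hvals p.1)) (bt (1 : K) (hvals p.2) (hval a''))).
Proof.
apply: (slin_R (F := fun w a'' => \sum_(p <- splits w) G _ (bt _ _ (hval a'')))) => [a''|w].
  apply: (wlin_splits (G := fun u v => G (word (hvals u)) (bt 1 (hvals v) _))) => u.
    exact: (bt_wlin (L := fun x => G x _) _ _ (Gb.1 _)).
  exact: (bt_wlin (L := fun x => G _ x) _ _ (Gb.2 _)).
apply: elin_sum => p; apply: (elin_hval (L := fun a'' => G _ (bt _ _ a''))).
exact: islin_comp (Gb.2 _) (bt_linr _ _).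
Qed.

Lemma coR_linear : linear (coR G).
Proof. exact: (hlift_linear coR_slin). Qed.

Lemma coRE w a'' :
  coR G (bt (1 : K) (hvals w) a'') =
  \sum_(p <- splits w) G (word (hvals p.1)) (bt (1 : K) (hvals p.2) a'').
Proof.
have bl := Gb.2; set L := fun a'' => coR G (bt (1 : K) (hvals w) a'').
pose L' a'' := \sum_(p <- splits w) G (word (hvals p.1)) (bt (1 : K) (hvals p.2) a'').
suff E : L = L' by exact: (congr1 (@^~ a'') E).
apply: A_lin_eq => [||a].
- exact: islin_comp coR_linear (bt_linr _ _).
- by rewrite /L'; lin.
by rewrite /L /coR (hliftE coR_slin (Helt (ahom1 K), w, a)) scale1r.
Qed.
End CoR.

End Coaction.

Section Cop.
Variables (k : comNzRingType) (A : adga k).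
Local Notation K := (k_adga k).

(** BA is B(k, A, k), so its coproduct is the case A'' = k of the coaction. *)
Definition cop (N : lmodType k) (G : BA A -> BA A -> N) : BA A -> N := coR (A'' := K) G.

Lemma cop_linear (N : lmodType k) (G : BA A -> BA A -> N) : bilin G -> linear (cop G).
Proof. exact: coR_linear. Qed.

Lemma copE (N : lmodType k) (G : BA A -> BA A -> N) (w : seq (helt (@bhom k A))) : bilin G ->
  cop G (word (hvals w)) = \sum_(p <- splits w) G (word (hvals p.1)) (word (hvals p.2)).
Proof. by move=> Gb; exact: coRE. Qed.

Lemma coR_ract (A'' : adga k) (N : lmodType k) (G : BA A -> bmod K A A'' -> N) (x : BA A) (a'' : A'') :
  bilin G -> coR G (ract x a'') = cop (fun x1 x2 => G x1 (ract x2 a'')) x.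
Proof.
move=> Gb; have [Gl Gr] := Gb.
have b : bilin (fun x1 x2 => G x1 (ract x2 a'')) by split=> z; [|refine (islin_comp (Gr z) _)]; lin.
suff E : (fun x => coR G (ract x a'')) = cop (fun x1 x2 => G x1 (ract x2 a'')).
  exact: (congr1 (@^~ x) E).
apply: BA_lin_eq => [||w]; [exact: islin_comp (coR_linear Gb) (ract_linl _)|exact: cop_linear|].
rewrite copE // /word ractE coRE //; apply: eq_bigr => p _.
by rewrite ractE.
Qed.

(** Prepending a letter is made a linear operator on arbitrary elements, so that inductions on words
    can be stated without mentioning words. *)
Definition pre (A'' : adga k) (a : abar A) (r : bmod K A A'') : bmod K A A'' :=
  hlift (fun s : bsym K A A'' => let: (c, w, a'') := s in bt (hval c) (a :: hvals w) (hval a'')) r.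

Lemma pre_spec (A'' : adga k) (a : abar A) : linear (@pre A'' a) /\
  forall (c : K) (w : seq (abar A)) (a'' : A''), pre a (bt c w a'') = bt c (a :: w) a''.
Proof.
have [w a''|c u v a''|c w|L [Ll LE]] :=
  @bmod_lift k K A A'' (bmod K A A'') (fun c w a'' => bt c (a :: w) a'').
- exact: bt_linl.
- exact: (bt_linm _ (a :: u)).
- exact: bt_linr.
suff -> : @pre A'' a = L by [].
by apply: hlift_lin => // -[[c w] a'']; rewrite /bval LE.
Qed.

Lemma pre_linr (A'' : adga k) a : linear (@pre A'' a).
Proof. by have [] := @pre_spec A'' a. Qed.

Lemma preE (A'' : adga k) a (w : seq (abar A)) (a'' : A'') :
  pre a (bt (1 : K) w a'') = bt (1 : K) (a :: w) a''.
Proof. by have [_ ->] := @pre_spec A'' a. Qed.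

Lemma pre_linl (A'' : adga k) (r : bmod K A A'') : linear (fun a => pre a r).
Proof.
move=> c a b; pose L r : bmod K A A'' := c *: pre a r + pre b r; rewrite -[RHS]/(L r).
suff -> : L = pre (c *: a + b) by [].
apply: R_lin_eq => [||w a'']; [|exact: pre_linr|by rewrite /L !preE bt_linh].
by apply: islin_add; [apply: islin_scale|]; exact: pre_linr.
Qed.

Ltac lin_op1 f ::= match f with
  | (fun x => pre (@?g x) ?c) => refine (@islin_comp _ _ _ _ _ g (pre_linl c) _)
  | (fun x => pre ?c (@?g x)) => refine (@islin_comp _ _ _ _ _ g (@pre_linr _ c) _)
  end.

Lemma pre_word a (w : seq (abar A)) : pre a (word w) = word (a :: w).
Proof. exact: preE. Qed.

(** A cut of [a|r] lies either in front of [a] or behind it, and in the second case it comes from a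
    cut of [r]. *)
Lemma coR_pre (A'' : adga k) (N : lmodType k) (G : BA A -> bmod K A A'' -> N) a r : bilin G ->
  coR G (pre a r) = G (word [::]) (pre a r) + coR (fun x y => G (pre a x) y) r.
Proof.
move=> Gb; have [Gl Gr] := Gb.
have b : bilin (fun x y => G (pre a x) y).
  by split=> z; [exact: islin_comp (Gl z) (@pre_linr _ _)|exact: Gr].
pose L r := G (word [::]) (pre a r) + coR (fun x y => G (pre a x) y) r.
suff E : (fun r => coR G (pre a r)) = L by exact: (congr1 (@^~ r) E).
apply: R_lin_eq => [||w a''].
- exact: islin_comp (coR_linear Gb) (@pre_linr _ _).
- by apply: islin_add; [exact: islin_comp (Gr _) (@pre_linr _ _)|exact: coR_linear].
rewrite /L preE (coRE b).
(* [coRE] evaluates only words with homogeneous letters, so [a] is replaced by its components. *)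
have [s [u [hu aE]]] := grad_sum (bhom_grading A) a.
pose F c : N := coR G (bt (1 : K) (c :: hvals w) (hval a'')).
pose F' c : N := G (word [::]) (bt (1 : K) (c :: hvals w) (hval a'')) +
  \sum_(p <- splits w) G (pre c (word (hvals p.1))) (bt (1 : K) (hvals p.2) (hval a'')).
have Fl : linear F by exact: islin_comp (coR_linear Gb) (bt_linh _ _ _).
have Fl' : linear F'.
  by rewrite /F'; lin.
rewrite -/(F a) -/(F' a) aE (lin_sum Fl) (lin_sum Fl'); apply: eq_bigr => n _.
rewrite /F /F' (coRE Gb (Helt (hu n) :: w)).
rewrite (splits_cons (fun u v => G (word (hvals u)) (bt 1 (hvals v) _))).
by congr (_ + _); apply: eq_bigr => p _; rewrite pre_word.
Qed.

Lemma cop_pre (N : lmodType k) (G : BA A -> BA A -> N) a (x : BA A) : bilin G ->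
  cop G (pre a x) = G (word [::]) (pre a x) + cop (fun x y => G (pre a x) y) x.
Proof. exact: coR_pre. Qed.

(** The hga axiom [hmu_deconc] is an equation in a tensor product. A bilinear [G] factors through
    [tens], which makes that axiom available to [cop]. *)
Lemma cop_deconc (N : lmodType k) (G : BA A -> BA A -> N) : bilin G ->
  exists L : tens (BA A) (BA A) -> N, [/\ linear L, forall x y, L (tensor x y) = G x y
    & forall x, cop G x = L (deconc x)].
Proof.
move=> Gb; have [L [Ll LE]] := tens_lift Gb; exists L; split=> // x.
have tb : bilin (@tensor k (BA A) (BA A)).
  have tl (M N' : lmodType k) (X Y Z : {freeg (M * N')%type / k}) c :
      tens_rel (X - (c *: Y + Z)) -> qmod_pi (@tens_rel k M N') X =
      c *: qmod_pi (@tens_rel k M N') Y + qmod_pi (@tens_rel k M N') Z.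
    move=> t; rewrite -(qmod_pi_linear (@tens_rel k M N')); apply/qmod_piP/asboolP.
    exists [:: (1, X - (c *: Y + Z))]; rewrite big_seq1 scale1r; split=> //.
    by move=> p; rewrite inE => /eqP ->.
  by split=> y c u v; apply: tl; [exact: tens_rel_l|exact: tens_rel_r].
have -> : deconc x = cop (@tensor k (BA A) (BA A)) x.
  suff E : @deconc k A = cop (@tensor k (BA A) (BA A)) by rewrite E.
  apply: hlift_lin => [|[[c w] c']]; first exact: cop_linear.
  rewrite /bval bt1 (linZ (cop_linear tb)) -scalerA; congr (_ *: _).
  rewrite bt1r (linZ (cop_linear tb)); congr (_ *: _).
  rewrite -[bt _ _ _]/(word (hvals w)) copE //.
  exact: (sum_splits (fun u v => tensor (word (hvals u)) (word (hvals v)))).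
have E : (fun x => L (cop (@tensor k (BA A) (BA A)) x)) = cop G.
  apply: BA_lin_eq => [||w]; [exact: islin_comp Ll (cop_linear tb)|exact: cop_linear|].
  by rewrite !copE // (lin_sum Ll); apply: eq_bigr => p _.
by rewrite -E.
Qed.

End Cop.

Ltac lin_op1 f ::= match f with
  | (fun x => pre (@?g x) ?c) => refine (@islin_comp _ _ _ _ _ g (pre_linl c) _)
  | (fun x => pre ?c (@?g x)) => refine (@islin_comp _ _ _ _ _ g (@pre_linr _ _ _ c) _)
  end.

Lemma splits_head (k : comNzRingType) (N : lmodType k) (T : Type) (F : T -> seq T -> seq T -> N) (w : seq T) :
  \sum_(p <- splits w) (if p.1 is b :: r then F b r p.2 else 0) =
  if w is b :: r then \sum_(p <- splits r) F b p.1 p.2 else 0.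
Proof.
case: w => [|b r]; first by rewrite big_seq1.
by rewrite (splits_cons (fun u v => if u is b :: r then F b r v else 0)) add0r.
Qed.

(** * The differential in terms of coproduct and twisting cochain *)

Section DiffFormulas.
Variables (k : comNzRingType).
Local Notation K := (k_adga k).

Definition kone : helt (@ahom k K) := Helt (ahom1 K).

Lemma aug_aval (A : adga k) (a : abar A) : aug_mor A (aval a) = 0.
Proof. exact: aeps_aval. Qed.

Section General.
Variables (A' A A'' : adga k).
Variables (phi' : adga_mor A A') (phi'' : adga_mor A A'').
Implicit Types w u r : seq (helt (@bhom k A)).
Local Notation B := (bmod A' A A'').
Local Notation R := (bmod K A A'').
Local Notation h' := (helt (@ahom k A')).
Local Notation h'' := (helt (@ahom k A'')).

Lemma lact_dtens (a' : h') w (a'' : h'') :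
  sg (hdeg a') *: lact (hval a') (dtens kone w a'') = dtens a' w a'' :> B.
Proof.
rewrite /dtens (lin_sum (@lact_linr _ _ _ _ _)) scaler_sumr; apply: eq_bigr => -[u [|a r]] _ /=.
  by rewrite (lin0 (@lact_linr _ _ _ _ _)) scaler0.
by rewrite (linZ (@lact_linr _ _ _ _ _)) lactE scalerA -sgD add0r.
Qed.

Lemma lact_dbar (a' : h') w (a'' : h'') :
  sg (hdeg a') *: lact (hval a') (dbar kone w a'') = dbar a' w a'' :> B.
Proof.
rewrite /dbar (lin_sum (@lact_linr _ _ _ _ _)) scaler_sumr; apply: eq_bigr => -[u [|a [|b r]]] _ /=;
  rewrite ?(lin0 (@lact_linr _ _ _ _ _)) ?scaler0 //.
by rewrite (linZ (@lact_linr _ _ _ _ _)) lactE scalerA -sgD add0r.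
Qed.

Lemma lact_dright (a' : h') w (a'' : h'') :
  sg (hdeg a') *: lact (hval a') (dright phi'' kone w a'') = dright phi'' a' w a'' :> B.
Proof.
rewrite /dright (lin_sum (@lact_linr _ _ _ _ _)) scaler_sumr; apply: eq_bigr => -[u [|a [|b r]]] _ /=;
  rewrite ?(lin0 (@lact_linr _ _ _ _ _)) ?scaler0 //.
by rewrite (linZ (@lact_linr _ _ _ _ _)) lactE scalerA -sgD add0r.
Qed.

Lemma ract_dtens w (a'' : h'') :
  ract (dtens kone w kone) (hval a'') = dtens kone w a'' :> R.
Proof.
rewrite /dtens (lin_sum (ract_linl _)); apply: eq_bigr => -[u [|a r]] _ /=.
  by rewrite (lin0 (ract_linl _)).
by rewrite (linZ (ract_linl _)) ractE.
Qed.

Lemma ract_dbar w (a'' : h'') :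
  ract (dbar kone w kone) (hval a'') = dbar kone w a'' :> R.
Proof.
rewrite /dbar (lin_sum (ract_linl _)); apply: eq_bigr => -[u [|a [|b r]]] _ /=;
  rewrite ?(lin0 (ract_linl _)) //.
by rewrite (linZ (ract_linl _)) ractE.
Qed.

Lemma dleft_aug w (a'' : h'') : dleft (aug_mor A) kone w a'' = 0.
Proof.
case: w => [|a r] //=.
by rewrite aug_aval mulr0 (lin0 (bt_linl _ _)) scaler0.
Qed.

Lemma dright_aug (a' : h') w : dright (aug_mor A) a' w kone = 0.
Proof.
rewrite /dright big1 // => -[u [|a [|b r]]] _ //=.
by rewrite aug_aval mul0r (lin0 (bt_linr _ _)) scaler0.
Qed.

Lemma bar_diff_R0 w (a'' : h'') : bar_diff (aug_mor A) phi'' (bt (1 : K) (hvals w) (hval a'')) =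
  dtens kone w a'' + dbar kone w a''
  + sg (wdeg w) *: bt (1 : K) (hvals w) (adiff A'' (hval a'')) - dright phi'' kone w a''.
Proof.
rewrite -[bt _ _ _]/(bval (kone, w, a'')) bar_diffE /dsym dleft_aug addr0 add0r.
by rewrite (lin0 (bt_linl _ _)) add0r.
Qed.

(** B(A', A, A'') is A' tensored with B(k, A, A''), apart from the term that moves the first letter
    into A'. The right outer term and the inner terms are inherited from the one-sided
    construction. *)
Lemma bar_diff_M (a' : h') w (a'' : h'') : bar_diff phi' phi'' (bt (hval a') (hvals w) (hval a'')) =
  bt (adiff A' (hval a')) (hvals w) (hval a'')
  + sg (hdeg a') *: lact (hval a') (bar_diff (aug_mor A) phi'' (bt (1 : K) (hvals w) (hval a'')))
  + dleft phi' a' w a''.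
Proof.
rewrite bar_diff_R0 -[LHS]/(bar_diff _ _ (bval (a', w, a''))) bar_diffE /dsym.
rewrite (linB (@lact_linr _ _ _ _ _)) !(linD (@lact_linr _ _ _ _ _)) (linZ (@lact_linr _ _ _ _ _)).
rewrite lactE scalerBr !scalerDr lact_dtens lact_dbar lact_dright scalerA -sgD.
by rewrite -!addrA; do 4 congr (_ + _); rewrite addrC.
Qed.
End General.

Section BarA.
Variable (A : adga k).
Implicit Types w u r : seq (helt (@bhom k A)).

Lemma epsA_linear : linear (@bar_eps k K A K : BA A -> k^o).
Proof. exact: bar_eps_linear. Qed.

Lemma preA_linear (a : abar A) : linear (pre a : BA A -> BA A).
Proof. exact: pre_linr. Qed.

Definition dBA : BA A -> BA A := bar_diff (aug_mor A) (aug_mor A).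

Lemma dBA_linear : linear dBA.
Proof. exact: bar_diff_linear. Qed.

End BarA.
End DiffFormulas.

Ltac lin_op2 f ::= match f with
  | (fun x => dBA (@?g x)) => refine (@islin_comp _ _ _ _ _ g (@dBA_linear _ _) _)
  end.

Section BarA.
Variables (k : comNzRingType) (A : adga k).
Local Notation kone := (kone k).
Implicit Types w u r : seq (helt (@bhom k A)).

Lemma dBAE w : dBA (word (hvals w)) = dtens kone w kone + dbar kone w kone.
Proof.
rewrite /dBA (bar_diff_R0 (aug_mor A) w kone) dright_aug subr0.
by rewrite (lin0 (bt_linr _ _)) scaler0 addr0.
Qed.

Lemma dBA_nil : dBA (word ([::] : seq (abar A))) = 0.
Proof. by rewrite (dBAE [::]) /dtens /dbar !big_seq1 addr0. Qed.

(** The empty split contributes the terms that differentiate [a] or multiply it with the next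
    letter; on all other splits the operator has been moved past [a], which has degree [hdeg a - 1]
    in the bar construction. *)
Lemma dBA_cons a w : dBA (word (hvals (a :: w))) =
  - pre (red (adiff A (aval (hval a)))) (word (hvals w))
  + sg (hdeg a - 1) *: pre (hval a) (dBA (word (hvals w)))
  + (if w is b :: r then sg (hdeg a - 1) *:
       pre (red (aval (hval a) * aval (hval b))) (word (hvals r)) else 0).
Proof.
rewrite !dBAE (linD (@preA_linear k A _)) scalerDr.
pose F u (z : seq (helt (@bhom k A))) : BA A := if z is a :: r then sg (hdeg kone + wdeg u) *: bt (hval kone)
  (hvals u ++ - red (adiff A (aval (hval a))) :: hvals r) (hval kone) else 0.
pose G u (z : seq (helt (@bhom k A))) : BA A := if z is a :: b :: r then sg (hdeg kone + (wdeg u + (hdeg a - 1))) *: bt (hval kone)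
  (hvals u ++ red (aval (hval a) * aval (hval b)) :: hvals r) (hval kone) else 0.
rewrite -[dtens kone (a :: w) kone]/(\sum_(p <- splits (a :: w)) F p.1 p.2).
rewrite -[dbar kone (a :: w) kone]/(\sum_(p <- splits (a :: w)) G p.1 p.2).
rewrite !splits_cons.
have -> : F [::] (a :: w) = - pre (red (adiff A (aval (hval a)))) (word (hvals w)).
  by rewrite /F wdeg_nil addr0 sg0 scale1r /= (linN (bt_linh _ _ _)) pre_word.
have -> : \sum_(p <- splits w) F (a :: p.1) p.2 =
    sg (hdeg a - 1) *: pre (hval a) (dtens kone w kone).
  rewrite /dtens (lin_sum (@preA_linear k A _)) scaler_sumr; apply: eq_bigr => -[u [|b r]] _ /=.
    by rewrite (lin0 (@preA_linear k A _)) scaler0.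
  by rewrite (linZ (@preA_linear k A _)) preE scalerA -sgD /F wdeg_cons /= !add0r.
have -> : \sum_(p <- splits w) G (a :: p.1) p.2 =
    sg (hdeg a - 1) *: pre (hval a) (dbar kone w kone).
  rewrite /dbar (lin_sum (@preA_linear k A _)) scaler_sumr; apply: eq_bigr => -[u [|b [|c r]]] _ /=;
    rewrite ?(lin0 (@preA_linear k A _)) ?scaler0 //.
  by rewrite (linZ (@preA_linear k A _)) preE scalerA -sgD /G wdeg_cons /= !add0r !addrA.
have -> : G [::] (a :: w) = if w is b :: r then sg (hdeg a - 1) *:
       pre (red (aval (hval a) * aval (hval b))) (word (hvals r)) else 0.
  by rewrite /G; case: (w) => [|b r] //; rewrite wdeg_nil !add0r pre_word.
by rewrite -!addrA; do 2 congr (_ + _); rewrite addrC.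
Qed.

Lemma eps_pre (a : abar A) (x : BA A) : bar_eps (pre a x) = 0.
Proof.
pose L (x : BA A) : k^o := bar_eps (pre a x).
have Ll : linear L by rewrite /L; lin.
suff E : L = (fun _ => 0) by exact: (congr1 (@^~ x) E).
apply: BA_lin_eq => // [|w]; first exact: islin_zero.
by rewrite /L pre_word /word bar_epsE.
Qed.

Lemma eps_dBA (x : BA A) : bar_eps (dBA x) = 0.
Proof.
pose L (x : BA A) : k^o := bar_eps (dBA x).
have Ll : linear L by rewrite /L /dBA; lin.
suff E : L = (fun _ => 0) by exact: (congr1 (@^~ x) E).
apply: BA_lin_eq => // [|[|a w]]; rewrite /L; first exact: islin_zero.
  by rewrite dBA_nil (lin0 (@epsA_linear k A)).
rewrite dBA_cons !(linD (@epsA_linear k A)) (linN (@epsA_linear k A)).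
rewrite (linZ (@epsA_linear k A)) !eps_pre oppr0 scaler0 !add0r.
case: w => [|b r]; first by rewrite (lin0 (@epsA_linear k A)).
by rewrite (linZ (@epsA_linear k A)) eps_pre scaler0.
Qed.

Lemma eps_word (w : seq (abar A)) : bar_eps (word w) = (w == [::])%:R.
Proof. by rewrite /word bar_epsE; case: w => //=; rewrite mulr1. Qed.

Lemma twist_pre (a : abar A) (x : BA A) : twist (pre a x) = (bar_eps x) *: aval a.
Proof.
pose L (x : BA A) : A := (bar_eps x) *: aval a.
have Ll : linear L by rewrite /L; lin.
suff E : (fun x => twist (pre a x)) = L by exact: (congr1 (@^~ x) E).
apply: BA_lin_eq => // [|w]; first by lin.
rewrite pre_word twistE /L eps_word.
by case: (hvals w) => [|b r]; rewrite ?scale1r ?scale0r.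
Qed.

Lemma bsign_word w : bsign (word (hvals w)) = sg (wdeg w) *: word (hvals w).
Proof. by rewrite -[word _]/(bval (kone, w, kone)) bsignE /bdeg /= add0r addr0. Qed.

Lemma bsign_pre (a : helt (@bhom k A)) (x : BA A) :
  bsign (pre (hval a) x) = sg (hdeg a - 1) *: pre (hval a) (bsign x).
Proof.
pose L (x : BA A) : BA A := sg (hdeg a - 1) *: pre (hval a) (bsign x).
have Ll : linear L by rewrite /L; lin.
suff E : (fun x => bsign (pre (hval a) x)) = L by exact: (congr1 (@^~ x) E).
apply: BA_lin_eq => // [|w]; first by lin.
rewrite /L bsign_word (linZ (@preA_linear k A _)) !pre_word.
by rewrite (bsign_word (a :: w)) wdeg_cons scalerA sgD.
Qed.

Lemma cop_counitl (N : lmodType k) (L : BA A -> N) (x : BA A) : linear L ->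
  cop (fun x y => bar_eps x *: L y) x = L x.
Proof.
move=> Ll; have b : bilin (fun x y : BA A => bar_eps x *: L y).
  by split=> y; lin; exact: islin_scale.
suff E : cop (fun x y => bar_eps x *: L y) = L by exact: (congr1 (@^~ x) E).
apply: BA_lin_eq => // [|w]; first exact: cop_linear.
rewrite copE //; case: w => [|a w]; first by rewrite big_seq1 eps_word scale1r.
rewrite (splits_cons (fun u v => bar_eps (word (hvals u)) *: L (word (hvals v)))).
by rewrite eps_word scale1r big1 ?addr0 // => p _; rewrite eps_word scale0r.
Qed.

(** On [a :: w] the recursion [dBA_cons] is compared with the cuts in front of [a] and behind it.
    Multiplying the first two letters is compatible with every cut except the one between them, and
    that cut carries no such term on either side. *)
Lemma coderivation (N : lmodType k) (G : BA A -> BA A -> N) x : bilin G ->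
  cop G (dBA x) = cop (fun x y => G (dBA x) y + G (bsign x) (dBA y)) x.
Proof.
have b (N' : lmodType k) (G' : BA A -> BA A -> N') : bilin G' ->
    bilin (fun x y => G' (dBA x) y + G' (bsign x) (dBA y)) by move=> Gb'; lin.
(* The statement is generalised over [G], since the induction hypothesis is applied to [G]
   precomposed with the prepending of [a]. *)
move=> Gb0; suff H w : forall (N' : lmodType k) (G' : BA A -> BA A -> N'), bilin G' ->
    cop G' (dBA (word (hvals w))) =
    cop (fun x y => G' (dBA x) y + G' (bsign x) (dBA y)) (word (hvals w)).
  suff E : (fun x => cop G (dBA x)) = cop (fun x y => G (dBA x) y + G (bsign x) (dBA y)).
    exact: (congr1 (@^~ x) E).
  apply: BA_lin_eq => [||w]; [exact: islin_comp (cop_linear Gb0) (@dBA_linear _ _)|exact/cop_linear/b|].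
  exact: H.
elim: w => [|a w IH] {x N G Gb0} N G Gb.
  rewrite dBA_nil (lin0 (cop_linear Gb)) (@copE _ _ _ _ [::]) ?big_seq1 /=; last exact: b.
  by rewrite dBA_nil (lin0 (Gb.1 _)) (lin0 (Gb.2 _)) addr0.
have bp c : bilin (fun x y : BA A => G (pre c x) y) by lin.
rewrite [RHS](copE _ (b _ _ Gb)).
rewrite (splits_cons (fun u v => G (dBA (word (hvals u))) (word (hvals v)) +
   G (bsign (word (hvals u))) (dBA (word (hvals v))))).
rewrite [in RHS]dBA_nil (lin0 (Gb.1 _)) add0r (bsign_word [::]) wdeg_nil sg0 scale1r.
rewrite !dBA_cons !(linD (cop_linear Gb)) (linN (cop_linear Gb)) (linZ (cop_linear Gb)).
rewrite !(cop_pre _ _ Gb) (IH _ _ (bp _)) !(linD (Gb.2 _)) (linN (Gb.2 _)) (linZ (Gb.2 _)).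
have -> : \sum_(p <- splits w) (G (dBA (word (hvals (a :: p.1)))) (word (hvals p.2)) +
     G (bsign (word (hvals (a :: p.1)))) (dBA (word (hvals p.2)))) =
   - cop (fun x y : BA A => G (pre (red (adiff A (aval (hval a)))) x) y) (word (hvals w))
   + sg (hdeg a - 1) *: cop (fun x y : BA A => G (pre (hval a) (dBA x)) y +
       G (pre (hval a) (bsign x)) (dBA y)) (word (hvals w))
   + (if w is c :: r then sg (hdeg a - 1) *:
       cop (fun x y : BA A => G (pre (red (aval (hval a) * aval (hval c))) x) y) (word (hvals r))
      else 0).
  rewrite !(copE _ (bp _)) (copE _ (b _ _ (bp _))).
  have -> : (if w is c :: r then sg (hdeg a - 1) *:
       cop (fun x y : BA A => G (pre (red (aval (hval a) * aval (hval c))) x) y) (word (hvals r))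
      else 0) = \sum_(p <- splits w) (if p.1 is c :: r then sg (hdeg a - 1) *:
         G (pre (red (aval (hval a) * aval (hval c))) (word (hvals r))) (word (hvals p.2)) else 0).
    rewrite (splits_head (fun c u v => sg (hdeg a - 1) *:
         G (pre (red (aval (hval a) * aval (hval c))) (word (hvals u))) (word (hvals v)))).
    by case: (w) => // c r; rewrite (copE _ (bp _)) scaler_sumr.
  rewrite -sumrN scaler_sumr -!big_split /=; apply: eq_bigr => -[u v] _ /=.
  rewrite (dBA_cons a) !(linD (Gb.1 _)) (linN (Gb.1 _)) (linZ (Gb.1 _)).
  rewrite -pre_word bsign_pre (linZ (Gb.1 _)) scalerDr -!addrA; do 2 congr (_ + _); rewrite addrC; congr (_ + _).
  by case: u => [|c r]; rewrite ?(lin0 (Gb.1 _)) ?(linZ (Gb.1 _)).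
have -> : cop G (if w is c :: r then sg (hdeg a - 1) *:
       pre (red (aval (hval a) * aval (hval c))) (word (hvals r)) else 0) =
    G (word [::]) (if w is c :: r then sg (hdeg a - 1) *:
       pre (red (aval (hval a) * aval (hval c))) (word (hvals r)) else 0) +
    (if w is c :: r then sg (hdeg a - 1) *:
       cop (fun x y : BA A => G (pre (red (aval (hval a) * aval (hval c))) x) y) (word (hvals r))
      else 0).
  case: (w) => [|c r]; first by rewrite (lin0 (cop_linear Gb)) (lin0 (Gb.2 _)) addr0.
  by rewrite (linZ (cop_linear Gb)) (cop_pre _ _ Gb) (linZ (Gb.2 _)) scalerDr.
by rewrite opprD scalerDr !addrA [LHS](ACl (1*3*5*2*4*6)).
Qed.

(** The Maurer-Cartan equation of the canonical twisting cochain. Both sides vanish except on words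
    of length two, where each gives the signed product of the two letters. *)
Lemma twist_dBA (x : BA A) :
  adiff A (twist x) + twist (dBA x) = cop (fun x y => twist (bsign x) * twist y) x.
Proof.
have b : bilin (fun x y : BA A => twist (bsign x) * twist y) by lin.
suff E : (fun x : BA A => adiff A (twist x) + twist (dBA x)) =
    cop (fun x y => twist (bsign x) * twist y) by exact: (congr1 (@^~ x) E).
apply: BA_lin_eq => [||w]; [by lin|exact: cop_linear|].
rewrite (copE _ b) {b}; case: w => [|a w].
  by rewrite big_seq1 /= dBA_nil (lin0 (@twist_linear _ _)) twistE mulr0 addr0 linear0.
rewrite (splits_cons (fun u v => twist (bsign (word (hvals u))) * twist (word (hvals v)))).
rewrite (bsign_word [::]) (linZ (@twist_linear _ _)) (twistE [::]) scaler0 mul0r add0r.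
rewrite dBA_cons !(linD (@twist_linear _ _)) (linN (@twist_linear _ _)) (linZ (@twist_linear _ _)).
rewrite !twist_pre eps_dBA scale0r scaler0 addr0 eps_word.
under eq_bigr => p _ do rewrite -pre_word bsign_pre (linZ (@twist_linear _ _)) twist_pre
  bsign_word (linZ (@epsA_linear k A)) eps_word.
have d0 : aeps A (adiff A (aval (hval a))) = 0 by exact: aeps_diff.
case: w => [|b w].
  by rewrite big_seq1 scale1r (aval_red d0) !twistE /= mulr0 (lin0 (@twist_linear _ _)) addr0 subrr.
have ab0 : aeps A (aval (hval a) * aval (hval b)) = 0.
  by rewrite rmorphM /= aeps_aval mul0r.
rewrite scale0r oppr0 add0r (linZ (@twist_linear _ _)) twist_pre eps_word (aval_red ab0).
rewrite (splits_cons (fun u v => ((sg (hdeg a - 1) *: ((sg (wdeg u) *: (hvals u == [::])%:R : k^o) *: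
   aval (hval a))) * twist (word (hvals v))))) wdeg_nil.
rewrite big1 ?addr0 => [|p _]; last by rewrite scaler0 scale0r scaler0 mul0r.
rewrite !twistE /= linear0 add0r sg0 !scale1r -scalerAl; case: w => [|c w] //=.
  by rewrite scale1r.
by rewrite scale0r scaler0 mulr0 scaler0.
Qed.

End BarA.

(** * Homotopy Gerstenhaber algebras *)

Lemma eq_splits_cat (T : Type) (k : comNzRingType) (N : lmodType k) (F G : seq T -> seq T -> N) w :
  (forall u v, u ++ v = w -> F u v = G u v) ->
  \sum_(p <- splits w) F p.1 p.2 = \sum_(p <- splits w) G p.1 p.2.
Proof.
elim: w F G => [|a w IH] F G FG; first by rewrite !splits_nil FG.
by rewrite !splits_cons FG // (IH (fun u v => F (a :: u) v) (fun u v => G (a :: u) v)) // => u v uv; apply: FG; rewrite /= uv.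
Qed.

Lemma cop_ext (k : comNzRingType) (A : adga k) (N : lmodType k) (F G : BA A -> BA A -> N) x :
  (forall y z, F y z = G y z) -> cop F x = cop G x.
Proof.
by move=> FG; congr (cop _ x); apply: funext => y; apply: funext => z; exact: FG.
Qed.

Section BSign.
Variables (k : comNzRingType) (A' A A'' : adga k).

(* x |-> (-1)^(n |x|) x: the sign of an operator of degree n moved past x. *)
Definition bsg (n : int) (x : bmod A' A A'') : bmod A' A A'' := if par n then bsign x else x.

Lemma bsg_linear n : linear (bsg n).
Proof. by rewrite /bsg; case: (par n) => c x y //; rewrite bsign_linear. Qed.

Lemma bsg_bval n s : bsg n (bval s) = sg (n * bdeg s) *: bval s.
Proof. by rewrite /bsg sgE parM; case: (par n); rewrite ?bsignE ?sgE ?expr0 ?scale1r. Qed.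

Lemma bsg_hom n m x : bar_hom m x -> bsg n x = sg (n * m) *: x.
Proof. by move=> hx; rewrite /bsg sgE parM; case: (par n); rewrite ?(bsign_hom hx) ?sgE ?expr0 ?scale1r. Qed.

End BSign.

Lemma bsg_word (k : comNzRingType) (A : adga k) n (w : seq (helt (@bhom k A))) :
  bsg n (word (hvals w)) = sg (n * wdeg w) *: word (hvals w).
Proof. by rewrite -[word _]/(bval (kone k, w, kone k)) bsg_bval /bdeg /= add0r addr0. Qed.

Lemma bar_hom_word (k : comNzRingType) (A : adga k) (w : seq (helt (@bhom k A))) :
  bar_hom (wdeg w) (word (hvals w)).
Proof. by have := bar_hom_bt w (ahom1 (k_adga k)) (ahom1 (k_adga k)); rewrite add0r addr0. Qed.

Ltac lin_op2 f ::= match f with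
  | (fun x => dBA (@?g x)) => refine (@islin_comp _ _ _ _ _ g (@dBA_linear _ _) _)
  | (fun x => bsg ?n (@?g x)) => refine (@islin_comp _ _ _ _ _ g (@bsg_linear _ _ _ _ n) _)
  end.

Lemma word0 (k : comNzRingType) (A : adga k) (w : seq (abar A)) : word (0 :: w) = 0.
Proof. by rewrite /word (lin0 (bt_linh (1 : k_adga k) w (1 : k_adga k))). Qed.

Lemma cop_counitr (k : comNzRingType) (A : adga k) (N : lmodType k) (L : BA A -> N) (x : BA A) :
  linear L -> cop (fun x y => bar_eps y *: L x) x = L x.
Proof.
move=> Ll; have b : bilin (fun x y : BA A => bar_eps y *: L x).
  by lin; exact: islin_scale.
suff E : cop (fun x y => bar_eps y *: L x) = L by exact: (congr1 (@^~ x) E).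
apply: BA_lin_eq => // [|w]; first exact: cop_linear.
rewrite copE // -(sum_splits (fun u v => bar_eps (word (hvals v)) *: L (word (hvals u)))).
rewrite big_ord_recr /= big1 => [|i _]; last first.
  by rewrite eps_word /hvals -size_eq0 size_map size_drop subn_eq0 leqNgt ltn_ord scale0r.
by rewrite add0r take_size drop_size eps_word scale1r.
Qed.

Lemma adiff1 (k : comNzRingType) (A : adga k) : adiff A 1 = 0.
Proof.
have := adiffM 1 (ahom1 A); rewrite !mulr1 sg0 scale1r mul1r => /eqP.
by rewrite -subr_eq0 opprD addNKr oppr_eq0 => /eqP.
Qed.

Lemma khom_unit (k : comNzRingType) (c : helt (@ahom k (k_adga k))) :
  hval c = 0 \/ hdeg c = 0.
Proof. by case: (hvalP c); [right|left]. Qed.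

Lemma BA_hom_ind (k : comNzRingType) (A : adga k) n (P : BA A -> Prop) (x : BA A) :
  bar_hom n x -> P 0 -> (forall c x y, P x -> P y -> P (c *: x + y)) ->
  (forall w : seq (helt (@bhom k A)), wdeg w = n -> P (word (hvals w))) -> P x.
Proof.
move=> hx P0 PZD Pw; apply: (bar_hom_ind hx) => // -[[c w] c'].
rewrite /bval /bdeg /= bt1 bt1r => dn.
have PZ (e : k) (z : BA A) : P z -> P (e *: z) by move=> Pz; rewrite -[_ *: _]addr0; exact: PZD.
have [->|c0] := khom_unit c; first by rewrite scale0r.
have [->|c'0] := khom_unit c'; first by rewrite scale0r scaler0.
refine (PZ _ _ (PZ _ _ (Pw w _))).
by rewrite -dn c0 c'0 add0r addr0.
Qed.

Lemma twist_hom (k : comNzRingType) (A : adga k) d (z : BA A) :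
  bar_hom d z -> ahom (d + 1) (twist z).
Proof.
move=> hz; have gA := ahom_grading A.
apply: (BA_hom_ind (P := fun z => ahom (d + 1) (twist z)) hz).
- by rewrite (lin0 (@twist_linear _ _)); exact: (grad0 gA _).
- by move=> c u v hu hv; rewrite twist_linear; exact: gradZD gA _ c _ _ hu hv.
move=> [|a [|b w]] <-; rewrite twistE; [exact: (grad0 gA _)| |exact: (grad0 gA _)].
by rewrite wdeg_cons wdeg_nil addr0 subrK; exact: (hvalP a).
Qed.

Section Hga.
Variables (k : comNzRingType) (A : hga_data k).
Hypothesis hA : is_hga A.
Implicit Types (x y z : BA A) (a b : A).

Lemma hmu_bilin : bilin (@hmu k A).
Proof. by split; [exact: hmu_linl hA|exact: hmu_linr hA]. Qed.
Let mb := hmu_bilin.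

Lemma hmu_word1l x : hmu (word [::]) x = x.
Proof. exact: (hmu1l hA). Qed.

Lemma hmu_word1r x : hmu x (word [::]) = x.
Proof. exact: (hmu1r hA). Qed.

(** The bialgebra axiom [hmu_deconc], seen through [cop_deconc]. *)
Lemma cop_mu (N : lmodType k) (G : BA A -> BA A -> N) (u w : seq (helt (@bhom k A))) : bilin G ->
  cop G (hmu (word (hvals u)) (word (hvals w))) =
  \sum_(p <- splits u) \sum_(q <- splits w) sg (wdeg p.2 * wdeg q.1) *:
    G (hmu (word (hvals p.1)) (word (hvals q.1))) (hmu (word (hvals p.2)) (word (hvals q.2))).
Proof.
move=> Gb; have [L [Ll LE ->]] := cop_deconc Gb; rewrite (hmu_deconc hA) (lin_sum Ll).
rewrite -(sum_splits (fun u1 u2 => \sum_(q <- splits w) sg (wdeg u2 * wdeg q.1) *: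
    G (hmu (word (hvals u1)) (word (hvals q.1))) (hmu (word (hvals u2)) (word (hvals q.2))))).
apply: eq_bigr => i _; rewrite (lin_sum Ll).
rewrite -(sum_splits (fun w1 w2 => sg (wdeg (drop i u) * wdeg w1) *:
    G (hmu (word (hvals (take i u))) (word (hvals w1))) (hmu (word (hvals (drop i u))) (word (hvals w2))))).
by apply: eq_bigr => j _; rewrite (linZ Ll) LE.
Qed.

Lemma hmu_bsign x y : bsign (hmu x y) = hmu (bsign x) (bsign y).
Proof.
suff E (w : seq (helt (@bhom k A))) : (fun x => bsign (hmu x (word (hvals w)))) =
    fun x => hmu (bsign x) (bsign (word (hvals w))).
  suff E' : (fun y => bsign (hmu x y)) = fun y => hmu (bsign x) (bsign y).
    exact: (congr1 (@^~ y) E').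
  apply: BA_lin_eq => [||w]; [by lin|by lin|exact: (congr1 (@^~ x) (E w))].
apply: BA_lin_eq => [||u]; [by lin|by lin|].
have h := hmu_hom hA (bar_hom_word u) (bar_hom_word w).
by rewrite (bsign_hom h) !bsign_word (linZ (mb.1 _)) (linZ (mb.2 _)) scalerA sgD.
Qed.

Lemma hmu_bsg n x y : bsg n (hmu x y) = hmu (bsg n x) (bsg n y).
Proof. by rewrite /bsg; case: (par n); rewrite ?hmu_bsign. Qed.

Lemma hmu_bar_eps x y : bar_eps (hmu x y) = bar_eps x * bar_eps y.
Proof. exact: (hmu_eps hA). Qed.

Lemma hE_bilin : bilin (@hE k A).
Proof. by rewrite /hE; lin. Qed.
Let eb := hE_bilin.

(** By [hE_ge2] only the components of [x] of length 0 and 1 contribute; they are recorded by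
    [bar_eps x] and [twist x]. This is what allows E to be iterated. *)
Lemma hE_twist x z : hE x z = bar_eps x *: twist z + hE (word [:: red (twist x)]) z.
Proof.
pose L x := bar_eps x *: twist z + hE (word [:: red (twist x)]) z.
suff E : (fun x => hE x z) = L by exact: (congr1 (@^~ x) E).
apply: BA_lin_eq => [||w]; first by lin.
  by rewrite /L /word; lin.
have w0 : word [:: red (0 : A)] = 0 by rewrite (lin0 (@red_linear k A)) word0.
rewrite /L eps_word twistE; case: w => [|a [|b w]].
- by rewrite w0 (lin0 (eb.1 _)) addr0 scale1r /hE hmu_word1l.
- by rewrite scale0r add0r redK.
by rewrite w0 (lin0 (eb.1 _)) (hE_ge2 hA) // scale0r addr0.
Qed.

(* The right action a <| y of the algebra BA on A. The hga axioms amount to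
   (a <| b) <| c = a <| bc, (ab) <| c = sum +-(a <| c1)(b <| c2), and a formula for
   d(a <| y) with correction terms in the twisting cochain. *)
Definition act a y : A := hE (word [:: red a]) y + (bar_eps y * (aeps A a : k)) *: 1.

Lemma act_bilin : bilin act.
Proof.
rewrite /act; split=> [y|a].
  apply: islin_add; first by rewrite /word; lin.
  move=> c u v; rewrite (@aeps_linear _ A) scalerA -scalerDl; congr (_ *: _).
  by rewrite mulrDr [_ *: _]/(_ * _) mulrCA.
apply: islin_add; first by lin.
move=> c u v; rewrite (@epsA_linear _ A) scalerA -scalerDl; congr (_ *: _).
by rewrite mulrDl [_ *: _]/(_ * _) mulrA.
Qed.
Let ab := act_bilin.

Lemma act1 y : act 1 y = bar_eps y *: 1.
Proof.
rewrite /act red1 word0 (lin0 (eb.1 _)) add0r.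
by rewrite rmorph1 mulr1.
Qed.

Lemma act_word1 a : act a (word [::]) = a.
Proof.
rewrite /act /hE hmu_word1r twistE eps_word mul1r /=.
by rewrite subrK.
Qed.

Lemma act_twist x z : act (twist x) z = hE x z - bar_eps x *: twist z.
Proof. by rewrite /act twist_eps mulr0 scale0r addr0 [hE x z]hE_twist addrC addKr. Qed.

Lemma act_abar (a : abar A) z : act (aval a) z = hE (word [:: a]) z.
Proof. by rewrite /act aeps_aval mulr0 scale0r addr0 redK. Qed.

(** E([a], y) is [twist] of [a].y, so by [hE_twist] acting on it with [z] gives E([a].y, z); the
    counit term drops out because [a] has positive length. Associativity of the product on BA
    finishes. *)
Lemma act_act a y z : act (act a y) z = act a (hmu y z).
Proof.
rewrite {2}/act (linD (ab.1 _)) (linZ (ab.1 _)) act1 {1}/hE act_twist hmu_bar_eps eps_word.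
by rewrite mul0r scale0r subr0 /act /hE (hmuA hA) hmu_bar_eps scalerA mulrAC.
Qed.

Lemma aeps_act a y : aeps A (act a y) = (bar_eps y * (aeps A a : k) : k^o).
Proof. by rewrite /act raddfD /= twist_eps add0r linearZ /= rmorph1 /GRing.scale /= mulr1. Qed.

(** [twist_dBA] is evaluated at the product of [a|b] and w. By [hE_ge2] every term with a two-letter
    word in the first argument of E vanishes: on the left only the summand [ab] of d[a|b] is left,
    on the right only the cut between [a] and [b]. *)
Lemma hE_ab (a b : helt (@bhom k A)) (w : seq (helt (@bhom k A))) :
  hE (word [:: red (aval (hval a) * aval (hval b))]) (word (hvals w)) =
  \sum_(q <- splits w) sg (hdeg b * wdeg q.1) *:
     (hE (word [:: hval a]) (word (hvals q.1)) * hE (word [:: hval b]) (word (hvals q.2))).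
Proof.
have tb : bilin (fun x y => twist (bsign x) * twist y) by lin.
have z2 (v : seq (abar A)) y : (2 <= size v)%N -> twist (hmu (word v) y) = 0 by exact: (hE_ge2 hA).
have := twist_dBA (hmu (word (hvals [:: a; b])) (word (hvals w))).
rewrite z2 // raddf0 add0r [dBA _](hmu_diff hA _ (bar_hom_word _)).
rewrite (linD (@twist_linear _ _)) (linZ (@twist_linear _ _)) z2 // scaler0 addr0.
rewrite -[cdiff _]/(dBA _) dBA_cons pre_word (dBA_cons b [::]) dBA_nil.
rewrite (lin0 (@preA_linear _ _ _)) scaler0 !addr0 pre_word (linN (@preA_linear _ _ _)) pre_word.
rewrite scalerN -opprD !(linD (mb.1 _), linN (mb.1 _), linZ (mb.1 _)).
rewrite !(linD (@twist_linear _ _), linN (@twist_linear _ _), linZ (@twist_linear _ _)).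
rewrite !z2 // scaler0 addr0 oppr0 add0r pre_word => E.
rewrite -[LHS](sgZK (hdeg a - 1)) E (cop_mu [:: a; b] w tb).
pose T (u1 u2 : seq (helt (@bhom k A))) := \sum_(q <- splits w) sg (wdeg u2 * wdeg q.1) *:
  (twist (bsign (hmu (word (hvals u1)) (word (hvals q.1)))) * twist (hmu (word (hvals u2)) (word (hvals q.2)))).
rewrite (splits_cons T) (splits_cons (fun u v => T (a :: u) v)) big_seq1.
have -> : T [::] [:: a; b] = 0 by apply: big1 => q _; rewrite z2 // mulr0 scaler0.
have -> : T [:: a; b] [::] = 0.
  apply: big1 => q _; rewrite hmu_bsign bsign_word (linZ (mb.1 _)) (linZ (@twist_linear _ _)) z2 //.
  by rewrite scaler0 mul0r scaler0.
rewrite add0r addr0 scaler_sumr; apply: eq_bigr => q _.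
rewrite (bsign_hom (hmu_hom hA (bar_hom_word [:: a]) (bar_hom_word q.1))).
rewrite (linZ (@twist_linear _ _)) -scalerAl !scalerA -!sgD; congr (_ *: _).
by apply: par_eq; rewrite !wdeg_cons wdeg_nil; par_solve.
Qed.

(** A is the direct sum of the multiples of 1 and the augmentation ideal, compatibly with
    degrees. *)
Lemma hdec_act (N : lmodType k) (L L' : A -> N) : linear L -> linear L' -> L 1 = L' 1 ->
  (forall a : helt (@bhom k A), L (aval (hval a)) = L' (aval (hval a))) -> L = L'.
Proof.
move=> Ll Ll' L1 La; apply: A_lin_eq => // a.
have -> : hval a = aval (red (hval a)) + (aeps A (hval a) : k) *: 1 by rewrite /= subrK.
rewrite (linD Ll) (linD Ll') (linZ Ll) (linZ Ll') L1; congr (_ + _).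
exact: (La (Helt (bhom_red (hvalP a)))).
Qed.

(** [hE_ab] is the case where [a] and [b] lie in the augmentation ideal. If one of them is 1, the
    formula is a counit identity, because 1 <| y is [bar_eps y] times 1. *)
Lemma act_mul n a b z : ahom n b ->
  act (a * b) z = cop (fun z1 z2 => act a (bsg n z1) * act b z2) z.
Proof.
move=> hb; have cb (c d : A) : bilin (fun z1 z2 => act c (bsg n z1) * act d z2) by lin.
suff E : act (a * b) = cop (fun z1 z2 => act a (bsg n z1) * act b z2).
  exact: (congr1 (@^~ z) E).
apply: BA_lin_eq => [||w]; [exact: ab.2|exact: cop_linear|].
rewrite copE //; pose L (c d : A) := \sum_(p <- splits w)
  act c (bsg n (word (hvals p.1))) * act d (word (hvals p.2)).
pose L' (c d : A) := act (c * d) (word (hvals w)); rewrite -/(L a b) -/(L' a b).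
have Ll b' : linear (L^~ b') by rewrite /L; lin.
have Ll' b' : linear (L'^~ b') by rewrite /L'; lin.
have Lr a' : linear (L a') by rewrite /L; lin.
have Lr' a' : linear (L' a') by rewrite /L'; lin.
suff E : L'^~ b = L^~ b by exact: (congr1 (@^~ a) E).
have bE : b = aval (red b) + (aeps A b : k) *: 1 by rewrite /= subrK.
(* A nonzero scalar part forces [b] to have degree 0, where [bsg n] is the identity. *)
have n0 : (aeps A b : k) = 0 \/ n = 0.
  by have [->|n0] := eqVneq n 0; [right|left; exact: aeps_hom hb n0].
apply: hdec_act => [||| a0]; [exact: Ll'|exact: Ll| |].
  rewrite /L /L' mul1r -(cop_counitl (word (hvals w)) (ab.2 b)).
  rewrite copE; last by lin.
  apply: eq_bigr => p _; rewrite act1 bsg_word (linZ (@epsA_linear _ A)) eps_word.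
  case: (p.1) => [|c r] /=; last by rewrite scaler0 !scale0r mul0r.
  by rewrite wdeg_nil mulr0 sg0 !scale1r mul1r.
rewrite bE (linD (Lr _)) (linD (Lr' _)); congr (_ + _).
  have := hE_ab a0 (Helt (bhom_red hb)) w; rewrite /L' /L -act_abar aval_red => [->|]; last first.
    by rewrite rmorphM /= aeps_aval mul0r.
  by apply: eq_bigr => p _; rewrite bsg_word (linZ (ab.2 _)) -scalerAl !act_abar.
case: n0 => [->|n0]; first by rewrite !scale0r (lin0 (Lr _)) (lin0 (Lr' _)).
rewrite (linZ (Lr _)) (linZ (Lr' _)); congr (_ *: _); rewrite /L /L' mulr1 n0.
rewrite -(sum_splits (fun u v => act (aval (hval a0)) (bsg 0 (word (hvals u))) * act 1 (word (hvals v)))).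
rewrite big_ord_recr /= big1 => [|i _]; last first.
  rewrite act1 eps_word /hvals -size_eq0 size_map size_drop subn_eq0 leqNgt ltn_ord.
  by rewrite scale0r mulr0.
by rewrite add0r take_size drop_size act1 eps_word scale1r mulr1.
Qed.

(** For [a] in the augmentation ideal this is [twist_dBA] at the product of [a] and w: the two
    splits of the one-letter word [a] give the two correction terms. *)
Lemma act_diff n a z : ahom n a ->
  adiff A (act a z) = act (adiff A a) z + sg n *: act a (dBA z)
    + cop (fun z1 z2 => sg (n + 1) *: (act a (bsign z1) * twist z2) + twist (bsg n z1) * act a z2) z.
Proof.
move=> ha; have cb (c : A) : bilin (fun z1 z2 => sg (n + 1) *: (act c (bsign z1) * twist z2)
  + twist (bsg n z1) * act c z2) by lin.
pose L z := act (adiff A a) z + sg n *: act a (dBA z)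
    + cop (fun z1 z2 => sg (n + 1) *: (act a (bsign z1) * twist z2) + twist (bsg n z1) * act a z2) z.
suff E : (fun z => adiff A (act a z)) = L by exact: (congr1 (@^~ z) E).
apply: BA_lin_eq => [||w]; first by lin.
  by apply: islin_add; [lin|exact: cop_linear].
rewrite /L copE // {L}.
pose P (c : A) := adiff A (act c (word (hvals w))).
pose Q (c : A) := act (adiff A c) (word (hvals w)) + sg n *: act c (dBA (word (hvals w))) +
  \sum_(p <- splits w) (sg (n + 1) *: (act c (bsign (word (hvals p.1))) * twist (word (hvals p.2)))
  + twist (bsg n (word (hvals p.1))) * act c (word (hvals p.2))).
have Pl : linear P by rewrite /P; lin.
have Ql : linear Q by rewrite /Q; lin.
rewrite -/(P a) -/(Q a).
have aE : a = aval (red a) + (aeps A a : k) *: 1 by rewrite /= subrK.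
have n0 : (aeps A a : k) = 0 \/ n = 0.
  by have [->|n0] := eqVneq n 0; [right|left; exact: aeps_hom ha n0].
rewrite aE (linD Pl) (linD Ql) (linZ Pl) (linZ Ql); congr (_ + _); last first.
  case: n0 => [->|n0]; first by rewrite !scale0r.
  congr (_ *: _); rewrite /P /Q n0 adiff1 (lin0 (ab.1 _)) !act1 eps_dBA scale0r scaler0 !add0r.
  rewrite linearZ /= adiff1 scaler0.
  (* For [a] = 1 both correction terms reduce to [twist], one through each counit identity, with
     opposite signs. *)
  have -> : \sum_(p <- splits w) (sg 1 *: (act 1 (bsign (word (hvals p.1))) * twist (word (hvals p.2))) +
      twist (bsg 0 (word (hvals p.1))) * act 1 (word (hvals p.2))) =
    - (cop (fun x y => bar_eps x *: twist y) (word (hvals w))) +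
      cop (fun x y => bar_eps y *: twist x) (word (hvals w)).
    rewrite !copE; [|by lin|by lin]; rewrite -sumrN -big_split; apply: eq_bigr => p _ /=.
    rewrite !act1 -scalerAr mulr1 -scalerAl mul1r scaleN1r bsign_word (linZ (@epsA_linear _ A)).
    congr (- _ + _); rewrite eps_word; case: (p.1) => [|c r] /=; last by rewrite scaler0 !scale0r.
    by rewrite wdeg_nil sg0 scale1r.
  by rewrite (cop_counitl _ (@twist_linear _ _)) (cop_counitr _ (@twist_linear _ _)) addNr.
have [a0 <- an] : exists2 a0 : helt (@bhom k A), hval a0 = red a & hdeg a0 = n.
  by exists (Helt (bhom_red ha)).
have tb : bilin (fun x y => twist (bsign x) * twist y) by lin.
have := twist_dBA (hmu (word (hvals [:: a0])) (word (hvals w))).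
rewrite [dBA _](hmu_diff hA _ (bar_hom_word _)) -[cdiff _]/(dBA _) -[cdiff _]/(dBA _).
rewrite (dBA_cons a0 [::]) dBA_nil (lin0 (@preA_linear _ _ _)) scaler0 !addr0 pre_word.
rewrite (linN (mb.1 _)) (linD (@twist_linear _ _)) (linZ (@twist_linear _ _)) (linN (@twist_linear _ _)).
rewrite wdeg_cons wdeg_nil addr0 (cop_mu [:: a0] w tb).
pose T (u1 u2 : seq (helt (@bhom k A))) := \sum_(q <- splits w) sg (wdeg u2 * wdeg q.1) *:
  (twist (bsign (hmu (word (hvals u1)) (word (hvals q.1)))) * twist (hmu (word (hvals u2)) (word (hvals q.2)))).
rewrite (splits_cons T) big_seq1 => /(canRL (addrK _)); rewrite opprD opprK.
move=> E; rewrite -[P _]/(adiff A (act (aval (hval a0)) (word (hvals w)))).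
rewrite (act_abar (hval a0)).
rewrite E /Q -an.
have -> : act (adiff A (aval (hval a0))) (word (hvals w)) =
    twist (hmu (word [:: red (adiff A (aval (hval a0)))]) (word (hvals w))).
  by rewrite -[RHS]act_abar aval_red //; exact: aeps_diff.
rewrite addrC -!addrA; congr (_ + _); rewrite act_abar.
rewrite -scaleNr -[- sg _]sgN subrK; congr (_ + _).
rewrite /T -big_split /=; apply: eq_bigr => q _.
rewrite addrC !hmu_word1l wdeg_nil mul0r sg0 scale1r !act_abar; congr (_ + _).
  rewrite hmu_bsign (bsign_word [:: a0]) (linZ (mb.1 _)) (linZ (@twist_linear _ _)) -scalerAl.
  by congr (_ *: _); apply: par_eq; rewrite wdeg_cons wdeg_nil; par_solve.
rewrite bsign_word bsg_word !(linZ (@twist_linear _ _)) -!scalerAl scalerA -sgD.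
by congr (_ *: _); apply: par_eq; rewrite wdeg_cons wdeg_nil; par_solve.
Qed.

Lemma hE_hom m n x y : bar_hom m x -> bar_hom n y -> ahom (m + n + 1) (hE x y).
Proof. by move=> hx hy; apply: twist_hom; exact: (hmu_hom hA hx hy). Qed.

Lemma act_hom m n a y : ahom m a -> bar_hom n y -> ahom (m + n) (act a y).
Proof.
move=> ha hy; have gA := ahom_grading A; rewrite /act -[hE _ _]scale1r; apply: (gradZD gA).
  have := hE_hom (bar_hom_word [:: Helt (bhom_red ha)]) hy.
  by rewrite wdeg_cons wdeg_nil /= addr0 addrAC subrK.
have [/eqP|n0] := boolP (m + n == 0).
  by move=> ->; apply: gradZ => //; exact: ahom1.
have [->|m0] := eqVneq m 0; last by rewrite (aeps_hom ha m0) mulr0 scale0r; exact: (grad0 gA _).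
have := n0; have [->|m0' _] := eqVneq m 0.
  rewrite add0r => n0'; rewrite (_ : bar_eps y = 0) ?mul0r ?scale0r; first exact: (grad0 gA _).
  apply: (BA_hom_ind (P := fun y => bar_eps y = 0) hy).
  - exact: lin0 (@epsA_linear k A).
  - by move=> c u v hu hv; rewrite (@epsA_linear k A) hu hv scaler0 addr0.
  - by move=> [|b w] wn; rewrite eps_word //; rewrite -wn wdeg_nil eqxx in n0'.
by rewrite (aeps_hom ha m0') mulr0 scale0r; exact: (grad0 gA _).
Qed.

End Hga.

Lemma splits_map (T U : Type) (f : T -> U) (w : seq T) :
  splits (map f w) = [seq (map f p.1, map f p.2) | p <- splits w].
Proof. by elim: w => //= a w ->; rewrite -!map_comp. Qed.

(** * Morphisms and the maps they induce on bar constructions *)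

Section Mor.
Variables (k : comNzRingType).
Implicit Types A B : adga k.

Definition ahelt A B (f : adga_mor A B) (h : helt (@ahom k A)) : helt (@ahom k B) :=
  Helt (amor_hom f (hvalP h)).

Definition fhelt A B (f : adga_mor A B) (h : helt (@bhom k A)) : helt (@bhom k B) :=
  Helt (bhom_red (amor_hom f (hvalP h))).

Definition fbar A B (f : adga_mor A B) (a : abar A) : abar B := red (f (aval a)).

Lemma aval_fbar A B (f : adga_mor A B) (a : abar A) : aval (fbar f a) = f (aval a).
Proof. by apply: aval_red; rewrite amor_eps aeps_aval. Qed.

Lemma aval_red_amor A B (f : adga_mor A B) (a : abar A) : aval (red (f (aval a))) = f (aval a).
Proof. exact: aval_fbar. Qed.

Lemma aval_fhelt A B (f : adga_mor A B) (h : helt (@bhom k A)) :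
  aval (hval (fhelt f h)) = f (aval (hval h)).
Proof. exact: aval_fbar. Qed.

Lemma fbar_linear A B (f : adga_mor A B) : linear (fbar f).
Proof. by rewrite /fbar; lin. Qed.

Lemma red_amor A B (f : adga_mor A B) (a : A) : fbar f (red a) = red (f a).
Proof.
apply/val_inj; change (aval (fbar f (red a)) = aval (red (f a))).
by rewrite aval_fbar /= amor_eps raddfB /= linearZ /= rmorph1.
Qed.

Lemma wdeg_fhelt A B (f : adga_mor A B) (w : seq (helt (@bhom k A))) :
  wdeg (map (fhelt f) w) = wdeg w.
Proof. by rewrite /wdeg big_map. Qed.

Lemma hvals_fhelt A B (f : adga_mor A B) (w : seq (helt (@bhom k A))) :
  hvals (map (fhelt f) w) = map (fbar f) (hvals w).
Proof. by rewrite /hvals -!map_comp. Qed.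

Definition comp_mor A B C (g : adga_mor B C) (f : adga_mor A B) : adga_mor A C.
Proof.
refine (@AdgaMor k A C (GRing.LRMorphism.clone _ _ _ _ (g \o f) _) _ _ _) => /=.
- by move=> n a ha; do 2 apply: amor_hom.
- by move=> a; rewrite !amor_diff.
- by move=> a; rewrite !amor_eps.
Defined.
End Mor.

Section BmapMor.
Variables (k : comNzRingType) (A' A A'' B' B B'' : adga k).
Variables (f' : adga_mor A' B') (f : adga_mor A B) (f'' : adga_mor A'' B'').
Local Notation g := (bmap f' f f'').

Lemma gE (a' : A') (w : seq (abar A)) (a'' : A'') :
  g (bt a' w a'') = bt (f' a') (map (fbar f) w) (f'' a'').
Proof. by rewrite bmapE //; exact: amor_linear. Qed.

Lemma g_linear : linear g.
Proof. by apply: bmap_linear; exact: amor_linear. Qed.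

Definition gsym (s : bsym A' A A'') : bsym B' B B'' :=
  let: (a', w, a'') := s in (ahelt f' a', map (fhelt f) w, ahelt f'' a'').

Lemma g_bval s : g (bval s) = bval (gsym s).
Proof. by case: s => [[a' w] a'']; rewrite /bval gE; congr bt; exact/esym/hvals_fhelt. Qed.

Lemma gsym_bdeg s : bdeg (gsym s) = bdeg s.
Proof. by case: s => [[a' w] a'']; rewrite /bdeg /= wdeg_fhelt. Qed.

Lemma g_hom n x : bar_hom n x -> bar_hom n (g x).
Proof.
move=> hx; rewrite -[n]addr0; apply: (bar_hom_linear (e := 0) g_linear _ hx) => s.
by rewrite g_bval addr0 -gsym_bdeg; exact: bar_hom_bval.
Qed.

Lemma g_bsign x : g (bsign x) = bsign (g x).
Proof.
have gl := g_linear.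
suff E : (fun x => g (bsign x)) = (fun x => bsign (g x)) by exact: (congr1 (@^~ x) E).
apply: lin_bval_eq => [||s]; [by lin|by lin|].
by rewrite g_bval !bsignE (linZ gl) g_bval gsym_bdeg.
Qed.

Lemma g_bsg n x : g (bsg n x) = bsg n (g x).
Proof. by rewrite /bsg; case: (par n); rewrite ?g_bsign. Qed.

Lemma g_eps x : bar_eps (g x) = bar_eps x.
Proof.
have gl := g_linear.
suff E : (fun x => bar_eps (g x) : k^o) = (fun x => bar_eps x) by exact: (congr1 (@^~ x) E).
apply: lin_bval_eq => [||s]; [by lin|by lin|].
case: s => [[a' w] a'']; rewrite /bval gE !bar_epsE.
by case: w => //=; rewrite !amor_eps.
Qed.

Variables (p' : adga_mor A A') (p'' : adga_mor A A'').
Variables (q' : adga_mor B B') (q'' : adga_mor B B'').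
Hypotheses (sq' : forall a, q' (f a) = f' (p' a)) (sq'' : forall a, q'' (f a) = f'' (p'' a)).

Lemma g_diff x : g (bar_diff p' p'' x) = bar_diff q' q'' (g x).
Proof.
have gl := g_linear.
suff E : (fun x => g (bar_diff p' p'' x)) = (fun x => bar_diff q' q'' (g x)) by exact: (congr1 (@^~ x) E).
apply: lin_bval_eq => [||[[a' w] a'']]; [by lin|by lin|].
rewrite g_bval !bar_diffE /dsym /= (linB gl) !(linD gl) (linZ gl) !gE hvals_fhelt wdeg_fhelt !amor_diff.
congr (_ + _ + _ + _ + _ - _).
- rewrite /dtens splits_map big_map (lin_sum gl); apply: eq_bigr => -[u [|a r]] _; cbn [fst snd map].
    by rewrite (lin0 gl).
  rewrite (linZ gl) gE wdeg_fhelt map_cat map_cons (linN (@fbar_linear _ _ _ f)) red_amor amor_diff.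
  by rewrite aval_fhelt !hvals_fhelt.
- rewrite /dbar splits_map big_map (lin_sum gl); apply: eq_bigr => -[u [|a [|b r]]] _; cbn [fst snd map];
    rewrite ?(lin0 gl) //.
  rewrite (linZ gl) gE wdeg_fhelt map_cat map_cons red_amor rmorphM !aval_fhelt.
  by rewrite !hvals_fhelt.
- rewrite /dleft; case: w => [|a r]; cbn [map]; first by rewrite (lin0 gl).
  by rewrite (linZ gl) gE aval_fhelt rmorphM /= -sq' hvals_fhelt.
rewrite /dright splits_map big_map (lin_sum gl); apply: eq_bigr => -[u [|a [|b r]]] _; cbn [fst snd map];
  rewrite ?(lin0 gl) //.
by rewrite (linZ gl) gE aval_fhelt rmorphM /= -sq'' hvals_fhelt wdeg_fhelt.
Qed.
End BmapMor.

Section PushWord.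
Variables (k : comNzRingType) (A B : adga k) (f : adga_mor A B).
Local Notation K := (k_adga k).

Definition pW : BA A -> BA B := bmap id f id.

Lemma pWg : pW = bmap (id_mor K) f (id_mor K).
Proof. by []. Qed.

Lemma pW_linear : linear pW.
Proof. exact: (@g_linear k K A K K B K (id_mor K) f (id_mor K)). Qed.

Lemma pW_word (w : seq (abar A)) : pW (word w) = word (map (fbar f) w).
Proof. by rewrite pWg /word gE. Qed.

Lemma pW_hvals (w : seq (helt (@bhom k A))) : pW (word (hvals w)) = word (hvals (map (fhelt f) w)).
Proof. by rewrite pW_word hvals_fhelt. Qed.

Lemma pW_bsg n x : pW (bsg n x) = bsg n (pW x).
Proof. exact: (@g_bsg k K A K K B K (id_mor K) f (id_mor K)). Qed.

Lemma pW_bsign x : pW (bsign x) = bsign (pW x).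
Proof. exact: (@g_bsign k K A K K B K (id_mor K) f (id_mor K)). Qed.

Lemma pW_eps x : bar_eps (pW x) = bar_eps x.
Proof. exact: (@g_eps k K A K K B K (id_mor K) f (id_mor K)). Qed.

Lemma pW_dBA x : pW (dBA x) = dBA (pW x).
Proof. by apply: (@g_diff k K A K K B K (id_mor K) f (id_mor K)) => a /=; rewrite amor_eps. Qed.

Lemma pW_twist x : twist (pW x) = f (twist x).
Proof.
have pl := pW_linear.
suff E : (fun x => twist (pW x)) = (fun x => f (twist x)) by exact: (congr1 (@^~ x) E).
apply: BA_lin_eq => [||w]; [by lin|by lin|].
by rewrite pW_word !twistE; case: w => [|a [|b w]] /=; rewrite ?raddf0 // -[RHS]aval_fbar.
Qed.

Lemma pW_cop (N : lmodType k) (G : BA B -> BA B -> N) x : bilin G ->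
  cop G (pW x) = cop (fun x y => G (pW x) (pW y)) x.
Proof.
move=> Gb; have pl := pW_linear.
have b : bilin (fun x y => G (pW x) (pW y)) by lin.
have cl := cop_linear Gb.
suff E : (fun x => cop G (pW x)) = cop (fun x y => G (pW x) (pW y)) by exact: (congr1 (@^~ x) E).
apply: BA_lin_eq => [||w]; [by lin|exact: cop_linear|].
by rewrite pW_hvals !copE // splits_map big_map; apply: eq_bigr => p _; rewrite !pW_hvals.
Qed.
End PushWord.

Ltac lin_op1 f ::= match f with
  | (fun x => pre (@?g x) ?c) => refine (@islin_comp _ _ _ _ _ g (pre_linl c) _)
  | (fun x => pre ?c (@?g x)) => refine (@islin_comp _ _ _ _ _ g (@pre_linr _ _ _ c) _)
  | (fun x => pW ?h (@?g x)) => refine (@islin_comp _ _ _ _ _ g (@pW_linear _ _ _ h) _)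
  end.

(** The first letter and the rest of a word are recovered by cutting and applying [twist] to the
    first part. This is cofreeness of BA, in a form suited to induction on the length. *)
Lemma recon (k : comNzRingType) (A : adga k) (z : BA A) :
  z = bar_eps z *: word [::] + cop (fun x y : BA A => pre (red (twist x)) y) z.
Proof.
have b : bilin (fun x y : BA A => pre (red (twist x)) y) by lin.
pose L (z : BA A) := bar_eps z *: (word [::] : BA A) + cop (fun x y : BA A => pre (red (twist x)) y) z.
suff E : id = L by exact: (congr1 (@^~ z) E).
apply: BA_lin_eq => [||w]; first exact: islin_id.
  by rewrite /L; apply: islin_add; [lin|exact: cop_linear].
rewrite /L (copE _ b) {b L} eps_word.
pose F (u v : seq (helt (@bhom k A))) : BA A := pre (red (twist (word (hvals u)))) (word (hvals v)).
have F0 u v : size u != 1%N -> F u v = 0.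
  case: u => [|a [|b u]] // _; rewrite /F twistE /= (lin0 (@red_linear k A)) (lin0 (pre_linl _)) //.
rewrite -[\sum_(p <- _) _]/(\sum_(p <- splits w) F p.1 p.2).
case: w => [|a [|b w]]; rewrite ?scale0r ?scale1r.
- by rewrite splits_nil F0 // addr0.
- by rewrite (splits_cons F) big_seq1 F0 // add0r /F twistE redK pre_word add0r.
rewrite (splits_cons F) (splits_cons (fun u v => F (a :: u) v)) (F0 [::]) //.
rewrite big1 => [|p _]; last by rewrite F0.
by rewrite addr0 !add0r /F twistE redK pre_word.
Qed.

Section HgaMor.
Variables (k : comNzRingType) (A B : hga_data k) (f : adga_mor A B).
Hypotheses (hA : is_hga A) (hB : is_hga B) (hf : is_hga_mor f).

(** A morphism of hgas is only assumed to respect E, that is, [twist] of a product. By [recon] a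
    product of words is determined by [twist] of products of first parts and by products of the
    second parts, whence an induction on the total length. *)
Lemma pW_mu x y : pW f (hmu x y) = hmu (pW f x) (pW f y).
Proof.
have mA := hmu_bilin hA; have mB := hmu_bilin hB.
suff H (u w : seq (helt (@bhom k A))) : pW f (hmu (word (hvals u)) (word (hvals w))) =
    hmu (pW f (word (hvals u))) (pW f (word (hvals w))).
  suff E : (fun x => pW f (hmu x y)) = (fun x => hmu (pW f x) (pW f y)) by exact: (congr1 (@^~ x) E).
  apply: BA_lin_eq => [||u]; [by lin|by lin|].
  set X := word (hvals u).
  suff E : (fun y => pW f (hmu X y)) = (fun y => hmu (pW f X) (pW f y)) by exact: (congr1 (@^~ y) E).
  by apply: BA_lin_eq => [||w]; [by lin|by lin|exact: H].
have [n] := ubnP (size u + size w); elim: n u w => // n IH u w un.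
have b : bilin (fun x y : BA B => pre (red (twist x)) y) by lin.
have b' : bilin (fun x y : BA A => pre (red (twist (pW f x))) (pW f y)) by lin.
rewrite [LHS]recon [RHS]recon (pW_cop _ _ b) (cop_mu hA _ _ b') !pW_hvals (cop_mu hB _ _ b).
rewrite !pW_eps !(hmu_bar_eps hA, hmu_bar_eps hB) -!pW_hvals !pW_eps; congr (_ + _).
rewrite !splits_map !big_map.
pose F (u1 u2 : seq (helt (@bhom k A))) := \sum_(q <- splits w) sg (wdeg u2 * wdeg q.1) *:
  (pre (red (twist (pW f (hmu (word (hvals u1)) (word (hvals q.1))))))
       (pW f (hmu (word (hvals u2)) (word (hvals q.2))))).
pose G (u1 u2 : seq (helt (@bhom k A))) := \sum_(q <- splits w) sg (wdeg u2 * wdeg q.1) *: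
  (pre (red (twist (hmu (pW f (word (hvals u1))) (pW f (word (hvals q.1))))))
       (hmu (pW f (word (hvals u2))) (pW f (word (hvals q.2))))).
transitivity (\sum_(p <- splits u) G p.1 p.2); last first.
  apply: eq_bigr => p _; rewrite big_map; apply: eq_bigr => q _ /=.
  by rewrite !wdeg_fhelt !pW_hvals.
apply: (eq_splits_cat (F := F) (G := G)) => u1 u2 uE; rewrite /F /G.
pose F' (w1 w2 : seq (helt (@bhom k A))) := sg (wdeg u2 * wdeg w1) *:
  (pre (red (twist (pW f (hmu (word (hvals u1)) (word (hvals w1))))))
       (pW f (hmu (word (hvals u2)) (word (hvals w2))))).
pose G' (w1 w2 : seq (helt (@bhom k A))) := sg (wdeg u2 * wdeg w1) *:
  (pre (red (twist (hmu (pW f (word (hvals u1))) (pW f (word (hvals w1))))))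
       (hmu (pW f (word (hvals u2))) (pW f (word (hvals w2))))).
apply: (eq_splits_cat (F := F') (G := G')) => w1 w2 wE; rewrite /F' /G'.
have -> : twist (pW f (hmu (word (hvals u1)) (word (hvals w1)))) =
    twist (hmu (pW f (word (hvals u1))) (pW f (word (hvals w1)))).
  by rewrite pW_twist; exact: hf.
(* If both first parts are empty, their product is the unit, which [twist] kills; otherwise the
   second parts are shorter and the induction hypothesis applies. *)
have [|n0] := ltnP 0 (size u1 + size w1).
  move=> n0; congr (_ *: pre _ _); apply: IH; rewrite ltnS in un.
  by apply: leq_trans un; rewrite -uE -wE !size_cat; lia.
have -> : u1 = [::] by apply/size0nil; lia.
have -> : w1 = [::] by apply/size0nil; lia.
rewrite pW_word /= (hmu_word1l hB) twistE (lin0 (@red_linear k B)).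
by rewrite !(lin0 (pre_linl _)).
Qed.

Lemma pW_act (a : A) y : f (act a y) = act (f a) (pW f y).
Proof.
rewrite /act raddfD /= hf linearZ /= rmorph1 pW_eps amor_eps; congr (hE _ _ + _).
by rewrite -/(pW f _) pW_word /= -red_amor.
Qed.
End HgaMor.

(** * The product on B(k, A, A'') *)

Lemma ract_hom (k : comNzRingType) (A' A A'' : adga k) m n (x : bmod A' A (k_adga k)) (a : A'') :
  bar_hom m x -> ahom n a -> bar_hom (m + n) (ract x a : bmod A' A A'').
Proof.
move=> hx ha; apply: (bar_hom_linear (ract_linl a) _ hx) => -[[a' w] c].
rewrite /bval /bdeg /= bt1r (linZ (ract_linl a)) ractE.
have [->|c0] := khom_unit c; first by rewrite scale0r; exact: bar_hom0.
by rewrite c0 addr0; apply: bar_homZ; apply: bar_hom_bt => //; exact: hvalP.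
Qed.

Section RightProduct.
Variables (k : comNzRingType) (A A'' : hga_data k) (phi : adga_mor A A'').
Hypotheses (hA : is_hga A) (hA'' : is_hga A'') (hphi : is_hga_mor phi).
Local Notation K := (k_adga k).
Local Notation R := (bmod K A A'').
Local Notation W w := (word (hvals (w : seq (helt (@bhom k A))))).
Local Notation wA := (helt (@bhom k A)).

Fact wact_key : unit. Proof. exact: tt. Qed.

(* Locked, since unification would otherwise unfold it down to [hlift]. *)
Definition wact (a : A'') (y : BA A) : A'' := locked_with wact_key (act a (pW phi y)).

Lemma wactE a y : wact a y = act a (pW phi y).
Proof. by rewrite /wact unlock. Qed.

Let mb : bilin (@hmu k A) := hmu_bilin hA.

Lemma wact_bilin : bilin wact.
Proof.
have b := act_bilin hA''; split=> [y|a] c u v; rewrite !wactE; first by rewrite (b.1 _ c u v).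
by rewrite (@pW_linear _ _ _ phi c u v) (b.2 _ c).
Qed.
Let acb := wact_bilin.

Definition rsym (u : seq wA) (a'' : helt (@ahom k A'')) (w : seq wA) (b : A'') : R :=
  \sum_(p <- splits w) sg (hdeg a'' * wdeg p.1) *:
    ract (hmu (W u) (W p.1)) (wact (hval a'') (W p.2) * b).

(** The two summands of the product merge, because [act] contains a counit term. That term survives
    only at the split with empty second part, and its sign is trivial there since the augmentation
    of a'' vanishes unless a'' has degree 0. *)
Lemma rprod_symE (c : helt (@ahom k K)) u a'' (e : helt (@ahom k K)) w (b : helt (@ahom k A'')) :
    ((hval c : k) * (hval e : k)) *:
    (\sum_(i < (size w).+1) sg (hdeg a'' * wdeg (take i w)) *:
       ract (hmu (word (hvals u)) (word (hvals (take i w))))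
            (hE (word [:: red (hval a'')])
                (bmap id phi id (word (hvals (drop i w)))) * hval b)
     + ract (hmu (word (hvals u)) (word (hvals w)))
            ((aeps A'' (hval a'') : k) *: hval b)) =
  ((hval c : k) * (hval e : k)) *: rsym u a'' w (hval b).
Proof.
congr (_ *: _); rewrite /rsym.
rewrite -(sum_splits (fun w1 w2 => sg (hdeg a'' * wdeg w1) *:
    ract (hmu (W u) (W w1)) (wact (hval a'') (W w2) * hval b))).
have E (i : 'I_(size w).+1) : sg (hdeg a'' * wdeg (take i w)) *:
    ract (hmu (W u) (W (take i w))) (wact (hval a'') (W (drop i w)) * hval b) =
  sg (hdeg a'' * wdeg (take i w)) *: ract (hmu (W u) (W (take i w)))
            (hE (word [:: red (hval a'')]) (bmap id phi id (W (drop i w))) * hval b) +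
  sg (hdeg a'' * wdeg (take i w)) *: ract (hmu (W u) (W (take i w)))
       ((((hvals (drop i w) == [::])%:R : k) * (aeps A'' (hval a'') : k)) *: hval b) :> R.
  rewrite -scalerDr -(linD (ract_linr _)) -[in RHS](mul1r (hval b)) mulrA mulr1 scalerAl -mulrDl.
  by rewrite wactE /act pW_eps eps_word.
rewrite (eq_bigr _ (fun i _ => E i)) big_split /=; congr (_ + _).
rewrite big_ord_recr big1 /= => [|i _]; last first.
  rewrite /hvals -size_eq0 size_map size_drop subn_eq0 leqNgt ltn_ord mul0r scale0r.
  by rewrite (lin0 (ract_linr _)) scaler0.
rewrite add0r drop_size take_size eqxx mul1r.
have [->|n0] := eqVneq (hdeg a'') 0; first by rewrite mul0r sg0 scale1r.
by rewrite (aeps_hom (hvalP a'') n0) scale0r (lin0 (ract_linr _)) scaler0.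
Qed.

Definition rprod_sym (s t : bsym K A A'') : R :=
  let: (c, u, a'') := s in let: (e, w, b) := t in
  ((hval c : k) * (hval e : k)) *: rsym u a'' w (hval b).

Lemma rprodE0 x y : rprod phi x y = hlift (fun s => hlift (rprod_sym s) y) x.
Proof.
rewrite /rprod; congr (hlift _ x); apply: funext => -[[c u] a''].
by congr (hlift _ y); apply: funext => -[[e w] b]; rewrite rprod_symE.
Qed.

Lemma rprod_sym_slinr s : slin (rprod_sym s).
Proof.
case: s => [[c u] a''].
have -> : rprod_sym (c, u, a'') = (fun t : bsym K A A'' => (hval c : k) *:
    (let: (e, w, b) := t in (hval e : k) *: rsym u a'' w (hval b))).
  by apply: funext => -[[e w] b]; rewrite /rprod_sym scalerA.
apply: (slin_comp (L := fun x : R => (hval c : k) *: x)); first exact: islin_scale.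
apply: (slin_R (F := fun w b => rsym u a'' w (hval b))) => [b|w]; rewrite /rsym.
  apply: (wlin_splits (G := fun w1 w2 => sg (hdeg a'' * wdeg w1) *:
    ract (hmu (W u) (W w1)) (wact (hval a'') (W w2) * hval b))) => v.
    apply: (wlin_deg (fun n => sg (hdeg a'' * n))).
    by apply: (bt_wlin (L := fun x : BA A => ract (hmu _ x) _)); lin.
  apply: wlin_zmod; apply: (bt_wlin (L := fun x : BA A => ract _ (wact _ x * _))); lin.
apply: (elin_hval (L := fun b => \sum_(p <- splits w) sg (hdeg a'' * wdeg p.1) *:
    ract (hmu (W u) (W p.1)) (wact (hval a'') (W p.2) * b))).
by lin.
Qed.

Lemma rprod_sym_slinl t : slin (rprod_sym^~ t).
Proof.
case: t => [[e w] b].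
have -> : rprod_sym^~ (e, w, b) = (fun s : bsym K A A'' => (hval e : k) *:
    (let: (c, u, a'') := s in (hval c : k) *: rsym u a'' w (hval b))).
  by apply: funext => -[[c u] a'']; rewrite /rprod_sym scalerA mulrC.
apply: (slin_comp (L := fun x : R => (hval e : k) *: x)); first exact: islin_scale.
apply: (slin_R (F := fun u a'' => rsym u a'' w (hval b))) => [a''|u]; rewrite /rsym.
  apply: (bt_wlin (L := fun x : BA A => \sum_(p <- splits w) sg (hdeg a'' * wdeg p.1) *:
    ract (hmu x (W p.1)) (wact (hval a'') (W p.2) * hval b))).
  by lin.
apply: elin_sum => p; apply: (elin_scale (fun n => sg (n * wdeg p.1))).
by apply: (elin_hval (L := fun a => ract _ (wact a _ * _))); lin.
Qed.

Lemma rprod_linr x : linear (rprod phi x).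
Proof.
move=> c y z; rewrite !rprodE0 /hlift scaler_sumr -big_split /=; apply: eq_bigr => p _.
rewrite -[\sum_(_ <- dec (_ + _)) _]/(hlift (rprod_sym p.2) (c *: y + z)).
by rewrite (hlift_linear (rprod_sym_slinr _)) scalerDr !scalerA mulrC.
Qed.

Lemma rprod_slinl y : slin (fun s => hlift (rprod_sym s) y).
Proof.
apply: slin_sum => p; apply: (slin_comp (L := fun x : R => p.1 *: x)).
  exact: islin_scale.
exact: rprod_sym_slinl.
Qed.

Lemma rprod_linl y : linear (fun x => rprod phi x y).
Proof. by move=> c x z; rewrite !rprodE0 (hlift_linear (rprod_slinl y)). Qed.

Lemma rprod_bilin : bilin (rprod phi).
Proof. by split; [exact: rprod_linl|exact: rprod_linr]. Qed.
Let rb := rprod_bilin.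

Lemma rprod_bt (u w : seq wA) (a b : helt (@ahom k A'')) :
  rprod phi (bt (1 : K) (hvals u) (hval a)) (bt (1 : K) (hvals w) (hval b)) = rsym u a w (hval b).
Proof.
rewrite rprodE0 (hliftE (rprod_slinl _) (kone k, u, a)).
by rewrite (hliftE (rprod_sym_slinr _) (kone k, w, b)) /rprod_sym /= mul1r scale1r.
Qed.

(** The smash product formula: [y1] is multiplied in BA, [y2] acts on [a], and [bsg n] is the sign
    of [a] moved past [y1]. *)
Lemma rprodE n x y (a b : A'') : ahom n a ->
  rprod phi (ract x a) (ract y b) =
  cop (fun y1 y2 => ract (hmu x (bsg n y1)) (wact a y2 * b)) y.
Proof.
move=> ha.
have Gb x' b' : bilin (fun y1 y2 => ract (hmu x' (bsg n y1)) (wact a y2 * b') : R) by lin.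
pose L y := rprod phi (ract x a) (ract y b).
suff E : L = cop (fun y1 y2 => ract (hmu x (bsg n y1)) (wact a y2 * b)) by exact: (congr1 (@^~ y) E).
apply: BA_lin_eq => [||w]; [by rewrite /L; lin|exact: cop_linear|].
rewrite copE // /L {L}.
pose L x : R := \sum_(p <- splits w) ract (hmu x (bsg n (W p.1))) (wact a (W p.2) * b).
suff E : (fun x => rprod phi (ract x a) (ract (W w) b)) = L by exact: (congr1 (@^~ x) E).
apply: BA_lin_eq => [||u]; [by lin|by rewrite /L; lin|].
rewrite /L {L}.
pose L b : R := \sum_(p <- splits w) ract (hmu (W u) (bsg n (W p.1))) (wact a (W p.2) * b).
suff E : (fun b => rprod phi (ract (W u) a) (ract (W w) b)) = L by exact: (congr1 (@^~ b) E).
apply: A_lin_eq => [||b']; [by lin|by rewrite /L; lin|].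
rewrite /word !ractE; have := rprod_bt u w (Helt ha) b'; rewrite /= => ->.
rewrite /L /rsym /=; apply: eq_bigr => p _.
by rewrite bsg_word (linZ (mb.2 _)) (linZ (ract_linl _)).
Qed.

Lemma rprod_words n (u w : seq wA) (a b : A'') : ahom n a ->
  rprod phi (ract (W u) a) (ract (W w) b) =
  \sum_(p <- splits w) sg (n * wdeg p.1) *: ract (hmu (W u) (W p.1)) (wact a (W p.2) * b).
Proof.
move=> ha; rewrite (rprodE _ _ _ ha) copE; last by lin.
by apply: eq_bigr => p _; rewrite bsg_word (linZ (mb.2 _)) (linZ (ract_linl _)).
Qed.

Lemma wact_wact a y z : wact (wact a y) z = wact a (hmu y z).
Proof. by rewrite !wactE (act_act hA'') -(pW_mu hA hA'' hphi). Qed.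

Lemma wact_mul n a b z : ahom n b -> wact (a * b) z = cop (fun z1 z2 => wact a (bsg n z1) * wact b z2) z.
Proof.
move=> hb; have b' := act_bilin hA''; rewrite wactE (act_mul hA'' _ _ hb) pW_cop; last by lin.
by apply: cop_ext => y1 y2; rewrite !wactE pW_bsg.
Qed.

Lemma wact_mul_word n a b (w : seq wA) : ahom n b -> wact (a * b) (W w) =
  \sum_(p <- splits w) sg (n * wdeg p.1) *: (wact a (W p.1) * wact b (W p.2)).
Proof.
move=> hb; rewrite (wact_mul _ _ hb) copE; last by lin.
by apply: eq_bigr => p _; rewrite bsg_word (linZ (acb.2 _)) -scalerAl.
Qed.

Lemma wact1 y : wact 1 y = bar_eps y *: 1.
Proof. by rewrite wactE (act1 hA'') pW_eps. Qed.

Lemma wact_word1 a : wact a (word [::]) = a.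
Proof. by rewrite wactE pW_word; exact: act_word1. Qed.

Lemma wact_hom m n a y : ahom m a -> bar_hom n y -> ahom (m + n) (wact a y).
Proof. by move=> ha hy; rewrite wactE; apply: (act_hom hA'' ha); exact: (@g_hom k K A K K A'' K (id_mor K) phi (id_mor K)). Qed.

Lemma ractE_word (w : seq wA) (a : A'') : bt (1 : K) (hvals w) a = ract (W w) a :> R.
Proof. by rewrite /word ractE. Qed.

Lemma R_lin_eq2 (N : lmodType k) (F G : R -> R -> N) : bilin F -> bilin G ->
  (forall (u w : seq wA) (a b : helt (@ahom k A'')),
     F (ract (W u) (hval a)) (ract (W w) (hval b)) = G (ract (W u) (hval a)) (ract (W w) (hval b))) ->
  forall x y, F x y = G x y.
Proof.
move=> Fb Gb FG x y.
suff E : F^~ y = G^~ y by exact: (congr1 (@^~ x) E).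
apply: R_lin_eq => [||u a]; [exact: Fb.1|exact: Gb.1|].
suff E : F (bt (1 : K) (hvals u) (hval a)) = G (bt (1 : K) (hvals u) (hval a)).
  exact: (congr1 (@^~ y) E).
apply: R_lin_eq => [||w b]; [exact: Fb.2|exact: Gb.2|].
by rewrite !ractE_word.
Qed.

(** On the left the product of v with a piece of w is cut by [cop_mu], and [wact_wact] separates the
    action of a product; on the right [wact_mul_word] distributes the action over a product in A''.
    Either way v is cut once and w into three pieces. *)
Lemma rprodA x y z : rprod phi x (rprod phi y z) = rprod phi (rprod phi x y) z.
Proof.
suff E : (fun z => rprod phi x (rprod phi y z)) = rprod phi (rprod phi x y).
  exact: (congr1 (@^~ z) E).
apply: R_lin_eq => [||w c]; [by lin|by lin|].
rewrite ractE_word.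
apply: (R_lin_eq2 (F := fun x y => rprod phi x (rprod phi y _))
                  (G := fun x y => rprod phi (rprod phi x y) _)) => [||u v a b]; [by lin|by lin|].
move: {x y z} (hval a) (hdeg a) (hvalP a) (hval b) (hdeg b) (hvalP b) (hval c) => {a b c}.
move=> a n ha b m hb c.
rewrite (rprod_words v w c hb) (lin_sum (rb.2 _)) (rprod_words u v b ha) (lin_sum (rb.1 _)).
(* The common summand: [p] is the cut of v, while the pieces of w are multiplied in BA, act on [a],
   and act on [b], respectively. *)
pose F p w11 w12 w2 : R := sg (m * (wdeg w11 + wdeg w12) + wdeg p.2 * wdeg w11 + n * (wdeg p.1 + wdeg w11)) *:
  ract (hmu (hmu (W u) (W p.1)) (W w11)) (wact (wact a (W p.2)) (W w12) * wact b (W w2) * c).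
transitivity (\sum_(q <- splits w) \sum_(q' <- splits q.1) \sum_(p <- splits v) F p q'.1 q'.2 q.2).
  apply: (eq_splits (F := fun w1 w2 => rprod phi (ract (W u) a) (sg (m * wdeg w1) *:
     ract (hmu (W v) (W w1)) (wact b (W w2) * c)))
    (G := fun w1 w2 => \sum_(q' <- splits w1) \sum_(p <- splits v) F p q'.1 q'.2 w2)) => w1 w2 _.
  rewrite (linZ (rb.2 _)) (rprodE _ _ _ ha) (cop_mu hA); last by lin.
  rewrite scaler_sumr exchange_big /=; apply: eq_bigr => p _; rewrite scaler_sumr.
  apply: (eq_splits (F := fun x y => sg (m * wdeg w1) *: (sg (wdeg p.2 * wdeg x) *:
     ract (hmu (W u) (bsg n (hmu (W p.1) (W x)))) (wact a (hmu (W p.2) (W y)) * (wact b (W w2) * c))))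
    (G := fun x y => F p x y w2)) => x y <-.
  rewrite (hmu_bsg hA) !bsg_word !(linZ (mb.2 _), linZ (mb.1 _)) !(linZ (ract_linl _)) !scalerA -!sgD.
  rewrite /F wact_wact (hmuA hA) mulrA; congr (_ *: _); apply: par_eq; par_solve.
rewrite (splitsA (fun x y z => \sum_(p <- splits v) F p x y z)) /=.
under eq_bigr => q _ do rewrite exchange_big /=.
rewrite exchange_big /=.
apply: (eq_splits (F := fun v1 v2 => \sum_(q <- splits w) \sum_(r <- splits q.2) F (v1, v2) q.1 r.1 r.2)
    (G := fun v1 v2 => rprod phi (sg (n * wdeg v1) *: ract (hmu (W u) (W v1)) (wact a (W v2) * b))
       (ract (W w) c))) => v1 v2 _.
have hab : ahom (n + wdeg v2 + m) (wact a (W v2) * b).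
  by apply: ahomM hb; exact: wact_hom ha (bar_hom_word _).
rewrite (linZ (rb.1 _)) (rprodE _ _ _ hab) copE; last by lin.
rewrite scaler_sumr; apply: eq_bigr => q _.
rewrite (wact_mul_word _ _ hb) mulr_suml (lin_sum (ract_linr _)) scaler_sumr.
apply: eq_bigr => r _; rewrite bsg_word (linZ (mb.2 _)) (linZ (ract_linl _)) -scalerAl.
rewrite (linZ (ract_linr _)) !scalerA -!sgD /F; congr (_ *: _); apply: par_eq; par_solve.
Qed.

Lemma rprod_rc x (a c : A'') : rprod phi (ract x a) (bt (1 : K) [::] c) = ract x (a * c).
Proof.
suff E : (fun a => rprod phi (ract x a) (bt (1 : K) [::] c)) = (fun a => ract x (a * c)).
  exact: (congr1 (@^~ a) E).
apply: A_lin_eq => [||a']; [by lin|by lin|].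
rewrite (ractE_word [::]) (rprodE _ _ _ (hvalP a')) (@copE _ _ _ _ [::]); last by lin.
by rewrite big_seq1 bsg_word wdeg_nil mulr0 sg0 scale1r hmu_word1r // wact_word1.
Qed.

Lemma rprod1r x : rprod phi x (bt (1 : K) [::] 1) = x.
Proof.
suff E : (fun x => rprod phi x (bt (1 : K) [::] 1)) = id by exact: (congr1 (@^~ x) E).
apply: R_lin_eq => [||w a]; [by lin|exact: islin_id|].
by rewrite ractE_word rprod_rc mulr1.
Qed.

Lemma rprod1l x : rprod phi (bt (1 : K) [::] 1) x = x.
Proof.
suff E : (fun x => rprod phi (bt (1 : K) [::] 1) x) = id by exact: (congr1 (@^~ x) E).
apply: R_lin_eq => [||w a]; [by lin|exact: islin_id|].
rewrite (ractE_word [::]) ractE_word (rprodE _ _ _ (ahom1 A'')).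
rewrite -[RHS](cop_counitr (W w) (ract_linl (hval a))).
apply: cop_ext => y z; rewrite hmu_word1l // wact1 -scalerAl mul1r (linZ (ract_linr _)).
by rewrite /bsg par0.
Qed.

Lemma rprod_hom m n x y : bar_hom m x -> bar_hom n y -> bar_hom (m + n) (rprod phi x y).
Proof.
move=> hx hy.
suff H s t : bar_hom (bdeg s + bdeg t) (rprod phi (bval s) (bval t)).
  apply: (bar_hom_linear (L := fun x => rprod phi x y) (rb.1 y) _ hx) => s; rewrite addrC.
  by apply: (bar_hom_linear (rb.2 (bval s)) _ hy) => t; rewrite addrC.
case: s t => [[c u] a] [[e w] b]; rewrite /bval /bdeg /= (bt1 (hval c)) (bt1 (hval e)).
rewrite (linZ (rb.1 _)) (linZ (rb.2 _)) rprod_bt.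
have [->|->] := khom_unit c; first by rewrite scale0r; exact: bar_hom0.
have [->|->] := khom_unit e; first by rewrite scale0r scaler0; exact: bar_hom0.
apply: bar_homZ; apply: bar_homZ; rewrite /rsym.
pose F w1 w2 : R := sg (hdeg a * wdeg w1) *: ract (hmu (W u) (W w1)) (wact (hval a) (W w2) * hval b).
have := splits_wdeg w; rewrite -[\sum_(p <- _) _]/(\sum_(p <- splits w) F p.1 p.2).
elim: (splits w) => [|p l IH] /=; first by rewrite big_nil => _; exact: bar_hom0.
move=> /andP[/eqP pw] /IH hl; rewrite big_cons; apply: bar_homD => //; apply: bar_homZ.
have -> : 0 + wdeg u + hdeg a + (0 + wdeg w + hdeg b) =
    (wdeg u + wdeg p.1) + (hdeg a + wdeg p.2 + hdeg b) by rewrite -pw; lia.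
apply: ract_hom; first exact: (hmu_hom hA (bar_hom_word _) (bar_hom_word _)).
apply: ahomM (hvalP b); exact: wact_hom (hvalP a) (bar_hom_word _).
Qed.

Local Notation dR := (bar_diff (aug_mor A) phi).

(** R is the twisted tensor product of BA and A'' along [phi] after [twist]: the cuts whose second
    part has length one detach the last letter. *)
Lemma dR_ract x a : dR (ract x a) = ract (dBA x) a + ract (bsign x) (adiff A'' a)
  - cop (fun x1 x2 => ract (bsign x1) (phi (twist x2) * a)) x.
Proof.
have b a' : bilin (fun x1 x2 => ract (bsign x1) (phi (twist x2) * a') : R) by lin.
pose L x : R := ract (dBA x) a + ract (bsign x) (adiff A'' a)
  - cop (fun x1 x2 => ract (bsign x1) (phi (twist x2) * a)) x.
suff E : (fun x => dR (ract x a)) = L by exact: (congr1 (@^~ x) E).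
have cl := cop_linear (b a).
apply: BA_lin_eq => [||w]; [by lin|by rewrite /L; lin|].
rewrite /L {L} copE //.
pose L a : R := ract (dBA (W w)) a + ract (bsign (W w)) (adiff A'' a)
  - \sum_(p <- splits w) ract (bsign (W p.1)) (phi (twist (W p.2)) * a).
suff E : (fun a => dR (ract (W w) a)) = L by exact: (congr1 (@^~ a) E).
apply: A_lin_eq => [||a']; [by lin|by rewrite /L; lin|].
rewrite /L {L} -ractE_word bar_diff_R0 dBAE (linD (ract_linl _)) ract_dtens ract_dbar.
rewrite bsign_word (linZ (ract_linl _)) -ractE_word; congr (_ + _ - _).
apply: eq_bigr => -[u v] _ /=; rewrite bsign_word twistE (linZ (ract_linl _)).
case: v => [|c [|d v]] /=; rewrite ?raddf0 ?mul0r ?(lin0 (ract_linr _)) ?scaler0 //.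
by rewrite add0r -ractE_word.
Qed.

End RightProduct.

Lemma splits_counitr (k : comNzRingType) (A : adga k) (N : lmodType k)
    (F : seq (helt (@bhom k A)) -> seq (helt (@bhom k A)) -> N) w :
  \sum_(p <- splits w) bar_eps (word (hvals p.2)) *: F p.1 p.2 = F w [::].
Proof.
rewrite -(sum_splits (fun u v => bar_eps (word (hvals v)) *: F u v)) big_ord_recr /= big1 => [|i _].
  by rewrite add0r take_size drop_size eps_word scale1r.
by rewrite eps_word /hvals -size_eq0 size_map size_drop subn_eq0 leqNgt ltn_ord scale0r.
Qed.

Lemma bar_hom_splits (k : comNzRingType) (A' A A'' : adga k) (T : Type) n
    (F : seq T -> seq T -> bmod A' A A'') w :
  (forall u v, u ++ v = w -> bar_hom n (F u v)) -> bar_hom n (\sum_(p <- splits w) F p.1 p.2).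
Proof.
elim: w F => [|a w IH] F hF; first by rewrite splits_nil; exact: hF.
rewrite splits_cons; apply: bar_homD; first exact: hF.
by apply: (IH (fun u v => F (a :: u) v)) => u v uv; apply: hF; rewrite /= uv.
Qed.

Lemma bar_diff_hom (k : comNzRingType) (A' A A'' : adga k)
    (p' : adga_mor A A') (p'' : adga_mor A A'') n (x : bmod A' A A'') :
  bar_hom n x -> bar_hom (n + 1) (bar_diff p' p'' x).
Proof.
move=> hx; apply: (bar_hom_linear (@bar_diff_linear _ _ _ _ p' p'') _ hx) => -[[a' w] a''].
rewrite bar_diffE /dsym /bdeg /=.
set d := _ + 1.
have deg l m (u r : seq (helt (@bhom k A))) (b' : A') (b'' : A'') : ahom l b' -> ahom m b'' -> l + (wdeg u + wdeg r) + m = d ->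
    bar_hom d (bt b' (hvals u ++ hvals r) b'').
  by move=> h' h'' <-; rewrite -wdeg_cat /hvals -map_cat; exact: bar_hom_bt.
apply: bar_homD; last apply: bar_homN; do ?apply: bar_homD.
- apply: (deg _ _ [::] w _ _ (ahom_diff (hvalP a')) (hvalP a'')).
  by rewrite wdeg_nil /d; lia.
- apply: (bar_hom_splits (F := fun u z => if z is a :: r then sg (hdeg a' + wdeg u) *:
     bt (hval a') (hvals u ++ - red (adiff A (aval (hval a))) :: hvals r) (hval a'') else 0)).
  move=> u [|a r] uw; first exact: bar_hom0.
  rewrite (linN (bt_linm _ _ _ _)); apply/bar_homZ/bar_homN.
  apply: (deg _ _ u (dhelt a :: r) _ _ (hvalP a') (hvalP a'')).
  by rewrite /d -uw wdeg_cat !wdeg_cons /=; lia.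
- apply: (bar_hom_splits (F := fun u z => if z is a :: b :: r then sg (hdeg a' + (wdeg u + (hdeg a - 1))) *:
     bt (hval a') (hvals u ++ red (aval (hval a) * aval (hval b)) :: hvals r) (hval a'') else 0)).
  move=> u [|a [|b r]] uw; [exact: bar_hom0|exact: bar_hom0|].
  apply/bar_homZ; apply: (deg _ _ u (mhelt a b :: r) _ _ (hvalP a') (hvalP a'')).
  by rewrite /d -uw wdeg_cat !wdeg_cons /=; lia.
- apply: bar_homZ; apply: (deg _ _ [::] w _ _ (hvalP a') (ahom_diff (hvalP a''))).
  by rewrite wdeg_nil /d; lia.
- rewrite /dleft; case wE: w => [|a r]; first exact: bar_hom0.
  apply: bar_homZ; apply: (deg _ _ [::] r _ _ (ahomM (hvalP a') (amor_hom p' (hvalP a))) (hvalP a'')).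
  by rewrite wdeg_nil /d wE !wdeg_cons; lia.
apply: (bar_hom_splits (F := fun u z => if z is [:: a] then sg (hdeg a' + wdeg u) *:
     bt (hval a') (hvals u) (p'' (aval (hval a)) * hval a'') else 0)).
move=> u [|a [|b r]] uw; [exact: bar_hom0| |exact: bar_hom0].
apply: bar_homZ; rewrite -[hvals u]cats0.
apply: (deg _ _ u [::] _ _ (hvalP a') (ahomM (amor_hom p'' (hvalP a)) (hvalP a''))).
by rewrite wdeg_nil /d -uw wdeg_cat wdeg_cons wdeg_nil; lia.
Qed.

(** * The Leibniz rule for the product on B(k, A, A'') *)

Section Leibniz.
Variables (k : comNzRingType) (A A'' : hga_data k) (phi : adga_mor A A'').
Hypotheses (hA : is_hga A) (hA'' : is_hga A'') (hphi : is_hga_mor phi).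
Local Notation K := (k_adga k).
Local Notation R := (bmod K A A'').
Local Notation W w := (word (hvals (w : seq (helt (@bhom k A))))).
Local Notation wA := (helt (@bhom k A)).
Local Notation dR := (bar_diff (aug_mor A) phi).
Local Notation ac := (wact phi).
Local Notation t' x := (phi (twist x)).
Let mb : bilin (@hmu k A) := hmu_bilin hA.
Let acb : bilin ac := wact_bilin phi hA''.
Let rb : bilin (rprod phi) := rprod_bilin phi hA hA''.

Lemma ac_diff_word n a (w : seq wA) : ahom n a ->
  adiff A'' (ac a (W w)) = ac (adiff A'' a) (W w) + sg n *: ac a (dBA (W w))
    + \sum_(p <- splits w) (sg (n + 1 + wdeg p.1) *: (ac a (W p.1) * t' (W p.2))
                            + sg (n * wdeg p.1) *: (t' (W p.1) * ac a (W p.2))).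
Proof.
move=> ha; have b := act_bilin hA''; rewrite !wactE (act_diff hA'' _ ha) -pW_dBA; congr (_ + _).
rewrite pW_cop; last by lin.
rewrite copE; last by lin.
apply: eq_bigr => p _; rewrite !wactE -pW_bsg -pW_bsign !pW_twist bsg_word bsign_word.
rewrite !(linZ (@twist_linear _ _)) (linZ (@pW_linear _ _ _ phi)) (linZ (b.2 _)).
by rewrite -scalerAl scalerA -sgD linearZ /= -scalerAl.
Qed.

Lemma phi_hE x z : phi (hE x z) = ac (t' x) z + bar_eps x *: t' z.
Proof.
rewrite hphi -/(pW phi _) -/(pW phi _) wactE -pW_twist (act_twist hA'') pW_eps pW_twist.
by rewrite subrK.
Qed.

Section Words.
Variables (u w : seq wA) (a b : A'') (n : int) (ha : ahom n a).
Local Notation U := (W u).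

(** The sums occurring in the Leibniz rule. [S1], [S2] and [S4] differentiate words, [S3] and [S5]
    the coefficients [a] and [b]; [S8] is the twisting term of the first factor and [S6] that of the
    second. [S7] appears twice on the left, with opposite signs. *)
Let S1 := \sum_(p <- splits w) sg (n * wdeg p.1) *:
  (ract (hmu (dBA U) (W p.1)) (ac a (W p.2) * b) : R).
Let S2 := \sum_(p <- splits w) sg (n * wdeg p.1 + wdeg u) *:
  (ract (hmu U (dBA (W p.1))) (ac a (W p.2) * b) : R).
Let S3 := \sum_(p <- splits w) sg (n * wdeg p.1 + wdeg u + wdeg p.1) *:
  (ract (hmu U (W p.1)) (ac (adiff A'' a) (W p.2) * b) : R).
Let S4 := \sum_(p <- splits w) sg (n * wdeg p.1 + wdeg u + wdeg p.1 + n) *: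
  (ract (hmu U (W p.1)) (ac a (dBA (W p.2)) * b) : R).
Let S5 := \sum_(p <- splits w) sg (n * wdeg p.1 + wdeg u + wdeg w + n) *:
  (ract (hmu U (W p.1)) (ac a (W p.2) * adiff A'' b) : R).
Let S6 := \sum_(p <- splits w) \sum_(q <- splits p.2)
  sg (n * wdeg p.1 + wdeg u + wdeg p.1 + n + 1 + wdeg q.1) *:
  (ract (hmu U (W p.1)) (ac a (W q.1) * t' (W q.2) * b) : R).
Let S7 := \sum_(p <- splits w) \sum_(q <- splits p.2)
  sg (n * wdeg p.1 + wdeg u + wdeg p.1 + n * wdeg q.1) *:
  (ract (hmu U (W p.1)) (t' (W q.1) * ac a (W q.2) * b) : R).
Let S8 := \sum_(r <- splits u) \sum_(p <- splits w) \sum_(q <- splits p.2)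
  sg (n * wdeg p.1 + wdeg r.2 * wdeg p.1 + wdeg r.1 + wdeg p.1 + n * wdeg q.1) *:
  (ract (hmu (W r.1) (W p.1)) (ac (t' (W r.2)) (W q.1) * ac a (W q.2) * b) : R).

Lemma leibniz_lhs : dR (rprod phi (ract U a) (ract (W w) b)) =
  S1 + S2 + S3 + S4 + S5 + S6 + S7 - (S8 + S7).
Proof.
rewrite (rprod_words phi hA hA'' u w b ha) (lin_sum (@bar_diff_linear _ _ _ _ _ phi)).
pose E8 (w1 w2 : seq wA) : R := sg (n * wdeg w1) *: cop (fun x1 x2 => ract (bsign x1)
   (t' x2 * (ac a (W w2) * b))) (hmu U (W w1)).
pose E6 (w1 w2 : seq wA) : R := \sum_(q <- splits w2)
  sg (n * wdeg w1 + wdeg u + wdeg w1 + n + 1 + wdeg q.1) *: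
  (ract (hmu U (W w1)) (ac a (W q.1) * t' (W q.2) * b) : R).
pose E7 (w1 w2 : seq wA) : R := \sum_(q <- splits w2)
  sg (n * wdeg w1 + wdeg u + wdeg w1 + n * wdeg q.1) *:
  (ract (hmu U (W w1)) (t' (W q.1) * ac a (W q.2) * b) : R).
(* The twisting term of a product contains E, which [phi_hE] splits into an action, giving [S8], and
   a counit term, giving a second copy of [S7]. *)
have -> : S8 + S7 = \sum_(p <- splits w) E8 p.1 p.2.
  pose F8 (r : seq wA * seq wA) (x y z : seq wA) : R :=
    sg (n * wdeg x + wdeg r.2 * wdeg x + wdeg r.1 + wdeg x + n * wdeg y) *:
    ract (hmu (W r.1) (W x)) (ac (t' (W r.2)) (W y) * ac a (W z) * b).
  pose F7 (r : seq wA * seq wA) (x y z : seq wA) : R :=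
    sg (n * wdeg x + wdeg r.2 * wdeg x + wdeg r.1 + wdeg x + n * wdeg y) *:
    ract (hmu (W r.1) (W x)) (t' (W y) * ac a (W z) * b).
  have E r : \sum_(p <- splits w) \sum_(q <- splits p.2) F8 r p.1 q.1 q.2 =
    \sum_(p <- splits w) \sum_(q <- splits p.1) F8 r q.1 q.2 p.2 by rewrite (splitsA (F8 r)).
  have -> : S8 = \sum_(p <- splits w) \sum_(r <- splits u) \sum_(q <- splits p.1) F8 r q.1 q.2 p.2.
    by rewrite /S8 (eq_bigr _ (fun r _ => E r)) exchange_big.
  have -> : S7 = \sum_(p <- splits w) \sum_(r <- splits u) bar_eps (W r.2) *:
      \sum_(q <- splits p.1) F7 r q.1 q.2 p.2.
    transitivity (\sum_(p <- splits w) \sum_(q <- splits p.1) F7 (u, [::]) q.1 q.2 p.2).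
      rewrite (splitsA (F7 (u, [::]))); apply: eq_bigr => p _; apply: eq_bigr => q _.
      by rewrite /F7 /= wdeg_nil; congr (_ *: _); apply: par_eq; par_solve.
    apply: eq_bigr => p _.
    by rewrite (splits_counitr (fun r1 r2 => \sum_(q <- splits p.1) F7 (r1, r2) q.1 q.2 p.2)).
  rewrite -big_split /=; apply: eq_bigr => p _; rewrite /E8 (cop_mu hA); last by lin.
  rewrite -big_split scaler_sumr /=; apply: eq_bigr => r _.
  rewrite scaler_sumr scaler_sumr -big_split /=.
  apply: (eq_splits (F := fun x y => F8 r x y p.2 + bar_eps (W r.2) *: F7 r x y p.2)
    (G := fun x y => sg (n * wdeg p.1) *: (sg (wdeg r.2 * wdeg x) *:
      ract (bsign (hmu (W r.1) (W x))) (t' (hmu (W r.2) (W y)) * (ac a (W p.2) * b))))) => x y <-.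
  rewrite (bsign_hom (hmu_hom hA (bar_hom_word _) (bar_hom_word _))) -[twist _]/(hE _ _) phi_hE.
  rewrite /F8 /F7 mulrDl -!mulrA -!scalerAl (linZ (ract_linl _)) (linD (ract_linr _)).
  rewrite (linZ (ract_linr _)) !scalerDr !scalerA -!sgD; congr (_ *: _ + _ *: _).
    by apply: par_eq; par_solve.
  by rewrite [RHS]mulrA -sgD mulrC; congr (_ * _); apply: par_eq; par_solve.
rewrite -[S6]/(\sum_(p <- splits w) E6 p.1 p.2) -[S7]/(\sum_(p <- splits w) E7 p.1 p.2).
rewrite /S1 /S2 /S3 /S4 /S5 -!big_split /= -sumrB.
pose F w1 w2 := dR (sg (n * wdeg w1) *: ract (hmu U (W w1)) (ac a (W w2) * b)).
apply: (eq_splits (F := F) (G := fun w1 w2 => sg (n * wdeg w1) *: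
  (ract (hmu (dBA U) (W w1)) (ac a (W w2) * b) : R) + sg (n * wdeg w1 + wdeg u) *:
  (ract (hmu U (dBA (W w1))) (ac a (W w2) * b) : R) + sg (n * wdeg w1 + wdeg u + wdeg w1) *:
  (ract (hmu U (W w1)) (ac (adiff A'' a) (W w2) * b) : R) + sg (n * wdeg w1 + wdeg u + wdeg w1 + n) *:
  (ract (hmu U (W w1)) (ac a (dBA (W w2)) * b) : R) +  sg (n * wdeg w1 + wdeg u + wdeg w + n) *:
  (ract (hmu U (W w1)) (ac a (W w2) * adiff A'' b) : R) + E6 w1 w2 + E7 w1 w2 - E8 w1 w2)).
move=> w1 w2 wE; rewrite /F (linZ (@bar_diff_linear _ _ _ _ _ phi)) dR_ract scalerBr.
congr (_ - _).
have hmw := hmu_hom hA (bar_hom_word u) (bar_hom_word w1).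
have -> : dBA (hmu U (W w1)) = hmu (dBA U) (W w1) + sg (wdeg u) *: hmu U (dBA (W w1)).
  exact: (hmu_diff hA _ (bar_hom_word u)).
rewrite (bsign_hom hmw) (adiffM b (wact_hom phi hA'' ha (bar_hom_word w2))) (ac_diff_word _ ha).
rewrite (linD (ract_linl _)) !(linZ (ract_linl _)) [LHS]scalerDr scalerDr !scalerA -!sgD.
rewrite (linD (ract_linr _)) (linZ (ract_linr _)).
rewrite !mulrDl !(linD (ract_linr _)) -!scalerAl !(linZ (ract_linr _)) !scalerDr !scalerA -!sgD.
set T67 := sg _ *: ract _ ((\sum_(p <- _) _) * _).
have -> : T67 = E6 w1 w2 + E7 w1 w2.
  rewrite /T67 mulr_suml (lin_sum (ract_linr _)) scaler_sumr -big_split /=; apply: eq_bigr => q _.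
  rewrite mulrDl (linD (ract_linr _)) -!scalerAl !(linZ (ract_linr _)) scalerDr !scalerA -!sgD.
  by congr (_ *: _ + _ *: _); apply: par_eq; par_solve.
rewrite !addrA [LHS](ACl (1*2*3*4*7*5*6)).
do 2 congr (_ + _); congr (_ + _ *: _ + _ *: _ + _ *: _); apply: par_eq; rewrite -?wE; par_solve.
Qed.

(** Each term of the two differentials is expanded by the smash product formula. [S2] and [S4] arise
    together, since [coderivation] distributes the differential of the second word over the two
    parts into which it is cut. *)
Lemma leibniz_rhs : rprod phi (dR (ract U a)) (ract (W w) b) +
    sg (wdeg u + n) *: rprod phi (ract U a) (dR (ract (W w) b)) =
  S1 + S2 + S3 + S4 + S5 + S6 - S8.
Proof.
have rl (X Y Z V : R) s : rprod phi (X + s *: Y - Z) V =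
    rprod phi X V + s *: rprod phi Y V - rprod phi Z V.
  by rewrite (linB (rb.1 _)) (linD (rb.1 _)) (linZ (rb.1 _)).
have rr (X Y Z V : R) s : rprod phi V (X + s *: Y - Z) =
    rprod phi V X + s *: rprod phi V Y - rprod phi V Z.
  by rewrite (linB (rb.2 _)) (linD (rb.2 _)) (linZ (rb.2 _)).
rewrite 2!dR_ract 2!bsign_word 2!(linZ (ract_linl _)) rl rr.
have sumE (x1 x3 x8 y1 y5 y6 : R) : x1 = S1 -> x3 = S3 -> x8 = S8 ->
    y1 = sg (wdeg u + n) *: (S2 + S4) -> y5 = sg (wdeg u + n) *: S5 -> y6 = sg (wdeg u + n + 1) *: S6 ->
    x1 + x3 - x8 + sg (wdeg u + n) *: (y1 + y5 - y6) = S1 + S2 + S3 + S4 + S5 + S6 - S8.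
  move=> -> -> -> -> -> ->; rewrite -scalerDr sgN scaleNr opprK !scalerDr !sgZK !addrA.
  by rewrite [LHS](ACl (1*4*2*5*6*7*3)).
have G n' (c : A'') x : bilin (fun y1 y2 => ract (hmu x (bsg n' y1)) (ac c y2 * b) : R) by lin.
have hd (w1 : seq wA) : bar_hom (wdeg w1 + 1) (dBA (W w1)).
  exact: (bar_diff_hom _ _ (bar_hom_word w1)).
apply: sumE.
- rewrite (rprodE phi hA hA'' _ _ _ ha) copE //; apply: eq_bigr => p _.
  by rewrite bsg_word (linZ (mb.2 _)) (linZ (ract_linl _)).
- rewrite (rprod_words phi hA hA'' _ _ _ (ahom_diff ha)) scaler_sumr; apply: eq_bigr => p _.
  by rewrite scalerA -sgD; congr (_ *: _); apply: par_eq; par_solve.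
- rewrite copE; last by lin.
  rewrite (lin_sum (rb.1 _)); apply: eq_bigr => r _.
  have h : ahom (wdeg r.2 + 1 + n) (t' (W r.2) * a).
    by apply: ahomM ha; apply: amor_hom; exact: twist_hom (bar_hom_word _).
  rewrite bsign_word (linZ (ract_linl _)) (linZ (rb.1 _)) (rprod_words phi hA hA'' _ _ _ h) scaler_sumr.
  apply: eq_bigr => p _; rewrite (wact_mul_word phi hA'' _ _ ha) mulr_suml (lin_sum (ract_linr _)).
  rewrite !scaler_sumr; apply: eq_bigr => q _.
  rewrite -scalerAl (linZ (ract_linr _)) !scalerA -!sgD.
  by congr (_ *: _); apply: par_eq; par_solve.
- rewrite (rprodE phi hA hA'' _ _ _ ha) coderivation // copE; last by have b1 := G n a U; lin.
  rewrite scalerDr !scaler_sumr -big_split; apply: eq_bigr => p _ /=.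
  rewrite bsign_word (bsg_hom _ (hd p.1)) (linZ (@bsg_linear _ _ _ _ n)) bsg_word.
  rewrite !(linZ (mb.2 _)) !(linZ (ract_linl _)) !scalerA -!sgD.
  by congr (_ *: _ + _ *: _); apply: par_eq; par_solve.
- rewrite (rprod_words phi hA hA'' _ _ _ ha) !scaler_sumr; apply: eq_bigr => p _.
  by rewrite !scalerA -!sgD; congr (_ *: _); apply: par_eq; par_solve.
- rewrite copE; last by lin.
  rewrite (lin_sum (rb.2 _)).
  pose F x y z : R := sg (wdeg x + wdeg y + n * wdeg x) *:
    (ract (hmu U (W x)) (ac a (W y) * t' (W z) * b) : R).
  transitivity (\sum_(p <- splits w) \sum_(q <- splits p.1) F q.1 q.2 p.2).
    apply: eq_bigr => p _; rewrite bsign_word (linZ (ract_linl _)) (linZ (rb.2 _)).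
    rewrite (rprod_words phi hA hA'' _ _ _ ha) scaler_sumr.
    apply: (eq_splits (F := fun x y => sg (wdeg p.1) *: (sg (n * wdeg x) *:
      (ract (hmu U (W x)) (ac a (W y) * (t' (W p.2) * b)) : R))) (G := fun x y => F x y p.2)) => x y <-.
    by rewrite scalerA -sgD mulrA.
  rewrite (splitsA F) scaler_sumr; apply: eq_bigr => p _; rewrite scaler_sumr; apply: eq_bigr => q _.
  by rewrite /F scalerA -sgD; congr (_ *: _); apply: par_eq; par_solve.
Qed.

Lemma leibniz_words : dR (rprod phi (ract U a) (ract (W w) b)) =
  rprod phi (dR (ract U a)) (ract (W w) b) +
  sg (wdeg u + n) *: rprod phi (ract U a) (dR (ract (W w) b)).
Proof. by rewrite leibniz_lhs leibniz_rhs [S8 + S7]addrC opprD addrA addrK. Qed.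

End Words.

Lemma rprod_diff x y : dR (rprod phi x y) = rprod phi (dR x) y + rprod phi (bsign x) (dR y).
Proof.
apply: (R_lin_eq2 (F := fun x y => dR (rprod phi x y))
  (G := fun x y => rprod phi (dR x) y + rprod phi (bsign x) (dR y))) => [||u w a b]; [by lin|by lin|].
rewrite (leibniz_words u w (hval b) (hvalP a)).
have := @bsignE k K A A'' (kone k, u, a); rewrite /bval /bdeg /= ractE_word add0r => ->.
by rewrite (linZ (rb.1 _)).
Qed.
End Leibniz.

(** * The right action, S and f_1 *)

Section CoMul.
Variables (k : comNzRingType) (A A'' : hga_data k) (phi : adga_mor A A'').
Hypotheses (hA : is_hga A) (hA'' : is_hga A'').
Local Notation K := (k_adga k).
Local Notation R := (bmod K A A'').
Local Notation W w := (word (hvals (w : seq (helt (@bhom k A))))).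
Local Notation wA := (helt (@bhom k A)).
Local Notation ac := (wact phi).
Let mb : bilin (@hmu k A) := hmu_bilin hA.
Let rb : bilin (rprod phi) := rprod_bilin phi hA hA''.

(** The smash product formula cuts [y] into a part multiplied with [u] and a part acting on [a].
    Only the product in BA is cut again, by [cop_mu]; coassociativity then lets the remaining pieces
    form a product in R. *)
Lemma coR_mul (N : lmodType k) (G : BA A -> R -> N) (u : seq wA) (a : helt (@ahom k A'')) y : bilin G ->
  coR G (rprod phi (ract (W u) (hval a)) y) =
  \sum_(r <- splits u) coR (fun y1 r2 => G (hmu (W r.1) (bsg (wdeg r.2 + hdeg a) y1))
                              (rprod phi (ract (W r.2) (hval a)) r2)) y.
Proof.
move=> Gb; set n := hdeg a; have ha : ahom n (hval a) := hvalP a; move: (hval a) n ha => {}a n ha.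
have Gb' n' x r : bilin (fun y1 r2 => G (hmu x (bsg n' y1)) (rprod phi r r2)) by lin.
have cl := coR_linear Gb.
pose L y := \sum_(r <- splits u) coR (fun y1 r2 => G (hmu (W r.1) (bsg (wdeg r.2 + n) y1))
                              (rprod phi (ract (W r.2) a) r2)) y.
suff E : (fun y => coR G (rprod phi (ract (W u) a) y)) = L by exact: (congr1 (@^~ y) E).
apply: R_lin_eq => [||w b]; first exact: islin_comp cl (rb.2 _).
  apply: (@islin_sum _ _ _ _ _ _ (fun r => coR (fun y1 r2 => G (hmu (W r.1) (bsg (wdeg r.2 + n) y1))
    (rprod phi (ract (W r.2) a) r2)))) => r; exact: coR_linear.
rewrite /L {L y} ractE_word; move: (hval b) => {}b.
rewrite (rprod_words phi hA hA'' _ _ _ ha) (lin_sum cl).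
pose F r x y z := sg (n * wdeg x + n * wdeg y + wdeg r.2 * wdeg x) *:
  G (hmu (W r.1) (W x)) (ract (hmu (W r.2) (W y)) (ac a (W z) * b)).
transitivity (\sum_(p <- splits w) \sum_(r <- splits u) \sum_(q <- splits p.1) F r q.1 q.2 p.2).
  apply: eq_bigr => p _; rewrite (linZ cl) (coR_ract _ _ Gb) (cop_mu hA); last first.
    by split=> z; [exact: (Gb.1 _)|exact: islin_comp (Gb.2 _) (ract_linl _)].
  rewrite scaler_sumr; apply: eq_bigr => r _; rewrite scaler_sumr.
  apply: (eq_splits (F := fun x y => sg (n * wdeg p.1) *: (sg (wdeg r.2 * wdeg x) *:
     G (hmu (W r.1) (W x)) (ract (hmu (W r.2) (W y)) (ac a (W p.2) * b))))
     (G := fun x y => F r x y p.2)) => x y <-.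
  by rewrite scalerA -sgD; congr (_ *: _); apply: par_eq; par_solve.
rewrite exchange_big /=; apply: eq_bigr => r _; rewrite (splitsA (F r)).
rewrite (coR_ract _ _ (Gb' _ _ _)) copE; last first.
  split=> z; first by have b1 := Gb.1; lin; exact: islin_comp (Gb.1 _) (islin_comp (mb.2 _) (bsg_linear _)).
  exact: islin_comp (Gb.2 _) (islin_comp (rb.2 _) (ract_linl _)).
apply: eq_bigr => p _; rewrite (rprod_words phi hA hA'' _ _ _ ha) (lin_sum (Gb.2 _)).
apply: eq_bigr => q _; rewrite bsg_word (linZ (mb.2 _)) (linZ (Gb.1 _)) (linZ (Gb.2 _)) scalerA -sgD.
by congr (_ *: _); apply: par_eq; par_solve.
Qed.
End CoMul.

Section Maps.
Variables (k : comNzRingType) (A A'' : hga_data k) (phi : adga_mor A A'').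
Hypothesis rb : bilin (rprod phi).
Local Notation K := (k_adga k).
Local Notation R := (bmod K A A'').
Local Notation M := (bmod A A A'').

(* The right action of B(k, A, A'') on B(A, A, A''), with h(x, y) = +-x.S(y). *)
Definition Qm (x : M) (s : R) : M :=
  hlift (fun t : bsym A A A'' => let: (a', w, a'') := t in
    lact (hval a') (rprod phi (bt (1 : K) (hvals w) (hval a'')) s)) x.

Lemma Qm_spec s : linear (Qm^~ s) /\ forall a' w a'',
  Qm (bt a' w a'') s = lact a' (rprod phi (bt (1 : K) w a'') s).
Proof.
have [w a''|a' u v a''|a' w|L [Ll LE]] := @bmod_lift k A A A'' M
  (fun a' w a'' => lact a' (rprod phi (bt (1 : K) w a'') s)).
- exact: lact_linl.
- exact: islin_comp (@lact_linr _ _ _ _ _) (islin_comp (rb.1 _) (bt_linm _ _ _ _)).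
- exact: islin_comp (@lact_linr _ _ _ _ _) (islin_comp (rb.1 _) (bt_linr _ _)).
have E : Qm^~ s = L by apply: hlift_lin => // -[[a' w] a'']; rewrite /bval LE.
by rewrite E; split=> // a' w a''; rewrite -LE; exact: (congr1 (@^~ _) E).
Qed.

Lemma Qm_linl s : linear (Qm^~ s).
Proof. by have [] := Qm_spec s. Qed.

Lemma QmE a' r s : Qm (lact a' r) s = lact a' (rprod phi r s).
Proof.
have ql := Qm_linl s.
suff E : (fun r => Qm (lact a' r) s) = (fun r => lact a' (rprod phi r s)) by exact: (congr1 (@^~ r) E).
apply: R_lin_eq => [||w a]; [exact: islin_comp ql (@lact_linr _ _ _ _ _)|by lin|].
by rewrite lactE; have [_ ->] := Qm_spec s.
Qed.

Lemma Qm_linr x : linear (Qm x).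
Proof.
move=> c s t; pose L x := c *: Qm x s + Qm x t; rewrite -[RHS]/(L x).
suff -> : L = Qm^~ (c *: s + t) by [].
apply: lin_bval_eq => [||[[a' w] a'']]; last first.
- by rewrite /L /bval -lactE !QmE (rb.2 _ c s t) lact_linr.
- exact: Qm_linl.
by apply: islin_add; [apply: islin_scale|]; exact: Qm_linl.
Qed.

Lemma Qm_bilin : bilin Qm.
Proof. by split; [exact: Qm_linl|exact: Qm_linr]. Qed.

Lemma Smap_spec : linear (@Smap k A A'') /\ forall a' w a'',
  Smap (bt a' w a'' : M) = bt (1 : K) (red a' :: w) a''.
Proof.
have [w a''|a' u v a''|a' w|L [Ll LE]] := @bmod_lift k A A A'' R
  (fun a' w a'' => bt (1 : K) (red a' :: w) a'').
- exact: islin_comp (bt_linh _ _ _) (@red_linear _ _).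
- exact: (bt_linm _ (red a' :: u)).
- exact: bt_linr.
suff -> : @Smap k A A'' = L by [].
by apply: hlift_lin => // -[[a' w] a'']; rewrite /bval LE.
Qed.

Lemma Smap_linear : linear (@Smap k A A'').
Proof. by have [] := Smap_spec. Qed.

Lemma SmapE a' (r : R) : Smap (lact a' r : M) = pre (red a') r.
Proof.
have sl := Smap_linear.
suff E : (fun r => Smap (lact a' r : M)) = pre (red a') by exact: (congr1 (@^~ r) E).
apply: R_lin_eq => [||w a]; [by lin|exact: pre_linr|].
by rewrite lactE preE; have [_ ->] := Smap_spec.
Qed.

Lemma h2E x y : h2 phi x y = Qm (bsign x) (Smap y).
Proof.
have ql := Qm_linl (Smap y).
suff E : (fun x => h2 phi x y) = (fun x => Qm (bsign x) (Smap y)) by exact: (congr1 (@^~ x) E).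
apply: hlift_lin => [|[[a' w] a'']]; first exact: islin_comp ql (@bsign_linear _ _ _ _).
by rewrite bsignE (linZ ql) /bval -[bt (hval a') _ _]lactE QmE.
Qed.

Lemma bsg_bsign n (x : M) : bsg n (bsign x) = bsg (n + 1) x.
Proof. by rewrite /bsg parD par1 addbT; case: (par n) => //=; rewrite bsignK. Qed.

Lemma bsign_bsg n (x : M) : bsign (bsg n x) = bsg (n + 1) x.
Proof. by rewrite /bsg parD par1 addbT; case: (par n) => //=; rewrite bsignK. Qed.

(** The definition contracts the last two arguments first. When [x] is pulled out at the front, m
    contractions of odd degree have passed it, whence [bsg m]; one more sign is part of [h2]. *)
Lemma hrec_cons m x xs : size xs = m.+1 ->
  hrec phi m.+1 (x :: xs) = h2 phi (bsg m x) (hrec phi m xs).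
Proof.
elim: m x xs => [|m IH] x xs sx; first by case: xs sx.
rewrite -[LHS]/(hrec phi m.+1 (ksign x :: rcons (map (@ksign k A A'') (take m xs))
  (h2 phi (nth 0 xs m) (nth 0 xs m.+1)))).
rewrite IH; first by rewrite -[ksign x]/(bsign x) bsg_bsign addrC -intS.
by rewrite size_rcons size_map size_take sx ltnW.
Qed.

Lemma hn1 x : hn phi [:: x] = x. Proof. by []. Qed.

Lemma hn_cons x xs : (0 < size xs)%N ->
  hn phi (x :: xs) = Qm (bsg (size xs)%:Z x) (Smap (hn phi xs)).
Proof.
case: xs => // y ys _; rewrite /hn [size (x :: _)]/= [(size _).+2.-1]/= hrec_cons //.
by rewrite h2E bsign_bsg addrC -intS.
Qed.

Lemma hn_multilinear : multilinear (hn phi).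
Proof.
have qb := Qm_bilin; have sl := Smap_linear.
move=> l r; elim: l r => [|y l IH] r.
  case: r => [|z r]; first exact: islin_id.
  have E x := @hn_cons x (z :: r) isT.
  by move=> c u v; rewrite /= !E bsg_linear (Qm_linl _ c).
have s0 x : (0 < size (l ++ x :: r))%N by rewrite size_cat addnS.
have sE x : size (l ++ x :: r) = (size l + size r).+1 by rewrite size_cat addnS.
move=> c u v; rewrite /= (hn_cons _ (s0 (c *: u + v))) (hn_cons _ (s0 u)) (hn_cons _ (s0 v)) !sE.
by rewrite (IH r c) sl (Qm_linr _ c).
Qed.

(** A left inverse of the inclusion of A'' in R, killing words of positive length; [f1E] factors f_1
    through it. *)
Definition pR (r : R) : A'' := hlift (fun s : bsym K A A'' => let: (c, w, a'') := s in
  if w is [::] then (hval c : k) *: hval a'' else 0) r.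

Lemma pR_spec : linear pR /\ forall x a, pR (ract x a) = bar_eps x *: a.
Proof.
have [w a''|c u v a''|c w|L [Ll LE]] := @bmod_lift k K A A'' A''
  (fun c w a'' => if w is [::] then (c : k) *: a'' else 0).
- case: w => [|b w]; last exact: islin_zero.
  by move=> c x y; rewrite scalerDl scalerA.
- by case: u => [|b u]; exact: islin_zero.
- by case: w => [|b w]; [apply: islin_scale|exact: islin_zero].
have E : pR = L by apply: hlift_lin => // -[[c w] a'']; rewrite /bval LE; case: w.
rewrite E; split=> // x a.
suff E' : (fun x => L (ract x a)) = (fun x => bar_eps x *: a) by exact: (congr1 (@^~ x) E').
apply: BA_lin_eq => [||w]; [by lin|by lin|].
rewrite -ractE_word LE eps_word; case: w => [|b w] /=; last by rewrite scale0r.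
by rewrite !scale1r.
Qed.

Lemma pR_linear : linear pR.
Proof. by have [] := pR_spec. Qed.

Lemma pR_ract x a : pR (ract x a) = bar_eps x *: a.
Proof. by have [_ ->] := pR_spec. Qed.

Lemma f1_spec : linear (f1 phi) /\ forall (a' : A) (w : seq (abar A)) (a'' : A''),
  f1 phi (bt a' w a'') = if w is [::] then phi a' * a'' else 0.
Proof.
have [w a''|a' u v a''|a' w|L [Ll LE]] := @bmod_lift k A A A'' A''
  (fun a' w a'' => if w is [::] then phi a' * a'' else 0).
- by case: w => [|b w]; [lin|exact: islin_zero].
- by case: u => [|b u]; exact: islin_zero.
- by case: w => [|b w]; [lin|exact: islin_zero].
have -> : f1 phi = L by apply: hlift_lin => // -[[a' w] a'']; rewrite /bval LE; case: w.
by [].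
Qed.

Lemma f1_linear : linear (f1 phi).
Proof. by have [] := f1_spec. Qed.

Lemma f1_bt (a' : A) (w : seq (abar A)) (a'' : A'') :
  f1 phi (bt a' w a'') = if w is [::] then phi a' * a'' else 0.
Proof. by have [_ ->] := f1_spec. Qed.

Lemma f1E a' r : f1 phi (lact a' r) = phi a' * pR r.
Proof.
have fl := f1_linear; have pl := pR_linear.
suff E : (fun r => f1 phi (lact a' r)) = (fun r => phi a' * pR r) by exact: (congr1 (@^~ r) E).
apply: R_lin_eq => [||w a]; [by lin|by lin|].
rewrite lactE f1_bt ractE_word pR_ract eps_word; case: w => [|b w] /=; rewrite ?scale1r //.
by rewrite scale0r mulr0.
Qed.

End Maps.

(** * Sums over the cuts of one argument *)

Section Cuts.
Variables (k : comNzRingType) (A A'' : hga_data k).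
Local Notation K := (k_adga k).
Local Notation R := (bmod K A A'').
Local Notation M := (bmod A A A'').
Local Notation ML := (bmod A A (k_hga k)).
Local Notation wA := (helt (@bhom k A)).

Lemma push_word_id (w : seq wA) : push_word (id_mor A) w = hvals w.
Proof. by rewrite /push_word -[RHS]map_id; apply: eq_map => a; exact: redK. Qed.

Lemma sum_cuts (A0 : hga_data k) (N : lmodType k) (F : cut A0 A A'' -> N) (s : bsym A0 A A'') :
  \sum_(c <- cuts s) F c = \sum_(p <- splits s.1.2) F ((s.1.1, p.1), (p.2, s.2)).
Proof. by case: s => [[a' w] a'']; rewrite /cuts -splits_iota !big_map. Qed.

(* The sum of G over the cuts of y, where an operator of degree n is moved past
   the left parts. *)
Definition Cm (N : lmodType k) n (G : ML -> R -> N) (y : M) : N :=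
  hlift (fun s => \sum_(c <- cuts s) sg (n * cut_ldeg c) *: G (cut_left (id_mor A) c) (cut_right c)) y.

Section CmLemmas.
Variables (N : lmodType k) (n : int) (G : ML -> R -> N).
Hypothesis Gb : bilin G.

Lemma Cm_slin : slin (fun s : bsym A A A'' =>
  \sum_(c <- cuts s) sg (n * cut_ldeg c) *: G (cut_left (id_mor A) c) (cut_right c)).
Proof.
have -> : (fun s : bsym A A A'' =>
    \sum_(c <- cuts s) sg (n * cut_ldeg c) *: G (cut_left (id_mor A) c) (cut_right c)) =
  (fun s => let: (a', w, a'') := s in \sum_(p <- splits w) sg (n * (hdeg a' + wdeg p.1)) *:
     G (bt (hval a') (hvals p.1) 1) (bt (1 : K) (hvals p.2) (hval a''))).
  apply: funext => -[[a' w] a'']; rewrite sum_cuts; apply: eq_bigr => p _.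
  by rewrite /cut_left /= push_word_id.
split=> [w a''|a' a''|a' w].
- apply: elin_sum => p; apply: (elin_scale (fun m => sg (n * (m + wdeg p.1)))).
  apply: (elin_hval (L := fun x => G (bt x _ _) _)); exact: islin_comp (Gb.1 _) (bt_linl _ _).
- apply: (wlin_splits (G := fun u v => sg (n * (hdeg a' + wdeg u)) *:
    G (bt (hval a') (hvals u) 1) (bt (1 : K) (hvals v) (hval a'')))) => v.
    apply: (wlin_deg (fun m => sg (n * (hdeg a' + m)))).
    exact: (bt_wlin (L := fun x => G x _) _ _ (Gb.1 _)).
  apply: wlin_zmod; exact: (bt_wlin (L := fun x => G _ x) _ _ (Gb.2 _)).
- apply: elin_sum => p; apply: elin_zmod.
  apply: (elin_hval (L := fun x => G _ (bt _ _ x))); exact: islin_comp (Gb.2 _) (bt_linr _ _).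
Qed.

Lemma Cm_linear : linear (Cm n G).
Proof. exact: (hlift_linear Cm_slin). Qed.

Lemma Cm_bval s : Cm n G (bval s) =
  \sum_(c <- cuts s) sg (n * cut_ldeg c) *: G (cut_left (id_mor A) c) (cut_right c).
Proof. exact: (hliftE Cm_slin). Qed.

(** The coefficient [b] always stays on the left, so the cuts of b (x) r are those of the coaction
    on [r]. *)
Lemma Cm_lact (b : helt (@ahom k A)) (r : R) : Cm n G (lact (hval b) r) =
  sg (n * hdeg b) *: coR (fun s1 s2 => G (lact (hval b) (bsg n s1)) s2) r.
Proof.
have cl := Cm_linear; have gb : bilin (fun (s1 : BA A) s2 => G (lact (hval b) (bsg n s1)) s2) by lin.
have rl := coR_linear gb.
suff E : (fun r => Cm n G (lact (hval b) r)) =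
    (fun r => sg (n * hdeg b) *: coR (fun s1 s2 => G (lact (hval b) (bsg n s1)) s2) r).
  exact: (congr1 (@^~ r) E).
apply: R_lin_eq => [||w a]; [by lin|exact: islin_scale|].
rewrite lactE -[bt _ _ _]/(bval (b, w, a)) Cm_bval sum_cuts (coRE gb) scaler_sumr.
apply: eq_bigr => p _; rewrite bsg_word (linZ (@lact_linr _ _ _ _ _)) (linZ (Gb.1 _)) scalerA -sgD.
rewrite /cut_left /cut_right /cut_ldeg /= push_word_id /word lactE; congr (_ *: _); apply: par_eq; par_solve.
Qed.
End CmLemmas.
End Cuts.

Lemma adiff_red (k : comNzRingType) (A : adga k) (a : A) : adiff A (aval (red a)) = adiff A a.
Proof. by rewrite /= raddfB /= linearZ /= adiff1 scaler0 subr0. Qed.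

(** * Differentials of S, f_1 and the right action *)

Section Homotopy.
Variables (k : comNzRingType) (A A'' : hga_data k) (phi : adga_mor A A'').
Hypotheses (hA : is_hga A) (hA'' : is_hga A'') (hphi : is_hga_mor phi).
Local Notation K := (k_adga k).
Local Notation R := (bmod K A A'').
Local Notation M := (bmod A A A'').
Local Notation ML := (bmod A A (k_hga k)).
Local Notation W w := (word (hvals (w : seq (helt (@bhom k A))))).
Local Notation wA := (helt (@bhom k A)).
Local Notation dR := (bar_diff (aug_mor A) phi).
Local Notation dM := (bar_diff (id_mor A) phi).
Let rb : bilin (rprod phi) := rprod_bilin phi hA hA''.
Let mb : bilin (@hmu k A) := hmu_bilin hA.
Let qb : bilin (Qm phi) := Qm_bilin rb.
Let sl : linear (@Smap k A A'') := @Smap_linear k A A''.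
Let fl : linear (f1 phi) := f1_linear phi.
Let pl : linear (@pR k A A'') := @pR_linear k A A''.

Lemma ract_pre (a : abar A) (x : BA A) (c : A'') : ract (pre a x) c = pre a (ract x c : R).
Proof.
suff E : (fun x : BA A => ract (pre a x) c) = (fun x => pre a (ract x c : R)) by exact: (congr1 (@^~ x) E).
apply: BA_lin_eq => [||w]; [by lin|by lin|].
by rewrite pre_word /word !ractE preE.
Qed.

(** [twist] singles out the cut behind the first letter, which expresses the left outer term of the
    differential through the coaction. *)
Lemma dM_lact (b : helt (@ahom k A)) (r : R) : dM (lact (hval b) r) =
  lact (adiff A (hval b)) r + sg (hdeg b) *: lact (hval b) (dR r)
  + sg (hdeg b) *: coR (fun x1 r2 => lact (hval b * twist x1) r2) r.
Proof.
have gb : bilin (fun (x1 : BA A) (r2 : R) => lact (hval b * twist x1) r2 : M) by lin.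
have cl := coR_linear gb.
pose L (r : R) : M := lact (adiff A (hval b)) r + sg (hdeg b) *: lact (hval b) (dR r)
  + sg (hdeg b) *: coR (fun x1 r2 => lact (hval b * twist x1) r2) r.
suff E : (fun r => dM (lact (hval b) r)) = L by exact: (congr1 (@^~ r) E).
apply: R_lin_eq => [||w a]; [by lin| |].
  by apply: islin_add; [by lin|exact: islin_scale].
rewrite /L !lactE bar_diff_M; congr (_ + _); rewrite (coRE gb).
case: w => [|c w]; first by rewrite big_seq1 twistE mulr0 (lin0 (lact_linl _)) scaler0.
rewrite (splits_cons (fun u v => lact (hval b * twist (W u)) (bt (1 : K) (hvals v) (hval a)))).
rewrite twistE mulr0 (lin0 (lact_linl _)) add0r.
case: w => [|d w]; first by rewrite big_seq1 twistE lactE.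
rewrite (splits_cons (fun u v => lact (hval b * twist (W (c :: u))) (bt (1 : K) (hvals v) (hval a)))).
rewrite big1 => [|p _]; last by rewrite twistE mulr0 (lin0 (lact_linl _)).
by rewrite addr0 twistE lactE.
Qed.

Lemma bval_lact (b : helt (@ahom k A)) (w : seq wA) (c : helt (@ahom k A'')) :
  bval (b, w, c) = lact (hval b) (ract (W w) (hval c) : R) :> M.
Proof. by rewrite /word ractE lactE. Qed.

(** This is the map eps (x) 1 in the homotopy formula for S. *)
Definition E0 (y : M) : R := hlift (fun s : bsym A A A'' => let: (a', w, a'') := s in
  (aeps A (hval a') : k) *: bt (1 : K) (hvals w) (hval a'')) y.

Lemma E0_spec : linear E0 /\ forall a' w a'',
  E0 (bt a' w a'') = (aeps A a' : k) *: bt (1 : K) w a''.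
Proof.
have [w a''|a' u v a''|a' w|L [Ll LE]] := @bmod_lift k A A A'' R
  (fun a' w a'' => (aeps A a' : k) *: bt (1 : K) w a'').
- exact: islin_scalel (@aeps_linear _ A).
- apply: islin_scale; exact: bt_linm.
- apply: islin_scale; exact: bt_linr.
suff -> : E0 = L by [].
by apply: hlift_lin => // -[[a' w] a'']; rewrite /bval LE.
Qed.

Lemma E0_linear : linear E0.
Proof. by have [] := E0_spec. Qed.

Lemma E0_lact a' r : E0 (lact a' r) = (aeps A a' : k) *: r.
Proof.
have el := E0_linear.
suff E : (fun r => E0 (lact a' r)) = (fun r => (aeps A a' : k) *: r) by exact: (congr1 (@^~ r) E).
apply: R_lin_eq => [||w a]; [by lin|by apply: islin_scale; exact: islin_id|].
by rewrite lactE; have [_ ->] := E0_spec.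
Qed.

Definition iotaR (c : A'') : R := bt (1 : K) [::] c.

Lemma iotaR_linear : linear iotaR.
Proof. exact: bt_linr. Qed.

(** The last summand is the right outer term in the case that [a0] is the only letter. *)
Lemma dR_pre (a0 : wA) (w : seq wA) (c : A'') : dR (pre (hval a0) (ract (W w) c)) =
  - pre (red (adiff A (aval (hval a0)))) (ract (W w) c)
  + sg (hdeg a0 - 1) *: pre (hval a0) (dR (ract (W w) c))
  + (if w is b :: r then sg (hdeg a0 - 1) *: pre (red (aval (hval a0) * aval (hval b))) (ract (W r) c) else 0)
  - bar_eps (W w) *: iotaR (phi (aval (hval a0)) * c).
Proof.
have gb : bilin (fun x1 x2 : BA A => ract (bsign x1) (phi (twist x2) * c) : R) by lin.
rewrite -ract_pre dR_ract cop_pre // pre_word (dBA_cons a0) twistE.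
rewrite dR_ract !(linB (pre_linr (hval a0))) !(linD (pre_linr (hval a0))) !scalerDr scalerN.
have -> : cop (fun x y : BA A => ract (bsign (pre (hval a0) x)) (phi (twist y) * c)) (W w) =
    sg (hdeg a0 - 1) *: pre (hval a0) (cop (fun x1 x2 : BA A => ract (bsign x1) (phi (twist x2) * c) : R) (W w)).
  rewrite copE; last by lin.
  rewrite copE // (lin_sum (pre_linr (hval a0))) scaler_sumr; apply: eq_bigr => p _.
  by rewrite bsign_pre (linZ (ract_linl _)) ract_pre.
have -> : ract (bsign (word [::])) (phi (match hvals w with [::] => aval (hval a0) | _ :: _ => 0 end) * c) =
    bar_eps (W w) *: iotaR (phi (aval (hval a0)) * c).
  rewrite (bsign_word [::]) wdeg_nil sg0 scale1r eps_word /iotaR (ractE_word [::]).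
  by case: (hvals w) => [|d v] /=; rewrite ?scale1r // scale0r raddf0 mul0r (lin0 (ract_linr _)).
rewrite -pre_word bsign_pre !(linD (ract_linl _)) (linN (ract_linl _)) !(linZ (ract_linl _)) !ract_pre.
have -> : ract (if w is b :: r then sg (hdeg a0 - 1) *:
    pre (red (aval (hval a0) * aval (hval b))) (W r) else 0) c =
  (if w is b :: r then sg (hdeg a0 - 1) *: pre (red (aval (hval a0) * aval (hval b))) (ract (W r) c) else 0).
  by case: (w) => [|b r]; rewrite ?(lin0 (ract_linl _)) // (linZ (ract_linl _)) ract_pre.
by rewrite opprD !addrA [LHS](ACl (1*2*4*6*3*5)).
Qed.

(** S sees a' only through its reduction. For a next letter [b], the differential of S(y) contains
    the product of this reduction with [b], while S of the differential reduces a'b; the difference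
    is eps(a')b, which is the [E0] term. On the empty word the right outer term yields both terms of
    the claim. *)
Lemma Smap_diff y : dR (Smap y) + Smap (dM y) = E0 y - iotaR (f1 phi y).
Proof.
have il := iotaR_linear; have el := E0_linear.
suff E : (fun y => dR (Smap y) + Smap (dM y)) = (fun y => E0 y - iotaR (f1 phi y)).
  exact: (congr1 (@^~ y) E).
apply: lin_bval_eq => [||[[a' w] a'']]; [by lin|by lin|].
rewrite bval_lact; set c := hval a''.
have S3 X Y Z s : Smap (X + s *: Y + s *: Z : M) = Smap X + s *: Smap Y + s *: Smap Z.
  by rewrite !(linD sl, linZ sl).
have -> : Smap (lact (hval a') (ract (W w) c)) = pre (red (hval a')) (ract (W w) c) by exact: SmapE.
have -> : Smap (dM (lact (hval a') (ract (W w) c))) = pre (red (adiff A (hval a'))) (ract (W w) c)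
    + sg (hdeg a') *: pre (red (hval a')) (dR (ract (W w) c))
    + sg (hdeg a') *: Smap (coR (fun x1 r2 => lact (hval a' * twist x1) r2 : M) (ract (W w) c)).
  rewrite (dM_lact a') S3; congr (_ + _ *: _ + _); exact: SmapE.
have -> : f1 phi (lact (hval a') (ract (W w) c)) = phi (hval a') * (bar_eps (W w) *: c).
  by rewrite f1E pR_ract.
rewrite E0_lact.
have gb : bilin (fun (x1 : BA A) (r2 : R) => lact (hval a' * twist x1) r2 : M) by lin.
pose a0 : wA := Helt (bhom_red (hvalP a')).
have aE : hval a' = aval (hval a0) + (aeps A (hval a') : k) *: 1 by rewrite /= subrK.
have m0 : (aeps A (hval a') : k) = 0 \/ hdeg a' = 0.
  by have [->|n0] := eqVneq (hdeg a') 0; [right|left; exact: aeps_hom (hvalP a') n0].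
have := dR_pre a0 w c; rewrite -[hval a0]/(red (hval a')) -[hdeg a0]/(hdeg a') => ->.
have -> : adiff A (aval (red (hval a'))) = adiff A (hval a').
  exact: adiff_red.
set P := pre (red (adiff A (hval a'))) _; set Q := pre _ (dR _).
have -> : Smap (coR (fun x1 r2 => lact (hval a' * twist x1) r2 : M) (ract (W w) c)) =
    (if w is b :: r then pre (red (hval a' * aval (hval b))) (ract (W r) c) else 0).
  rewrite -ractE_word coRE // (lin_sum sl).
  rewrite (eq_bigr (fun p => pre (red (hval a' * twist (W p.1))) (bt (1 : K) (hvals p.2) c))); last first.
    by move=> p _; rewrite SmapE.
  pose F (u v : seq wA) : R := pre (red (hval a' * twist (W u))) (bt (1 : K) (hvals v) c).
  have F0 (u v : seq wA) : size u != 1%N -> F u v = 0.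
    case: u => [|d [|e u]] // _;
    by rewrite /F twistE mulr0 (lin0 (@red_linear k A)) (lin0 (pre_linl _)).
  rewrite -[LHS]/(\sum_(p <- splits w) F p.1 p.2); case: (w) => [|b r]; first by rewrite big_seq1 F0.
  rewrite (splits_cons F) F0 // add0r; case: r => [|d r].
    by rewrite big_seq1 /F twistE -ractE_word.
  rewrite (splits_cons (fun u v => F (b :: u) v)) big1 => [|p _]; last by rewrite F0.
  by rewrite addr0 /F twistE -ractE_word.
have sB : sg (hdeg a' - 1) = - sg (hdeg a') :> k.
  by rewrite -sgN; apply: par_eq; par_solve.
(* The sign may be dropped, since eps(a') is 0 unless a' has degree 0. *)
set e : k := aeps A (hval a'); have se : sg (hdeg a') * e = e.
  by case: m0 => m0; [rewrite /e m0 mulr0|rewrite m0 sg0 mul1r].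
have AC (V : zmodType) (p q m f m' : V) : - p + - q + m - f + (p + q + m') = m + m' - f.
  by rewrite !addrA [LHS](ACl (1*5*2*6*3*7*4)) /= addNr add0r addNr add0r.
rewrite sB scaleNr AC {AC P Q}.
have redE : aval (red (hval a')) = hval a' - e *: 1 by [].
rewrite redE eps_word; case: w => [|b r].
  rewrite scaler0 addr0 add0r !scale1r raddfB /= linearZ /= rmorph1 mulrBl -scalerAl mul1r.
  by rewrite (linB il) (linZ il) opprB -(ractE_word [::]).
rewrite scale0r subr0 scale0r mulr0 (lin0 il) subr0 scaleNr addrC -scalerBr mulrBl.
rewrite -scalerAl mul1r (linB (@red_linear k A)) (linZ (@red_linear k A)).
rewrite (linB (pre_linl _)) (linZ (pre_linl _)) redK subKr scalerA se.
by rewrite -ract_pre pre_word.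
Qed.

(** A word with one letter b contributes through both outer terms, each giving phi(a') phi(b) c,
    with opposite signs. *)
Lemma f1_diff y : f1 phi (dM y) = adiff A'' (f1 phi y).
Proof.
suff E : (fun y => f1 phi (dM y)) = (fun y => adiff A'' (f1 phi y)) by exact: (congr1 (@^~ y) E).
apply: lin_bval_eq => [||[[a' w] a'']]; [by lin|by lin|].
rewrite bval_lact; set c := hval a''.
have F3 X Y Z s : f1 phi (X + s *: Y + s *: Z : M) = f1 phi X + s *: f1 phi Y + s *: f1 phi Z.
  by rewrite !(linD fl, linZ fl).
have gb : bilin (fun (x1 : BA A) (r2 : R) => lact (hval a' * twist x1) r2 : M) by lin.
have ll (b : A) x : f1 phi (lact b (ract x c)) = phi b * (bar_eps x *: c).
  by rewrite f1E pR_ract.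
have sumE (x1 x2 x3 : A'') : x1 = phi (adiff A (hval a')) * (bar_eps (W w) *: c) ->
    x2 = phi (hval a') * (bar_eps (W w) *: adiff A'' c - phi (twist (W w)) * c) ->
    x3 = phi (hval a') * (phi (twist (W w)) * c) ->
    x1 + sg (hdeg a') *: x2 + sg (hdeg a') *: x3 = adiff A'' (phi (hval a') * (bar_eps (W w) *: c)).
  move=> -> -> ->; rewrite mulrBr scalerBr addrA subrK amor_diff.
  by rewrite (adiffM _ (amor_hom phi (hvalP a'))) (linZ (@adiff_linear _ A'')).
refine (etrans (congr1 (f1 phi) (dM_lact a' _)) _); refine (etrans (F3 _ _ _ _) _).
refine (etrans (sumE _ _ _ (ll _ _) _ _) (congr1 (adiff A'') (esym (ll _ _)))).
  rewrite f1E; congr (_ * _).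
  have P3 (X Y Z : R) : pR (X + Y - Z) = pR X + pR Y - pR Z by rewrite (linB pl) (linD pl).
  have gb' : bilin (fun x1 x2 : BA A => ract (bsign x1) (phi (twist x2) * c) : R) by lin.
  have sum3 (x1 x2 x3 x2' x3' : A'') : x1 = 0 -> x2 = x2' -> x3 = x3' -> x1 + x2 - x3 = x2' - x3'.
    by move=> -> -> ->; rewrite add0r.
  rewrite dR_ract; refine (etrans (P3 _ _ _) (sum3 _ _ _ _ _ _ _ _)).
  - by rewrite pR_ract eps_dBA scale0r.
  - rewrite pR_ract; congr (_ *: _); rewrite bsign_word (linZ (@epsA_linear _ A)) eps_word.
    by case: (w) => [|b r] /=; rewrite ?scaler0 // wdeg_nil sg0 scale1r.
  rewrite copE // (lin_sum pl).
  rewrite (eq_bigr (fun p => bar_eps (W p.1) *: (phi (twist (W p.2)) * c))).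
    rewrite -(copE (G := fun x y => bar_eps x *: (phi (twist y) * c))); last by lin.
    by rewrite (cop_counitl (L := fun y => phi (twist y) * c)) //; lin.
  move=> p _; rewrite pR_ract bsign_word (linZ (@epsA_linear _ A)) eps_word.
  by case: (p.1) => [|b r] /=; rewrite ?wdeg_nil ?sg0 ?scale1r ?scaler0 // !scale0r.
rewrite -ractE_word coRE // (lin_sum fl).
rewrite (eq_bigr (fun p => bar_eps (W p.2) *: (phi (hval a' * twist (W p.1)) * c))).
  rewrite (splits_counitr (fun u v => phi (hval a' * twist (W u)) * c)).
  by rewrite rmorphM /= mulrA.
by move=> p _; rewrite ractE_word ll scalerAr.
Qed.

Lemma f1_Qm_iotaR x c : f1 phi (Qm phi x (iotaR c)) = f1 phi x * c.
Proof.
have il := iotaR_linear.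
suff E : (fun x => f1 phi (Qm phi x (iotaR c))) = (fun x => f1 phi x * c) by exact: (congr1 (@^~ x) E).
apply: lin_bval_eq => [||[[a' w] a'']]; [by lin|by lin|].
by rewrite bval_lact QmE // (rprod_rc phi hA hA'') !f1E !pR_ract -mulrA scalerAl.
Qed.

Lemma Qm_Qm x s t : Qm phi (Qm phi x s) t = Qm phi x (rprod phi s t).
Proof.
suff E : (fun x => Qm phi (Qm phi x s) t) = (fun x => Qm phi x (rprod phi s t)) by exact: (congr1 (@^~ x) E).
apply: lin_bval_eq => [||[[a' w] a'']]; [by lin|by lin|].
by rewrite bval_lact !QmE // (rprodA hA hA'' hphi).
Qed.

Lemma Smap_Qm x c : Smap (Qm phi x (iotaR c)) = rprod phi (Smap x) (iotaR c).
Proof.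
suff E : (fun x => Smap (Qm phi x (iotaR c))) = (fun x => rprod phi (Smap x) (iotaR c)).
  exact: (congr1 (@^~ x) E).
apply: lin_bval_eq => [||[[a' w] a'']]; [by lin|by lin|].
by rewrite bval_lact QmE // !SmapE (rprod_rc phi hA hA'') -!ract_pre (rprod_rc phi hA hA'').
Qed.

(* \tilde m_2 with an arbitrary element as second argument. *)
Definition mt2 (s : bsym A A A'') (y : M) : M := let: (a', w, a'') := s in
  \sum_(r <- splits w) sg (wdeg r.1) *:
    Cm (wdeg r.2 + hdeg a'') (fun yl yr => lact (hval a' * hE (W r.1) (Smap yl))
        (rprod phi (ract (W r.2) (hval a'')) yr)) y.

Lemma mt2_bilin (a' : A) x (r : R) :
  bilin (fun (yl : ML) yr => lact (a' * hE x (Smap yl)) (rprod phi r yr) : M).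
Proof. by have eb := hE_bilin hA; have sl' := @Smap_linear k A (k_hga k); lin. Qed.

Lemma mt2_linear s : linear (mt2 s).
Proof.
case: s => [[a' w] a'']; apply: (@islin_sum _ _ _ _ _ _ (fun r y => sg (wdeg r.1) *:
    Cm (wdeg r.2 + hdeg a'') (fun yl yr => lact (hval a' * hE (W r.1) (Smap yl))
        (rprod phi (ract (W r.2) (hval a'')) yr)) y)) => r.
by apply: islin_scale; apply: Cm_linear; exact: mt2_bilin.
Qed.

End Homotopy.

Lemma eq_splits_pair (k : comNzRingType) (A : adga k) (N : lmodType k)
    (F G : seq (helt (@bhom k A)) * seq (helt (@bhom k A)) -> N) w :
  (forall p, wdeg p.1 + wdeg p.2 = wdeg w -> F p = G p) ->
  \sum_(p <- splits w) F p = \sum_(p <- splits w) G p.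
Proof.
move=> FG; have := @eq_splits k A N (fun u v => F (u, v)) (fun u v => G (u, v)) w.
move=> E; have EP (H : _ * _ -> N) :
    \sum_(p <- splits w) H p = \sum_(p <- splits w) H (p.1, p.2) by apply: eq_bigr => -[].
by rewrite (EP F) (EP G); apply: E => u v uv; exact: FG.
Qed.

Section Homotopy.
Variables (k : comNzRingType) (A A'' : hga_data k) (phi : adga_mor A A'').
Hypotheses (hA : is_hga A) (hA'' : is_hga A'') (hphi : is_hga_mor phi).
Local Notation K := (k_adga k).
Local Notation R := (bmod K A A'').
Local Notation M := (bmod A A A'').
Local Notation ML := (bmod A A (k_hga k)).
Local Notation W w := (word (hvals (w : seq (helt (@bhom k A))))).
Local Notation wA := (helt (@bhom k A)).
Local Notation dR := (bar_diff (aug_mor A) phi).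
Local Notation dM := (bar_diff (id_mor A) phi).
Let rb : bilin (rprod phi) := rprod_bilin phi hA hA''.
Let mb : bilin (@hmu k A) := hmu_bilin hA.
Let qb : bilin (Qm phi) := Qm_bilin rb.
Let sl : linear (@Smap k A A'') := @Smap_linear k A A''.

Lemma bsg_pre n (a : wA) (x : BA A) :
  bsg n (pre (hval a) x) = sg (n * (hdeg a - 1)) *: pre (hval a) (bsg n x).
Proof. by rewrite /bsg sgE parM; case: (par n); rewrite ?bsign_pre ?sgE ?expr0 ?scale1r. Qed.

(** By the Leibniz rule in R only the left outer term is in question. It is a cut of a product
    x.S(y): in front of the first letter of S(y) the cut reproduces the left outer term of x, behind
    that letter a piece of S(y) enters E, which is [mt2]. *)
Lemma Qm_diff0 s y : dM (Qm phi (bval s) (Smap y)) =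
  Qm phi (dM (bval s)) (Smap y) + sg (bdeg s) *: Qm phi (bval s) (dR (Smap y)) + sg (bdeg s) *: mt2 phi s y.
Proof.
have ml := mt2_linear phi hA hA'' s.
pose L y := Qm phi (dM (bval s)) (Smap y) + sg (bdeg s) *: Qm phi (bval s) (dR (Smap y))
  + sg (bdeg s) *: mt2 phi s y.
suff E : (fun y => dM (Qm phi (bval s) (Smap y))) = L by exact: (congr1 (@^~ y) E).
apply: lin_bval_eq => [||[[b v] b'']]; [by lin| |].
  by apply: islin_add; [by lin|exact: islin_scale].
rewrite /L {L ml}; case: s => [[a' w] a''].
have -> : bval (a', w, a'') = lact (hval a') (ract (W w) (hval a'') : R) by exact: bval_lact.
have -> : bval (b, v, b'') = lact (hval b) (ract (W v) (hval b'') : R) by exact: bval_lact.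
set n := bdeg _; have nE : n = hdeg a' + (wdeg w + hdeg a'') by rewrite /n /bdeg /= addrA.
set r := ract (W w) (hval a''); set s' := ract (W v) (hval b'').
have sE : Smap (lact (hval b) s' : M) = pre (red (hval b)) s' by exact: SmapE.
rewrite sE; set s := pre (red (hval b)) s'.
have gb : bilin (fun (x1 : BA A) (r2 : R) => lact (hval a' * twist x1) r2 : M) by lin.
have QE z : Qm phi (lact (hval a') z) s = lact (hval a') (rprod phi z s) by exact: (QmE rb).
have rs : bsign r = sg (wdeg w + hdeg a'') *: r.
  have := @bsignE k K A A'' (kone k, w, a''); rewrite /bval /bdeg /= ractE_word add0r; exact.
have e1 : dM (Qm phi (lact (hval a') r) s) = lact (adiff A (hval a')) (rprod phi r s)
   + (sg (hdeg a') *: lact (hval a') (rprod phi (dR r) s)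
   + sg n *: lact (hval a') (rprod phi r (dR s)))
   + sg (hdeg a') *: coR (fun x1 r2 => lact (hval a' * twist x1) r2 : M) (rprod phi r s).
  rewrite QE (dM_lact phi a') (rprod_diff hA hA'' hphi) rs (linZ (rb.1 _)).
  by rewrite (linD (@lact_linr _ _ _ _ _)) (linZ (@lact_linr _ _ _ _ _)) scalerDr scalerA -sgD nE.
have e2 : Qm phi (dM (lact (hval a') r)) s = lact (adiff A (hval a')) (rprod phi r s)
   + sg (hdeg a') *: lact (hval a') (rprod phi (dR r) s)
   + sg (hdeg a') *: Qm phi (coR (fun x1 r2 => lact (hval a' * twist x1) r2 : M) r) s.
  have Q3 X Y Z c : Qm phi (X + c *: Y + c *: Z) s = Qm phi X s + c *: Qm phi Y s + c *: Qm phi Z s.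
    by rewrite !(linD (qb.1 s), linZ (qb.1 s)).
  refine (etrans (congr1 (fun x => Qm phi x s) (dM_lact phi a' r)) _); refine (etrans (Q3 _ _ _ _) _).
  by congr (_ + _ *: _ + _); exact: (QmE rb).
have e3 : Qm phi (lact (hval a') r) (dR s) = lact (hval a') (rprod phi r (dR s)) by exact: (QmE rb).
(* The remaining terms agree by the Leibniz rule; what is left is the left outer term of the
   product. *)
suff e4 : sg (hdeg a') *: coR (fun x1 r2 => lact (hval a' * twist x1) r2 : M) (rprod phi r s) =
    sg (hdeg a') *: Qm phi (coR (fun x1 r2 => lact (hval a' * twist x1) r2 : M) r) s
    + sg n *: mt2 phi (a', w, a'') (lact (hval b) s').
  have sumE (X Y Z T U V : M) : T = U + V -> X + (Y + Z) + T = X + Y + U + Z + V.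
    by move=> ->; rewrite !addrA -!(addrAC _ U).
  refine (etrans e1 (esym (etrans (f_equal2 (fun x z => x + sg n *: z + _) e2 e3) _))).
  exact/esym/sumE.
have e5 : Qm phi (coR (fun x1 r2 => lact (hval a' * twist x1) r2 : M) r) s =
    \sum_(p <- splits w) lact (hval a' * twist (W p.1)) (rprod phi (ract (W p.2) (hval a'')) s).
  rewrite /r -ractE_word (coRE gb) (lin_sum (qb.1 s)); apply: eq_bigr => p _.
  by rewrite ractE_word; exact: (QmE rb).
have gb2 p (c : seq wA) : bilin (fun y1 r2 => lact (hval a' * twist (hmu (W c) (bsg (wdeg p + hdeg a'') y1)))
     (rprod phi (ract (W p) (hval a'')) r2) : M) by lin.
rewrite e5 (coR_mul phi hA hA'' w a'' s gb) /mt2 !scaler_sumr -big_split /=.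
apply: eq_splits_pair => p pE; set q := wdeg p.2 + hdeg a''.
rewrite (coR_pre _ _ (gb2 _ _)) scalerDr; congr (_ *: _ + _).
  by rewrite (bsg_word _ [::]) wdeg_nil mulr0 sg0 scale1r hmu_word1r.
rewrite (Cm_lact q (mt2_bilin phi hA hA'' _ _ _)).
have -> : s' = bt (1 : K) (hvals v) (hval b'') by rewrite ractE_word.
rewrite coRE; last first.
  have b2 := gb2 p.2 p.1; split=> z; last exact: b2.2.
  exact: islin_comp (b2.1 z) (pre_linr _).
rewrite coRE; last first.
  have b2 := mt2_bilin phi hA hA'' (hval a') (W p.1) (ract (W p.2) (hval a'')); split=> z; last exact: b2.2.
  exact: islin_comp (b2.1 z) (islin_comp (@lact_linr _ _ _ _ _) (bsg_linear _)).
rewrite !scaler_sumr; apply: eq_bigr => o _.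
have -> : Smap (lact (hval b) (bsg q (W o.1)) : ML) = pre (red (hval b)) (bsg q (W o.1)) by exact: SmapE.
rewrite /hE; have := bsg_pre q (Helt (bhom_red (hvalP b))) (W o.1); rewrite -/q /= => ->.
rewrite (linZ (mb.2 _)) (linZ (@twist_linear _ _)) -scalerAr (linZ (lact_linl _)) !scalerA -!sgD.
by congr (_ *: _); apply: par_eq; rewrite nE -pE /q; par_solve.
Qed.

(** After substitution of the homotopy formula for S, the [mt2] and [E0] terms add up to m_2(s,
    y). *)
Lemma Qm_diff s y : dM (Qm phi (bval s) (Smap y)) =
  Qm phi (dM (bval s)) (Smap y) - sg (bdeg s) *: Qm phi (bval s) (Smap (dM y))
  + sg (bdeg s) *: (mt2 phi s y + Qm phi (bval s) (E0 y)) - sg (bdeg s) *: Qm phi (bval s) (iotaR A (f1 phi y)).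
Proof.
have Sd : dR (Smap y) = E0 y - iotaR A (f1 phi y) - Smap (dM y).
  by rewrite -(Smap_diff phi) addrK.
refine (etrans (Qm_diff0 s y) _); refine (etrans (congr1 (fun z => _ + _ *: Qm phi (bval s) z + _) Sd) _).
have Q3 X Y Z : Qm phi (bval s) (X - Y - Z) = Qm phi (bval s) X - Qm phi (bval s) Y - Qm phi (bval s) Z.
  by rewrite !(linB (qb.2 _)).
rewrite Q3; move: (Qm phi _ (E0 y)) (Qm phi _ (iotaR A _)) (Qm phi _ (Smap (dM y))) (mt2 _ _ _) (Qm phi _ _).
move=> e i d m q; rewrite !scalerBr scalerDr -!addrA; congr (_ + _).
by rewrite !addrA [LHS](ACl (3*4*1*2)) /= ?addrA.
Qed.
End Homotopy.

(** * Cutting h_n *)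

Section RprodAug.
Variables (k : comNzRingType) (A : hga_data k).
Hypothesis hA : is_hga A.
Local Notation K := (k_adga k).
Local Notation W w := (word (hvals (w : seq (helt (@bhom k A))))).
Local Notation aug := (aug_mor A : adga_mor A (k_hga k)).
Let mb : bilin (@hmu k A) := hmu_bilin hA.

Lemma bval_word (c a : helt (@ahom k K)) (w : seq (helt (@bhom k A))) :
  bval (c, w, a) = ((hval c : k) * (hval a : k)) *: W w.
Proof. by rewrite /bval /= bt1 bt1r scalerA. Qed.

Lemma ract_1 (x : BA A) : ract x (1 : k_hga k) = x.
Proof.
suff E : (fun x : BA A => ract x (1 : k_hga k)) = id by exact: (congr1 (@^~ x) E).
by apply: BA_lin_eq => [||w]; [exact: ract_linl|exact: islin_id|exact: ractE].
Qed.

Lemma wact_aug (a : k_hga k) (w : seq (helt (@bhom k A))) : wact aug a (W w) = bar_eps (W w) *: a.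
Proof.
rewrite wactE /act pW_eps /hE.
have -> : hmu (word [:: red a]) (pW aug (W w)) = 0.
  by rewrite /= eps_word scale0r.
by rewrite (lin0 (@twist_linear k (k_hga k))) add0r -scalerA; congr (_ *: _); rewrite /GRing.scale /= mulr1.
Qed.

(** Over k the term E([a], y) of [act] vanishes, so BA acts on the coefficients through the counit
    and the smash product collapses to [hmu]. The left parts of cuts are multiplied in this way. *)
Lemma rprod_aug x y : rprod aug x y = hmu x y.
Proof.
have rs u (a : helt (@ahom k (k_hga k))) w b : rsym aug u a w b = ract (hmu (W u) (W w)) (hval a * b).
  rewrite /rsym (eq_bigr (fun p => bar_eps (W p.2) *: ract (hmu (W u) (W p.1)) (hval a * b))).
    exact: (splits_counitr (fun x _ => ract (hmu (W u) (W x)) (hval a * b))).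
  move=> p _; rewrite wact_aug -scalerAl (linZ (ract_linr _)).
  by case: (khom_unit a) => ->; rewrite ?mul0r ?sg0 ?scale1r // !(lin0 (ract_linr _)) !scaler0.
rewrite rprodE0; have El s : hlift (rprod_sym aug s) = hmu (bval s).
  apply: hlift_lin => [|[[e w] b]]; first exact: mb.2.
  case: s => [[c u] a]; rewrite /rprod_sym rs !bval_word (linZ (mb.1 _)) !(linZ (mb.2 _)).
  have -> : hval a * hval b = (hval a * hval b : k) *: (1 : k^o) by rewrite /GRing.scale /= mulr1.
  rewrite (linZ (ract_linr _)) ract_1 !scalerA; congr (_ *: _).
  by rewrite [RHS]mulrACA.
by apply: (congr1 (@^~ x) (hlift_lin (mb.1 y) _)) => s; rewrite El.
Qed.
End RprodAug.

Section CutQm.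
Variables (k : comNzRingType) (A A'' : hga_data k) (phi : adga_mor A A'').
Hypotheses (hA : is_hga A) (hA'' : is_hga A'').
Local Notation K := (k_adga k).
Local Notation R := (bmod K A A'').
Local Notation M := (bmod A A A'').
Local Notation ML := (bmod A A (k_hga k)).
Local Notation W w := (word (hvals (w : seq (helt (@bhom k A))))).
Local Notation wA := (helt (@bhom k A)).
Local Notation aug := (aug_mor A : adga_mor A (k_hga k)).
Let rb : bilin (rprod phi) := rprod_bilin phi hA hA''.
Let mb : bilin (@hmu k A) := hmu_bilin hA.

Lemma rprod_aug_bilin : bilin (rprod aug).
Proof.
have mb' := mb; have E : rprod aug = @hmu k A by apply: funext => x; apply: funext => y; exact: rprod_aug.
by rewrite E.
Qed.
Let rbL : bilin (rprod aug) := rprod_aug_bilin.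

(** The accumulator of the recursion over arguments: what is still to be applied to a cut of the
    later arguments once the current one has been cut at [c]. *)
Definition cutG (N : lmodType k) (G : ML -> R -> N) (c : cut A A A'') : ML -> R -> N :=
  fun yl yr => G (Qm aug (cut_left (id_mor A) c) (Smap yl)) (rprod phi (cut_right c) yr).

Lemma cutG_bilin (N : lmodType k) (G : ML -> R -> N) c : bilin G -> bilin (cutG G c).
Proof.
move=> Gb; have qb := Qm_bilin rbL; have sl := @Smap_linear k A (k_hga k); rewrite /cutG.
split=> z; first exact: islin_comp (Gb.1 _) (islin_comp (qb.2 _) sl).
exact: islin_comp (Gb.2 _) (rb.2 _).
Qed.

(** A cut of x.S(y) is a cut of x together with a cut of S(y). In front of the first letter of S(y)
    the latter leaves y whole in the right part; otherwise it is a cut of y. *)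
Lemma Cm_Qm (N : lmodType k) (G : ML -> R -> N) n s y : bilin G ->
  Cm n G (Qm phi (bval s) (Smap y)) =
  \sum_(c <- cuts s) (sg (n * cut_ldeg c) *: G (cut_left (id_mor A) c) (rprod phi (cut_right c) (Smap y))
    + sg (n * cut_ldeg c + cut_rdeg c + n) *: Cm (n + cut_rdeg c) (cutG G c) y).
Proof.
move=> Gb; have cgb c := cutG_bilin c Gb; have qb := Qm_bilin rb; have sl := @Smap_linear k A A''.
pose L y := \sum_(c <- cuts s) (sg (n * cut_ldeg c) *: G (cut_left (id_mor A) c) (rprod phi (cut_right c) (Smap y))
    + sg (n * cut_ldeg c + cut_rdeg c + n) *: Cm (n + cut_rdeg c) (cutG G c) y).
have cl := Cm_linear n Gb.
suff E : (fun y => Cm n G (Qm phi (bval s) (Smap y))) = L by exact: (congr1 (@^~ y) E).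
apply: lin_bval_eq => [||[[b v] b'']]; [by lin| |].
  apply: (@islin_sum _ _ _ _ _ _ (fun c y => sg (n * cut_ldeg c) *: G (cut_left (id_mor A) c) (rprod phi (cut_right c) (Smap y))
    + sg (n * cut_ldeg c + cut_rdeg c + n) *: Cm (n + cut_rdeg c) (cutG G c) y)) => c.
  apply: islin_add; apply: islin_scale; first exact: islin_comp (Gb.2 _) (islin_comp (rb.2 _) sl).
  exact: Cm_linear.
rewrite /L {L}; case: s => [[a' w] a''].
have -> : bval (a', w, a'') = lact (hval a') (ract (W w) (hval a'') : R) by exact: bval_lact.
have -> : bval (b, v, b'') = lact (hval b) (ract (W v) (hval b'') : R) by exact: bval_lact.
set s' := ract (W v) (hval b''); set r := ract (W w) (hval a'').
have sE : Smap (lact (hval b) s' : M) = pre (red (hval b)) s' by exact: SmapE.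
rewrite sE; have -> : Qm phi (lact (hval a') r) (pre (red (hval b)) s') =
  lact (hval a') (rprod phi r (pre (red (hval b)) s')) by exact: QmE.
have gb : bilin (fun (s1 : BA A) s2 => G (lact (hval a') (bsg n s1)) s2).
  split=> z; last exact: Gb.2.
  exact: islin_comp (Gb.1 z) (islin_comp (@lact_linr _ _ _ _ _) (bsg_linear _)).
have gb2 p (c : seq wA) m : bilin (fun y1 r2 => G (lact (hval a') (bsg n (hmu (W c) (bsg m y1))))
     (rprod phi (ract (W p) (hval a'')) r2)).
  split=> z; last exact: islin_comp (Gb.2 _) (rb.2 _).
  exact: islin_comp (gb.1 _) (islin_comp (mb.2 _) (bsg_linear _)).
rewrite (Cm_lact n Gb a') (coR_mul phi hA hA'' w a'' _ gb) sum_cuts scaler_sumr.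
apply: eq_splits_pair => p pE; rewrite (coR_pre _ _ (gb2 _ _ _)) scalerDr; congr (_ + _).
  rewrite (bsg_word _ [::]) wdeg_nil mulr0 sg0 scale1r hmu_word1r //.
  rewrite bsg_word (linZ (@lact_linr _ _ _ _ _)) (linZ (Gb.1 _)) scalerA -sgD.
  rewrite /cut_left /cut_right push_word_id lactE ractE_word; congr (_ *: _); apply: par_eq.
  by rewrite /cut_ldeg /=; par_solve.
rewrite (Cm_lact _ (cgb _)).
have -> : s' = bt (1 : K) (hvals v) (hval b'') by rewrite ractE_word.
rewrite coRE; last first.
  have b2 := gb2 p.2 p.1 (wdeg p.2 + hdeg a''); split=> z; last exact: b2.2.
  exact: islin_comp (b2.1 z) (pre_linr _).
rewrite coRE; last first.
  have b2 := cgb ((a', p.1), (p.2, a'')); split=> z; last exact: b2.2.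
  exact: islin_comp (b2.1 z) (islin_comp (@lact_linr _ _ _ _ _) (bsg_linear _)).
rewrite !scaler_sumr; apply: eq_bigr => o _; rewrite /cutG.
pose b0 : wA := Helt (bhom_red (hvalP b)); set m := n + _.
have e1 : Smap (lact (hval b) (bsg m (W o.1)) : ML) = sg (m * wdeg o.1) *: W (b0 :: o.1).
  rewrite bsg_word SmapE.
  by rewrite (linZ (pre_linr _)) pre_word.
have e2 : cut_left (id_mor A) ((a', p.1), (p.2, a'')) = lact (hval a') (W p.1 : bmod K A (k_hga k)).
  by rewrite /cut_left push_word_id lactE.
rewrite e1 e2 (linZ ((Qm_bilin rbL).2 _)) (QmE rbL) rprod_aug //.
rewrite -[red _]/(hval b0) pre_word -[hval b0 :: hvals o.1]/(hvals (b0 :: o.1)).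
rewrite (bsg_word _ (b0 :: o.1)) (linZ (mb.2 _)) (linZ (bsg_linear n)) (hmu_bsg hA) !bsg_word.
rewrite (linZ (mb.1 _)) (linZ (mb.2 _)) !scalerA !(linZ (@lact_linr _ _ _ _ _)) !(linZ (Gb.1 _)) !scalerA -!sgD.
rewrite ractE_word; congr (_ *: _); last by rewrite /cut_right ractE_word.
apply: par_eq.
rewrite /m /cut_ldeg /cut_rdeg /= wdeg_cons -[hdeg b0]/(hdeg b); par_solve.
Qed.

(* Cutting h(s_1, ..., s_m) = +-s_1.S(h(s_2, ..., s_m)) inside s_1, or not inside s_1,
   leaves for some l cuts of s_1, ..., s_l and an uncut tail; [Tm] collects the
   terms in which all symbols are cut. *)
Fixpoint Tm (N : lmodType k) (ss : seq (bsym A A A'')) n (G : ML -> R -> N) : N :=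
  if ss is s :: ss' then \sum_(c <- cuts s) (if ss' is [::] then
      sg (n * cut_ldeg c) *: G (cut_left (id_mor A) c) (cut_right c)
    else sg (n * cut_ldeg c + cut_rdeg c + n + (size ss')%:Z * bdeg s) *: Tm ss' (n + cut_rdeg c) (cutG G c))
  else 0.

(* An empty tail contributes the unit of B(k, A, A''). *)
Definition Stail (ys : seq M) : R := if ys is [::] then bt (1 : K) [::] 1 else Smap (hn phi ys).

Lemma Tm_eq (N : lmodType k) ss n (G G' : ML -> R -> N) :
  (forall x y, G x y = G' x y) -> Tm ss n G = Tm ss n G'.
Proof.
by move=> E; congr (Tm _ _ _); apply: funext => x; apply: funext => y.
Qed.

Hypothesis hphi : is_hga_mor phi.

(** Iterates [Cm_Qm]. The index [l] is the position of the last symbol that is cut; what follows is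
    absorbed into the right part, regrouped by [rprodA]. *)
Lemma Cm_hn (N : lmodType k) ss n (G : ML -> R -> N) : bilin G -> (0 < size ss)%N ->
  Cm n G (hn phi (map (@bval k A A A'') ss)) = \sum_(0 <= l < size ss)
    sg ((size ss - l.+1)%N%:Z * \sum_(s <- take l.+1 ss) bdeg s) *:
      Tm (take l.+1 ss) n (fun yl yr => G yl (rprod phi yr (Stail (map (@bval k A A A'') (drop l.+1 ss))))).
Proof.
elim: ss n G => // s ss IH n G Gb _.
have [/size0nil ->|s0] := posnP (size ss).
  rewrite big_nat1 /= mul0r sg0 scale1r hn1 Cm_bval //; apply: eq_bigr => c _.
  by rewrite rprod1r.
rewrite [map _ _]/= hn_cons ?size_map // bsg_bval (linZ ((Qm_bilin rb).1 _)) (linZ (Cm_linear n Gb)) Cm_Qm //.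
rewrite big_split scalerDr [size (s :: ss)]/= big_nat_recl //; congr (_ + _).
  rewrite /= take0 drop0 big_seq1 subn1 /=; congr (_ *: _); apply: eq_bigr => c _.
  by case: (ss) s0.
under eq_bigr do rewrite (IH _ _ (cutG_bilin _ Gb) s0) scaler_sumr.
rewrite exchange_big /= scaler_sumr; apply: eq_big_nat => l /andP[_ ls].
rewrite [drop _ _]/= [take _ _]/= subSS big_cons scaler_sumr /= scaler_sumr.
apply: eq_bigr => c _.
case E : (take l.+1 ss) => [|t ts]; first by case: (ss) s0 E.
rewrite -E !scalerA -!sgD; congr (_ *: _).
  apply: par_eq; rewrite size_takel //.
  have -> : (size ss)%:Z = (size ss - l.+1)%N%:Z + l.+1%:Z by rewrite -PoszD subnK.
  by par_solve.
by apply: Tm_eq => x y; rewrite /cutG (rprodA hA hA'' hphi).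
Qed.
End CutQm.

Section AllCuts.
Variables (k : comNzRingType) (A' A A'' : hga_data k) (N : lmodType k).

Lemma eq_cuts (F G : cut A' A A'' -> N) s :
  (forall c, cut_ldeg c + cut_rdeg c = bdeg s -> F c = G c) ->
  \sum_(c <- cuts s) F c = \sum_(c <- cuts s) G c.
Proof.
move=> E; rewrite !sum_cuts; apply: eq_splits_pair => p pE; apply: E.
by rewrite /cut_ldeg /cut_rdeg /bdeg /= -pE -!addrA.
Qed.

Lemma sum_all_cuts_cons (F : seq (cut A' A A'') -> N) s ss :
  \sum_(cs <- all_cuts (s :: ss)) F cs = \sum_(c <- cuts s) \sum_(cs <- all_cuts ss) F (c :: cs).
Proof. by rewrite /= big_allpairs_dep. Qed.

Lemma eq_all_cuts (F G : seq (cut A' A A'') -> N) ss :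
  (forall cs, size cs = size ss -> F cs = G cs) ->
  \sum_(cs <- all_cuts ss) F cs = \sum_(cs <- all_cuts ss) G cs.
Proof.
elim: ss F G => [|s ss IH] F G E; first by rewrite !big_seq1 E.
rewrite !sum_all_cuts_cons; apply: eq_bigr => c _; apply: IH => cs cE; apply: E.
by rewrite /= cE.
Qed.
End AllCuts.

Section Link.
Variables (k : comNzRingType) (A A'' : hga_data k) (phi : adga_mor A A'').
Hypotheses (hA : is_hga A) (hA'' : is_hga A'') (hphi : is_hga_mor phi).
Local Notation K := (k_adga k).
Local Notation R := (bmod K A A'').
Local Notation M := (bmod A A A'').
Local Notation ML := (bmod A A (k_hga k)).
Local Notation W w := (word (hvals (w : seq (helt (@bhom k A))))).
Local Notation wA := (helt (@bhom k A)).
Local Notation aug := (aug_mor A : adga_mor A (k_hga k)).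
Let rbL : bilin (rprod aug) := rprod_aug_bilin hA.

Lemma rprods_cons y ys : (0 < size ys)%N -> rprods phi (y :: ys) = rprod phi y (rprods phi ys).
Proof.
case: ys => // z ys _ /=; elim: ys z => //= x ys IH z.
by rewrite -(rprodA hA hA'' hphi) IH.
Qed.

Lemma bsg_cut_left n (c : cut A A A'') :
  bsg n (cut_left (id_mor A) c) = sg (n * cut_ldeg c) *: cut_left (id_mor A) c.
Proof.
have := @bsg_bval k A A (k_hga k) n (c.1.1, c.1.2, kone k).
by rewrite /cut_left push_word_id /bval /bdeg /= addr0.
Qed.

(** Unfolding the accumulator: the nested actions on left parts assemble to [hn] by [hn_cons], the
    nested products of right parts to [rprods], and the growing [n] collects the crossing
    degrees. *)
Lemma Tm_all_cuts (N : lmodType k) ss n (G : ML -> R -> N) : bilin G -> (0 < size ss)%N ->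
  Tm phi ss n G = \sum_(cs <- all_cuts ss)
    sg (n * (\sum_(c <- cs) cut_ldeg c) + ((size ss)%:Z - 1) * n + cross_deg cs) *:
      G (hn aug (map (cut_left (id_mor A)) cs)) (rprods phi (map (@cut_right k A A A'') cs)).
Proof.
elim: ss n G => // s ss IH n G Gb _; rewrite sum_all_cuts_cons.
have [/size0nil ->|s0] := posnP (size ss).
  rewrite /=; apply: eq_bigr => c _; rewrite big_seq1 big_seq1 /= big_nil mulr0 subrr mul0r !addr0.
  by rewrite hn1.
have -> : Tm phi (s :: ss) n G = \sum_(c <- cuts s)
    sg (n * cut_ldeg c + cut_rdeg c + n + (size ss)%:Z * bdeg s) *: Tm phi ss (n + cut_rdeg c) (cutG phi G c).
  by apply: eq_bigr => c _; case: (ss) s0.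
apply: eq_cuts => c cE; rewrite (IH _ _ (cutG_bilin phi hA hA'' _ Gb) s0) scaler_sumr.
apply: eq_all_cuts => cs csE.
have c0 : (0 < size cs)%N by rewrite csE.
rewrite /cutG [map _ (c :: cs)]/= [map (@cut_right _ _ _ _) (c :: cs)]/= hn_cons ?size_map //.
rewrite rprods_cons ?size_map // bsg_cut_left (linZ ((Qm_bilin rbL).1 _)) (linZ (Gb.1 _)) !scalerA -!sgD.
congr (_ *: _); apply: par_eq; rewrite big_cons /= csE -cE intS; par_solve.
Qed.

Definition mtG (s : bsym A A A'') (p : seq wA * seq wA) : ML -> R -> M :=
  fun yl yr => lact (hval s.1.1 * hE (W p.1) (Smap yl)) (rprod phi (ract (W p.2) (hval s.2)) yr).

Lemma mtG_bilin s p : bilin (mtG s p).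
Proof. exact: mt2_bilin. Qed.

(** The left word of the first argument enters E directly, unlike those of the others. Its splits
    are therefore kept outside, and only the remaining arguments go through [Tm]. *)
Lemma mtilde_Tm s ss : (0 < size ss)%N -> mtilde_sym (id_mor A) phi (s :: ss) =
  sg (((size ss)%:Z - 1) * bdeg s) *: \sum_(p <- splits s.1.2)
    sg (wdeg p.1) *: Tm phi ss (wdeg p.2 + hdeg s.2) (mtG s p).
Proof.
move=> s0; rewrite /mtilde_sym sum_all_cuts_cons sum_cuts scaler_sumr.
apply: eq_splits_pair => p pE; rewrite Tm_all_cuts //; last exact: mtG_bilin.
rewrite !scaler_sumr; apply: eq_all_cuts => cs csE.
have c0 : (0 < size cs)%N by rewrite csE.
rewrite [map (@cut_right _ _ _ _) (_ :: cs)]/= rprods_cons ?size_map //.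
rewrite /mtG !scalerA -!sgD push_word_id /cut_right -ractE_word.
congr (_ *: _); apply: par_eq; rewrite /= csE /bdeg -pE /cut_ldeg /cut_rdeg /= intS; par_solve.
Qed.
End Link.

(** * Multilinearity of m_n *)

Lemma elin_dep (k : comNzRingType) (V N : lmodType k) (H : int -> V -> Prop) (F : int -> helt H -> N) :
  (forall m, elin (F m)) -> elin (fun h => F (hdeg h) h).
Proof. by move=> Fl c h h1 h2 d1 d2 hh; rewrite d1 d2; exact: Fl. Qed.

Lemma wlin_dep (k : comNzRingType) (A : adga k) (N : lmodType k) (F : int -> seq (helt (@bhom k A)) -> N) :
  (forall m, wlin (F m)) -> wlin (fun w => F (wdeg w) w).
Proof.
move=> Fl u v c h h1 h2 d1 d2 hh; have E x : hdeg x = hdeg h -> wdeg (u ++ x :: v) = wdeg (u ++ h :: v).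
  by move=> xh; rewrite !wdeg_cat !wdeg_cons xh.
by rewrite (E _ d1) (E _ d2); exact: Fl.
Qed.

Section SlinSplits.
Variables (k : comNzRingType) (A' A A'' : adga k) (N : lmodType k).
Local Notation W w := (word (hvals (w : seq (helt (@bhom k A))))).
Variable F : int -> int -> int -> int -> A' -> BA A -> BA A -> A'' -> N.
Hypotheses (F1 : forall m1 m2 m3 m4 x y a'', linear (fun a' => F m1 m2 m3 m4 a' x y a''))
  (F2 : forall m1 m2 m3 m4 a' y a'', linear (fun x => F m1 m2 m3 m4 a' x y a''))
  (F3 : forall m1 m2 m3 m4 a' x a'', linear (fun y => F m1 m2 m3 m4 a' x y a''))
  (F4 : forall m1 m2 m3 m4 a' x y, linear (F m1 m2 m3 m4 a' x y)).

(** The degrees are separate arguments of [F], so that linearity is checked with the degrees held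
    fixed and arbitrary signs are allowed. *)
Lemma slin_splits : slin (fun s : bsym A' A A'' => \sum_(p <- splits s.1.2)
  F (hdeg s.1.1) (wdeg p.1) (wdeg p.2) (hdeg s.2) (hval s.1.1) (W p.1) (W p.2) (hval s.2)).
Proof.
split=> [w a''|a' a''|a' w] /=.
- apply: elin_sum => p.
  apply: (elin_dep (F := fun m h => F m _ _ _ (hval h) _ _ _)) => m.
  exact: (elin_hval (L := fun x => F _ _ _ _ x _ _ _)).
- apply: (wlin_splits (G := fun u v => F _ (wdeg u) (wdeg v) _ _ (W u) (W v) _)) => v.
    apply: (wlin_dep (F := fun m u => F _ m _ _ _ (W u) _ _)) => m.
    exact: (bt_wlin (L := fun x => F _ _ _ _ _ x _ _)).
  apply: (wlin_dep (F := fun m u => F _ _ m _ _ _ (W u) _)) => m.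
  exact: (bt_wlin (L := fun x => F _ _ _ _ _ _ x _)).
- apply: elin_sum => p.
  apply: (elin_dep (F := fun m h => F _ _ _ m _ _ _ (hval h))) => m.
  exact: elin_hval.
Qed.
End SlinSplits.

Lemma slin_scale (k : comNzRingType) (A' A A'' : adga k) (N : lmodType k) (c : k) (F : bsym A' A A'' -> N) :
  slin F -> slin (fun s => c *: F s).
Proof. by apply: (slin_comp (L := fun x => c *: x)); apply: islin_scale; exact: islin_id. Qed.

Section TmLin.
Variables (k : comNzRingType) (A A'' : hga_data k) (phi : adga_mor A A'').
Hypotheses (hA : is_hga A) (hA'' : is_hga A'') (hphi : is_hga_mor phi).
Local Notation K := (k_adga k).
Local Notation R := (bmod K A A'').
Local Notation M := (bmod A A A'').
Local Notation ML := (bmod A A (k_hga k)).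
Local Notation W w := (word (hvals (w : seq (helt (@bhom k A))))).
Local Notation wA := (helt (@bhom k A)).
Local Notation aug := (aug_mor A : adga_mor A (k_hga k)).
Let rb : bilin (rprod phi) := rprod_bilin phi hA hA''.
Let rbL : bilin (rprod aug) := rprod_aug_bilin hA.

Lemma Tm_lin (V N : lmodType k) (G : V -> ML -> R -> N) ss n :
  (forall x y, linear (fun v => G v x y)) -> linear (fun v => Tm phi ss n (G v)).
Proof.
elim: ss n G => [|s ss IH] n G Gl; first exact: islin_zero.
apply: (@islin_sum _ _ _ _ _ _ (fun c v => if ss is [::] then
      sg (n * cut_ldeg c) *: G v (cut_left (id_mor A) c) (cut_right c)
    else sg (n * cut_ldeg c + cut_rdeg c + n + (size ss)%:Z * bdeg s) *: Tm phi ss (n + cut_rdeg c) (cutG phi (G v) c))) => c.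
case: (ss) IH => [|t ts] IH; apply: islin_scale; first exact: Gl.
by apply: (IH _ (fun v => cutG phi (G v) c)) => x y; exact: Gl.
Qed.

Lemma cut_left_lact (s : bsym A A A'') (p : seq wA * seq wA) :
  cut_left (id_mor A) ((s.1.1, p.1), (p.2, s.2)) = lact (hval s.1.1) (W p.1 : bmod K A (k_hga k)).
Proof. by rewrite /cut_left push_word_id lactE. Qed.

Lemma cut_right_ract (s : bsym A A A'') (p : seq wA * seq wA) :
  cut_right ((s.1.1, p.1), (p.2, s.2)) = ract (W p.2) (hval s.2).
Proof. by rewrite /cut_right ractE_word. Qed.

(** Sign and accumulator depend on the first symbol through the degrees of its four pieces and
    linearly through the pieces themselves; this is the shape required by [slin_splits]. *)
Lemma Tm_slin0 (N : lmodType k) (G : ML -> R -> N) r n : bilin G ->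
  slin (fun s : bsym A A A'' => Tm phi (s :: r) n G).
Proof.
move=> Gb; have Gr := Gb.2.
pose H m1 m2 m3 m4 a' (x : BA A) (y : BA A) (a'' : A'') : N := if r is [::] then
      sg (n * (m1 + m2)) *: G (lact a' x) (ract y a'')
    else sg (n * (m1 + m2) + (m3 + m4) + n + (size r)%:Z * (m1 + m2 + (m3 + m4))) *:
      Tm phi r (n + (m3 + m4)) (fun yl yr => G (Qm aug (lact a' x) (Smap yl)) (rprod phi (ract y a'') yr)).
have -> : (fun s : bsym A A A'' => Tm phi (s :: r) n G) = fun s => \sum_(p <- splits s.1.2)
  H (hdeg s.1.1) (wdeg p.1) (wdeg p.2) (hdeg s.2) (hval s.1.1) (W p.1) (W p.2) (hval s.2).
  apply: funext => s; rewrite /= sum_cuts; apply: eq_splits_pair => p pE.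
  rewrite /H /cutG cut_left_lact cut_right_ract /cut_ldeg /cut_rdeg /=.
  case: (r) => [|t ts] //; congr (sg _ *: _).
  by rewrite /bdeg -pE -!addrA.
have Gl x := Gb.1 x; have ql := (Qm_bilin rbL).1; have rl := rb.1.
have ll x := @lact_linl k A A (k_hga k) x; have lr x := @lact_linr k A A (k_hga k) x.
apply: slin_splits => m1 m2 m3 m4 z z' z''; rewrite /H; case: (r) => [|t ts]; apply: islin_scale.
- exact: islin_comp (Gl _) (ll _).
- apply: (Tm_lin (G := fun a' yl yr => G (Qm aug (lact a' z) (Smap yl)) (rprod phi (ract z' z'') yr))) => yl yr.
  exact: islin_comp (Gl _) (islin_comp (ql _) (ll _)).
- exact: islin_comp (Gl _) (lr _).
- apply: (Tm_lin (G := fun x yl yr => G (Qm aug (lact z x) (Smap yl)) (rprod phi (ract z' z'') yr))) => yl yr.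
  exact: islin_comp (Gl _) (islin_comp (ql _) (lr _)).
- exact: islin_comp (Gr _) (ract_linl _).
- apply: (Tm_lin (G := fun y yl yr => G (Qm aug (lact z z') (Smap yl)) (rprod phi (ract y z'') yr))) => yl yr.
  exact: islin_comp (Gr _) (islin_comp (rl _) (ract_linl _)).
- exact: islin_comp (Gr _) (ract_linr _).
- apply: (Tm_lin (G := fun a yl yr => G (Qm aug (lact z z') (Smap yl)) (rprod phi (ract z'' a) yr))) => yl yr.
  exact: islin_comp (Gr _) (islin_comp (rl _) (ract_linr _)).
Qed.

Lemma Tm_slin (N : lmodType k) (G : ML -> R -> N) l r n : bilin G ->
  slin (fun s : bsym A A A'' => Tm phi (l ++ s :: r) n G).
Proof.
elim: l n G => [|t l IH] n G Gb; first exact: Tm_slin0.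
have -> : (fun s : bsym A A A'' => Tm phi ((t :: l) ++ s :: r) n G) = fun s => \sum_(c <- cuts t)
  sg (n * cut_ldeg c + cut_rdeg c + n + (size l + size r).+1%:Z * bdeg t) *:
     Tm phi (l ++ s :: r) (n + cut_rdeg c) (cutG phi G c).
  apply: funext => s; apply: eq_bigr => c _; rewrite size_cat addnS.
  by case: (l).
apply: slin_sum => c; apply: slin_scale; apply: IH; exact: cutG_bilin.
Qed.

Lemma mtG_split_linear (p : BA A * BA A) x (r : R) a (c : A'') :
  [/\ linear (fun a : A => lact (a * hE p.1 x) (rprod phi (ract p.2 c) r) : M),
      linear (fun z : BA A => lact (a * hE z x) (rprod phi (ract p.2 c) r) : M),
      linear (fun z : BA A => lact (a * hE p.1 x) (rprod phi (ract z c) r) : M)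
    & linear (fun c => lact (a * hE p.1 x) (rprod phi (ract p.2 c) r) : M)].
Proof. by have eb := hE_bilin hA; split; lin. Qed.

Lemma E0_bval (s t : bsym A A A'') : Qm phi (bval s) (E0 (bval t)) =
  lact ((aeps A (hval t.1.1) : k) *: hval s.1.1)
       (rprod phi (bt (1 : K) (hvals s.1.2) (hval s.2)) (bt (1 : K) (hvals t.1.2) (hval t.2))).
Proof.
case: s t => [[a' w] a''] [[b v] b'']; rewrite /bval.
have -> : bt (hval b) (map (@hval _ _) v) (hval b'') = lact (hval b) (bt (1 : K) (hvals v) (hval b'')) :> M by rewrite lactE.
have -> : bt (hval a') (map (@hval _ _) w) (hval a'') = lact (hval a') (bt (1 : K) (hvals w) (hval a'')) :> M by rewrite lactE.
by rewrite E0_lact QmE // (linZ (rb.2 _)) (linZ (@lact_linr _ _ _ _ _)) (linZ (lact_linl _)).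
Qed.

Lemma m_symE s ss : (0 < size ss)%N -> m_sym (id_mor A) phi (s :: ss) = mtilde_sym (id_mor A) phi (s :: ss) +
  (if ss is [:: t] then Qm phi (bval s) (E0 (bval t)) else 0).
Proof.
case: ss => // t [|u ss] _; rewrite /m_sym; congr (_ + _); last by case: s t => [[? ?] ?] [[? ?] ?].
by rewrite E0_bval; case: s t => [[? ?] ?] [[? ?] ?].
Qed.

(** [m_sym_slin] ranges over lists of every length. For a single argument [hn] is applied to the
    empty list and returns the default value 0 of [nth]. *)
Lemma m_sym1 s : m_sym (id_mor A) phi [:: s] = 0.
Proof.
have eb := hE_bilin hA; rewrite /m_sym /mtilde_sym; case: s => [[a' w] a'']; rewrite addr0 sum_all_cuts_cons.
rewrite big1 // => c _; rewrite big_seq1 [map _ [::]]/= /hn /=.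
rewrite (lin0 (@Smap_linear k A (k_hga k))) (lin0 (eb.2 _)) mulr0 (lin0 (lact_linl _)) scaler0 //.
Qed.

Lemma mtilde_slin l r : (0 < size l + size r)%N ->
  slin (fun s => mtilde_sym (id_mor A) phi (l ++ s :: r)).
Proof.
case: l => [|t l] s0.
  pose H m1 m2 m3 m4 a' (x : BA A) (y : BA A) (a'' : A'') : M :=
    sg (((size r)%:Z - 1) * (m1 + m2 + (m3 + m4)) + m2) *:
      Tm phi r (m3 + m4) (fun yl yr => lact (a' * hE x (Smap yl)) (rprod phi (ract y a'') yr)).
  have -> : (fun s : bsym A A A'' => mtilde_sym (id_mor A) phi ([::] ++ s :: r)) = fun s => \sum_(p <- splits s.1.2)
      H (hdeg s.1.1) (wdeg p.1) (wdeg p.2) (hdeg s.2) (hval s.1.1) (W p.1) (W p.2) (hval s.2).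
    apply: funext => s; rewrite /= mtilde_Tm // scaler_sumr; apply: eq_splits_pair => p pE.
    by rewrite scalerA -sgD /H; congr (sg (_ * _ + _) *: _); rewrite /bdeg -pE -!addrA.
  apply: slin_splits => m1 m2 m3 m4 z z' z''; rewrite /H; apply: islin_scale.
  - apply: (Tm_lin (G := fun a yl yr => lact (a * hE z (Smap yl)) (rprod phi (ract z' z'') yr) : M)) => yl yr.
    by have [] := mtG_split_linear (z, z') (Smap yl) yr 0 z''.
  - apply: (Tm_lin (G := fun x yl yr => lact (z * hE x (Smap yl)) (rprod phi (ract z' z'') yr) : M)) => yl yr.
    by have [] := mtG_split_linear (0, z') (Smap yl) yr z z''.
  - apply: (Tm_lin (G := fun y yl yr => lact (z * hE z' (Smap yl)) (rprod phi (ract y z'') yr) : M)) => yl yr.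
    by have [] := mtG_split_linear (z', 0) (Smap yl) yr z z''.
  - apply: (Tm_lin (G := fun a yl yr => lact (z * hE z' (Smap yl)) (rprod phi (ract z'' a) yr) : M)) => yl yr.
    by have [] := mtG_split_linear (z', z'') (Smap yl) yr z 0.
have -> : (fun s => mtilde_sym (id_mor A) phi ((t :: l) ++ s :: r)) = fun s =>
    sg (((size l + size r).+1%:Z - 1) * bdeg t) *: \sum_(p <- splits t.1.2)
    sg (wdeg p.1) *: Tm phi (l ++ s :: r) (wdeg p.2 + hdeg t.2) (mtG phi t p).
  by apply: funext => s; rewrite /= mtilde_Tm // size_cat addnS.
apply: slin_scale; apply: slin_sum => p; apply: slin_scale; apply: Tm_slin; exact: mtG_bilin.
Qed.

(** This justifies the definition of [mn] through [mlift]: the extension is multilinear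
    ([mn_multilinear]) and has the value [m_sym] on symbols ([mn_bval]). *)
Lemma m_sym_slin l r : slin (fun s => m_sym (id_mor A) phi (l ++ s :: r)).
Proof.
have qb := Qm_bilin rb; have el := @E0_linear k A A''.
have z0 : slin (fun _ : bsym A A A'' => 0 : M).
  by split=> *; [exact: elin0F|exact: wlin0|exact: elin0F].
have [s0|] := posnP (size l + size r).
  case: l r s0 => [|? ?] [|? ?] //= _.
  by rewrite (_ : (fun s => _) = fun _ => 0) //; apply: funext => s; exact: m_sym1.
move=> s0; have := mtilde_slin s0.
case: l s0 => [|t l] s0 ms.
  rewrite (_ : (fun s => _) = fun s => mtilde_sym (id_mor A) phi (s :: r) +
    (if r is [:: t] then Qm phi (bval s) (E0 (bval t)) else 0)); last first.
    by apply: funext => s; rewrite /= m_symE.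
  apply: slin_add => //; case: (r) => [|t [|u r']] //.
  exact: slin_comp (qb.1 _) (@bval_slin k A A A'').
rewrite (_ : (fun s => _) = fun s => mtilde_sym (id_mor A) phi ((t :: l) ++ s :: r) +
    (if l ++ s :: r is [:: u] then Qm phi (bval t) (E0 (bval u)) else 0)); last first.
  by apply: funext => s; rewrite /= m_symE // size_cat addnS.
apply: slin_add => //; case: (l) => [|u [|v l']] //; case: (r) => [|u' r'] //.
exact: slin_comp (islin_comp (qb.2 _) el) (@bval_slin k A A A'').
Qed.
End TmLin.

Section Mlift.
Variables (k : comNzRingType) (A' A A'' : adga k) (N : lmodType k).
Local Notation S := (bsym A' A A'').
Implicit Type F : seq S -> N.

Lemma mlift_slin (F : S -> seq S -> N) xs : (forall ss, slin (F^~ ss)) -> slin (fun s => mlift (F s) xs).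
Proof.
elim: xs F => [|x xs IH] F Fs; first exact: Fs.
apply: slin_sum => p; apply: slin_scale.
by apply: (IH (fun s ss => F s (p.2 :: ss))) => ss; exact: Fs.
Qed.

Lemma mlift_bval F ss : (forall l r, slin (fun s => F (l ++ s :: r))) -> mlift F (map (@bval k A' A A'') ss) = F ss.
Proof.
elim: ss F => // s ss IH F Fs /=; rewrite hliftE; last first.
  by apply: (mlift_slin (F := fun s ss => F (s :: ss))) => r; exact: (Fs [::]).
by apply: (IH (fun ss => F (s :: ss))) => l r; exact: (Fs (s :: l)).
Qed.

Lemma mlift_multilinear F : (forall l r, slin (fun s => F (l ++ s :: r))) -> multilinear (mlift F).
Proof.
move=> Fs l r; elim: l F Fs => [|y l IH] F Fs /=.
  apply: hlift_linear; apply: (mlift_slin (F := fun s ss => F (s :: ss))) => ss; exact: (Fs [::]).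
apply: (@islin_sum _ _ _ _ _ _ (fun p x => p.1 *: mlift (fun ss => F (p.2 :: ss)) (l ++ x :: r))) => p.
by apply: islin_scale; apply: IH => l' r'; exact: (Fs (p.2 :: l')).
Qed.
End Mlift.

(** * Degrees of S, h_n and m_n *)

Lemma lact_hom (k : comNzRingType) (A A'' : adga k) m n (a : A) (r : bmod (k_adga k) A A'') :
  ahom m a -> bar_hom n r -> bar_hom (m + n) (lact a r : bmod A A A'').
Proof.
move=> ha hr; rewrite addrC; apply: (bar_hom_linear (@lact_linr _ _ _ _ a) _ hr) => -[[c w] a''].
have := bar_hom_bt w (gradZ (ahom_grading A) (hval c : k) ha) (hvalP a'').
rewrite /bval /= bt1 (linZ (@lact_linr _ _ _ _ _)) lactE (linZ (bt_linl _ _)) /bdeg /=.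
case: (khom_unit c) => ->; first by rewrite scale0r => _; exact: bar_hom0.
by congr (bar_hom _ _); lia.
Qed.

Lemma Smap_hom (k : comNzRingType) (A A'' : hga_data k) n (x : bmod A A A'') :
  bar_hom n x -> bar_hom (n - 1) (Smap x).
Proof.
move=> hx; apply: (bar_hom_linear (@Smap_linear _ _ _) _ hx) => -[[a' w] a''].
rewrite bval_lact SmapE -ractE_word preE.
have := bar_hom_bt (Helt (bhom_red (hvalP a')) :: w) (@ahom1 k (k_adga k)) (hvalP a'').
by rewrite wdeg_cons /bdeg /=; congr (bar_hom _ _); lia.
Qed.

(** The product is kept abstract because the lemma serves both [phi] and, for the left parts of
    cuts, the augmentation. *)
Lemma Qm_hom (k : comNzRingType) (A A'' : hga_data k) (phi : adga_mor A A'') m n x r :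
  bilin (rprod phi) -> (forall m n x y, bar_hom m x -> bar_hom n y -> bar_hom (m + n) (rprod phi x y)) ->
  bar_hom m x -> bar_hom n r -> bar_hom (m + n) (Qm phi x r).
Proof.
move=> rb rh hx hr; apply: (bar_hom_linear ((Qm_bilin rb).1 r) _ hx) => -[[a' w] a''].
rewrite bval_lact QmE //.
have := lact_hom (hvalP a') (rh _ _ _ _ (ract_hom (bar_hom_word w) (hvalP a'')) hr).
by rewrite /bdeg -!addrA.
Qed.

Lemma hn_hom (k : comNzRingType) (A A'' : hga_data k) (phi : adga_mor A A'') (xs : seq (helt (@bar_hom k A A A''))) :
  bilin (rprod phi) -> (forall m n x y, bar_hom m x -> bar_hom n y -> bar_hom (m + n) (rprod phi x y)) ->
  (0 < size xs)%N -> bar_hom (hdegs xs + 1 - (size xs)%:Z) (hn phi (hvals xs)).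
Proof.
move=> rb rh; elim: xs => // x xs IH _; have [/size0nil ->|s0] := posnP (size xs).
  rewrite hn1 /hdegs big_seq1 /= addrK; exact: hvalP.
rewrite /= hn_cons ?size_map // /hdegs big_cons.
have := Qm_hom rb rh (hvalP x) (Smap_hom (IH s0)).
have -> : hdeg x + \sum_(j <- xs) hdeg j + 1 - (size xs).+1%:Z =
   hdeg x + (hdegs xs + 1 - (size xs)%:Z - 1) by rewrite /hdegs intS; lia.
rewrite /bsg; case: par => //.
by rewrite (bsign_hom (hvalP x)) (linZ ((Qm_bilin rb).1 _)); exact: bar_homZ.
Qed.

Section Homs2.
Variables (k : comNzRingType) (A A'' : hga_data k) (phi : adga_mor A A'').
Hypotheses (hA : is_hga A) (hA'' : is_hga A'') (hphi : is_hga_mor phi).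
Local Notation K := (k_adga k).
Local Notation R := (bmod K A A'').
Local Notation M := (bmod A A A'').
Local Notation ML := (bmod A A (k_hga k)).
Local Notation aug := (aug_mor A : adga_mor A (k_hga k)).
Let rb : bilin (rprod phi) := rprod_bilin phi hA hA''.
Let rbL : bilin (rprod aug) := rprod_aug_bilin hA.
Let rh := rprod_hom phi hA hA''.

Lemma rprod_aug_hom m n x y : bar_hom m x -> bar_hom n y -> bar_hom (m + n) (rprod aug x y).
Proof. by move=> hx hy; rewrite rprod_aug //; exact: (hmu_hom hA hx hy). Qed.

Lemma f1_hom n x : bar_hom n x -> ahom n (f1 phi x).
Proof.
move=> hx; apply: (bar_hom_ind (P := fun x => ahom n (f1 phi x)) hx) => [|c y z hy hz|[[a' w] a''] <-].
- by rewrite (lin0 (f1_linear phi)); exact: grad0 (ahom_grading A'') _.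
- by rewrite (f1_linear phi c); exact: gradZD (ahom_grading A'') _ _ _ _ hy hz.
rewrite /bval f1_bt /bdeg /=; case: w => [|b w] /=; last exact: grad0 (ahom_grading A'') _.
by rewrite wdeg_nil addr0; apply: ahomM; [apply: amor_hom|]; exact: hvalP.
Qed.

(** Here [q] is the degree of [G]. Cutting [s] changes it into [bdeg s - 1 + q], as [cutG]
    multiplies by both parts of [s] and applies S, of degree -1. *)
Lemma Tm_hom (G : ML -> R -> M) q ss n : (0 < size ss)%N ->
  (forall m m' x y, bar_hom m x -> bar_hom m' y -> bar_hom (m + m' + q) (G x y)) ->
  bar_hom (\sum_(s <- ss) bdeg s + q + 1 - (size ss)%:Z) (Tm phi ss n G).
Proof.
elim: ss n q G => // s ss IH n q G _ hG; rewrite big_cons.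
pose T c : M := if ss is [::] then
      sg (n * cut_ldeg c) *: G (cut_left (id_mor A) c) (cut_right c)
    else sg (n * cut_ldeg c + cut_rdeg c + n + (size ss)%:Z * bdeg s) *: Tm phi ss (n + cut_rdeg c) (cutG phi G c).
rewrite -[Tm _ _ _ _]/(\sum_(c <- cuts s) T c) sum_cuts.
have sp := splits_wdeg s.1.2; elim: (splits s.1.2) sp => [|p ps IHp] /=; first by rewrite big_nil => _; exact: bar_hom0.
move=> /andP[/eqP pE /IHp hps]; rewrite big_cons; apply: bar_homD => // {IHp hps}; rewrite /T.
set c := (s.1.1, p.1, (p.2, s.2)).
have cE : bdeg s = cut_ldeg c + cut_rdeg c by rewrite /bdeg /cut_ldeg /cut_rdeg /= -pE -!addrA.
have hl : bar_hom (cut_ldeg c) (cut_left (id_mor A) c).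
  rewrite cut_left_lact; exact: lact_hom (hvalP s.1.1) (bar_hom_word p.1).
have hr : bar_hom (cut_rdeg c) (@cut_right k A A A'' c).
  rewrite cut_right_ract; exact: ract_hom (bar_hom_word p.2) (hvalP s.2).
have [/size0nil E|s0] := posnP (size ss).
  rewrite E big_nil /= addr0 addrK; apply: bar_homZ; rewrite cE; exact: hG.
have IH' : bar_hom (\sum_(j <- ss) bdeg j + (bdeg s - 1 + q) + 1 - (size ss)%:Z)
    (Tm phi ss (n + cut_rdeg c) (cutG phi G c)).
  apply: IH => // m m' x y hx hy.
  have := hG _ _ _ _ (Qm_hom rbL rprod_aug_hom hl (Smap_hom hx)) (rh hr hy).
  by rewrite cE; congr (bar_hom _ _); lia.
have -> : bdeg s + \sum_(j <- ss) bdeg j + q + 1 - (size (s :: ss))%:Z =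
   \sum_(j <- ss) bdeg j + (bdeg s - 1 + q) + 1 - (size ss)%:Z by rewrite /= intS; lia.
by case: (ss) s0 IH' => // t ts _; exact: bar_homZ.
Qed.

Lemma m_sym_hom s ss : (0 < size ss)%N ->
  bar_hom (\sum_(t <- s :: ss) bdeg t + 1 - (size ss)%:Z) (m_sym (id_mor A) phi (s :: ss)).
Proof.
move=> s0; rewrite m_symE //; apply: bar_homD.
  rewrite mtilde_Tm //; apply: bar_homZ.
  have sp := splits_wdeg s.1.2; elim: (splits s.1.2) sp => [|p ps IHp] /=.
    by rewrite [X in bar_hom _ X]big_nil => _; exact: bar_hom0.
  move=> /andP[/eqP pE /IHp hps]; rewrite [X in bar_hom _ X]big_cons; apply: bar_homD => //; apply: bar_homZ.
  rewrite big_cons (addrC (bdeg s)); apply: Tm_hom => // m m' x y hx hy.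
  have := lact_hom (ahomM (hvalP s.1.1) (hE_hom hA (bar_hom_word p.1) (Smap_hom hx)))
     (rh (ract_hom (bar_hom_word p.2) (hvalP s.2)) hy).
  by rewrite /bdeg -pE; congr (bar_hom _ _); lia.
case: ss s0 => // t [|u ss] _; last exact: bar_hom0.
rewrite !big_cons big_nil addr0 addrK; apply: (Qm_hom rb rh (bar_hom_bval s)).
rewrite -[bdeg t]addr0; apply: (bar_hom_linear (@E0_linear k A A'') _ (bar_hom_bval t)) => -[[a' w] a''].
rewrite bval_lact E0_lact /bdeg addr0 /=.
have [->|n0] := eqVneq (hdeg a') 0; last by rewrite (aeps_hom (hvalP a') n0) scale0r; exact: bar_hom0.
apply: bar_homZ; rewrite add0r; exact: ract_hom (bar_hom_word w) (hvalP a'').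
Qed.
End Homs2.

(** * The differential of h_n *)

Section HnDiff.
Variables (k : comNzRingType) (A A'' : hga_data k) (phi : adga_mor A A'').
Hypotheses (hA : is_hga A) (hA'' : is_hga A'') (hphi : is_hga_mor phi).
Local Notation K := (k_adga k).
Local Notation R := (bmod K A A'').
Local Notation M := (bmod A A A'').
Local Notation ML := (bmod A A (k_hga k)).
Local Notation dM := (bar_diff (id_mor A) phi).
Local Notation V ss := (map (@bval k A A A'') ss).
Let rb : bilin (rprod phi) := rprod_bilin phi hA hA''.
Let qb : bilin (Qm phi) := Qm_bilin rb.
Let sl := @Smap_linear k A A''.
Implicit Types (s : bsym A A A'') (ss : seq (bsym A A A'')).

Lemma Tm_comp (N P : lmodType k) (L : N -> P) (G : ML -> R -> N) ss n : linear L ->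
  Tm phi ss n (fun x y => L (G x y)) = L (Tm phi ss n G).
Proof.
move=> Ll; elim: ss n G => [|s ss IH] n G /=; first by rewrite (lin0 Ll).
rewrite (lin_sum Ll); apply: eq_bigr => c _.
case: (ss) IH => [|t ts] IH; rewrite (linZ Ll) //; congr (_ *: _).
exact: (IH _ (cutG phi G c)).
Qed.

(** [Cm_hn] yields, for each [l], all cuts of the first l+1 arguments times an uncut tail. [Tm_comp]
    moves the action of the tail outside, and what stays inside is the operation of [mtilde_sym]. *)
Lemma mt2_hn s ss : (0 < size ss)%N -> mt2 phi s (hn phi (V ss)) =
  \sum_(0 <= l < size ss) sg ((size ss - l.+1)%N%:Z * (\sum_(t <- take l.+1 ss) bdeg t) + l%:Z * bdeg s) *:
    Qm phi (mtilde_sym (id_mor A) phi (s :: take l.+1 ss)) (Stail phi (V (drop l.+1 ss))).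
Proof.
move=> s0; have -> : mt2 phi s (hn phi (V ss)) = \sum_(p <- splits s.1.2)
    sg (wdeg p.1) *: Cm (wdeg p.2 + hdeg s.2) (mtG phi s p) (hn phi (V ss)) by case: s => [[]].
under eq_bigr do rewrite (Cm_hn hA hA'' hphi _ (mtG_bilin phi hA hA'' s _) s0) scaler_sumr.
rewrite exchange_big; apply: eq_big_nat => l /andP[_ ls]; set t := Stail _ _.
rewrite mtilde_Tm //; last by rewrite size_takel.
rewrite (linZ (qb.1 t)) (lin_sum (qb.1 t)) !scaler_sumr; apply: eq_bigr => p _.
rewrite (linZ (qb.1 t)) !scalerA size_takel // -(Tm_comp (L := fun x => Qm phi x t)); last exact: qb.1.
rewrite (@Tm_eq _ _ _ _ _ _ _ _ (fun x y => Qm phi (mtG phi s p x y) t)); last first.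
  by move=> x y; rewrite /mtG QmE // (rprodA hA hA'' hphi).
by rewrite -!sgD; congr (_ *: _); apply: par_eq; rewrite intS; par_solve.
Qed.

Lemma E0_Qm x r : E0 (Qm phi x r) = rprod phi (E0 x) r.
Proof.
have el := @E0_linear k A A''.
suff E : (fun x => E0 (Qm phi x r)) = fun x => rprod phi (E0 x) r by exact: (congr1 (@^~ x) E).
apply: lin_bval_eq => [||[[a' w] a'']]; [by lin|by lin|].
by rewrite bval_lact QmE // !E0_lact (linZ (rb.1 _)).
Qed.

Lemma Qm1 x : Qm phi x (bt (1 : K) [::] 1) = x.
Proof.
suff E : (fun x => Qm phi x (bt (1 : K) [::] 1)) = id by exact: (congr1 (@^~ x) E).
apply: lin_bval_eq => [||[[a' w] a'']]; [by lin|exact: islin_id|].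
by rewrite bval_lact QmE // rprod1r.
Qed.

(** The convention that the empty tail is the unit lets one formula cover h_1 and the higher h_n. *)
Lemma Qm_Stail n x ys : bar_hom n x -> Qm phi x (Stail phi ys) = sg ((size ys)%:Z * n) *: hn phi (x :: ys).
Proof.
move=> hx; case: ys => [|y ys]; first by rewrite Qm1 mul0r sg0 scale1r hn1.
rewrite hn_cons // /Stail /bsg sgE parM; move: (par _) => b.
by case: b => //=; rewrite ?expr0 ?scale1r // (bsign_hom hx) (linZ (qb.1 _)) sgE -sgE sgZK.
Qed.

Lemma E0_hn s t ss : Qm phi (bval s) (E0 (hn phi (V (t :: ss)))) =
  sg ((size ss)%:Z * bdeg t) *: Qm phi (Qm phi (bval s) (E0 (bval t))) (Stail phi (V ss)).
Proof.
have el := @E0_linear k A A''.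
have E : sg ((size ss)%:Z * bdeg t) *: Qm phi (bval t) (Stail phi (V ss)) = hn phi (V (t :: ss)).
  by rewrite (Qm_Stail _ (bar_hom_bval t)) size_map sgZK.
by rewrite -E (linZ el) (linZ (qb.2 _)) E0_Qm (Qm_Qm hA hA'' hphi).
Qed.

(** The [E0] term supplies the second summand of m_2, so it joins the summand [l = 0] only; the
    other m_l have no second summand. *)
Lemma mt2_E0_hn s ss : (0 < size ss)%N -> mt2 phi s (hn phi (V ss)) + Qm phi (bval s) (E0 (hn phi (V ss))) =
  \sum_(0 <= l < size ss) sg ((size ss - l.+1)%N%:Z * (bdeg s - l%:Z) + l%:Z * bdeg s) *:
    hn phi (m_sym (id_mor A) phi (s :: take l.+1 ss) :: V (drop l.+1 ss)).
Proof.
move=> s0; transitivity (\sum_(0 <= l < size ss)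
  sg ((size ss - l.+1)%N%:Z * (\sum_(t <- take l.+1 ss) bdeg t) + l%:Z * bdeg s) *:
    Qm phi (m_sym (id_mor A) phi (s :: take l.+1 ss)) (Stail phi (V (drop l.+1 ss)))).
  rewrite mt2_hn //; case: ss s0 => // t ss _; rewrite E0_hn.
  rewrite [size (t :: ss)]/= !big_nat_recl // addrAC; congr (_ + _).
    rewrite /= take0 drop0 big_seq1 subn1 mul0r addr0 /= -scalerDr; congr (_ *: _).
    by rewrite -(linD (qb.1 _)) m_symE.
  apply: eq_big_nat => l /andP[_ ls]; rewrite m_symE //.
  by case: (ss) ls => // u us _; rewrite addr0.
apply: eq_big_nat => l /andP[_ ls].
have st : (0 < size (take l.+1 ss))%N by rewrite size_takel.
rewrite (Qm_Stail _ (m_sym_hom hA hA'' hphi s st)) scalerA -sgD; congr (_ *: _); apply: par_eq.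
rewrite size_map size_drop size_takel // big_cons intS; par_solve.
Qed.

(* By induction on the number of arguments: d(h)(x, y) = m_2(x, y) - x.f_1(y), and
   [mt2_E0_hn] rewrites m_2(x_1, h(x_2, ..., x_n)) as the sum of the terms in which
   some m_l is applied to x_1, ..., x_l. *)
Lemma hn_diff ss : (0 < size ss)%N ->
  let n := size ss in let x := V ss in let D i := \sum_(t <- take i ss) bdeg t in
  dM (hn phi x) = sg (1 - n%:Z) *: (\sum_(0 <= i < n) sg (D i) *:
      hn phi (take i x ++ map dM (take 1 (drop i x)) ++ drop i.+1 x))
  + \sum_(1 <= l < n) sg (l%:Z + (1 - (n%:Z - l%:Z)) * D l) *:
      Qm phi (hn phi (take l x)) (iotaR A (fn phi (drop l x)))
  + \sum_(2 <= l < n.+1) \sum_(0 <= i < (n - l)%N.+1)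
      sg (i%:Z + l%:Z * (n%:Z - i%:Z - l%:Z) + (2 - l%:Z) * D i) *:
      hn phi (take i x ++ m_sym (id_mor A) phi (take l (drop i ss)) :: drop (i + l)%N x).
Proof.
elim: ss => // s ss IH _; have [/size0nil -> {IH}|s0] := posnP (size ss).
  rewrite /= big_nat1 !big_geq // !addr0 subrr sg0 !scale1r big_nil sg0 scale1r.
  by rewrite /= !hn1.
move: (IH s0) => {}IH; cbn zeta in IH |- *.
set m := size ss in s0 IH *; rewrite -[size (s :: ss)]/m.+1; set x := V ss in IH *.
rewrite -[V (s :: ss)]/(bval s :: x).
have sx : size x = m by rewrite size_map.
set D := bdeg s.
have x0 : (0 < size x)%N by rewrite sx.
have Lh z : (0 < size z)%N -> Qm phi (bval s) (Smap (hn phi z)) = sg ((size z)%:Z * D) *: hn phi (bval s :: z).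
  by move=> z0; rewrite -(Qm_Stail _ (bar_hom_bval s)); case: z z0.
have -> : hn phi (bval s :: x) = sg (m%:Z * D) *: Qm phi (bval s) (Smap (hn phi x)).
  by rewrite Lh // sx sgZK.
rewrite (linZ (bar_diff_linear _ _)) (Qm_diff hA hA'' hphi) mt2_E0_hn //.
set dI := fun i => \sum_(t <- take i ss) bdeg t in IH *.
have dS i : \sum_(t <- take i.+1 (s :: ss)) bdeg t = D + dI i by rewrite /= big_cons.
set y := hn phi x in IH *.
(* The summand [i = 0] of the terms with d: the first argument is differentiated. *)
have e1 : sg (m%:Z * D) *: Qm phi (dM (bval s)) (Smap y) =
    sg (1 - m.+1%:Z) *: (sg 0 *: hn phi (dM (bval s) :: x)).
  have hd : bar_hom (D + 1) (dM (bval s)) by apply: bar_diff_hom; exact: bar_hom_bval.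
  have -> : Smap y = Stail phi x by rewrite /y; case: (x) x0.
  rewrite (Qm_Stail _ hd) sx !scalerA -!sgD; congr (_ *: _); apply: par_eq; rewrite intS; par_solve.
(* The summand [l = 1] of the terms with iota: only the first argument stays under h. *)
have e4 : sg (m%:Z * D) *: (sg D *: Qm phi (bval s) (iotaR A (f1 phi y))) =
    - (sg (1%:Z + (1 - (m.+1%:Z - 1%:Z)) * (D + dI 0%N)) *: Qm phi (hn phi [:: bval s]) (iotaR A (fn phi x))).
  rewrite -scaleNr -sgN scalerA -sgD hn1 /dI take0 big_nil addr0; congr (_ *: _); apply: par_eq.
  by rewrite intS; par_solve.
pose Lm z := Qm phi (bval s) (Smap z).
have Lml : linear Lm by exact: islin_comp (qb.2 _) sl.
have LQ u c : Lm (Qm phi u (iotaR A c)) = Qm phi (Lm u) (iotaR A c).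
  by rewrite /Lm Smap_Qm // (Qm_Qm hA hA'' hphi).
(* The induction hypothesis under S, with the first argument put in front: [i], and in the second
   sum [l], moves up by one. *)
have e2 : - (sg (m%:Z * D) *: (sg D *: Qm phi (bval s) (Smap (dM y)))) =
    sg (1 - m.+1%:Z) *: (\sum_(0 <= i < m) sg (D + dI i) *:
      hn phi (bval s :: take i x ++ map dM (take 1 (drop i x)) ++ drop i.+1 x))
  + \sum_(1 <= l < m) sg (l.+1%:Z + (1 - (m.+1%:Z - l.+1%:Z)) * (D + dI l)) *:
      Qm phi (hn phi (bval s :: take l x)) (iotaR A (fn phi (drop l x)))
  + \sum_(2 <= l < m.+1) \sum_(0 <= i < (m - l)%N.+1)
      sg (i.+1%:Z + l%:Z * (m.+1%:Z - i.+1%:Z - l%:Z) + (2 - l%:Z) * (D + dI i)) *: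
      hn phi (bval s :: take i x ++ m_sym (id_mor A) phi (take l (drop i ss)) :: drop (i + l)%N x).
  rewrite -/(Lm _) IH scalerA -sgD -scaleNr -sgN !(linD Lml) (linZ Lml) !(lin_sum Lml) !scalerDr.
  congr (_ + _ + _); rewrite ?scalerA !scaler_sumr.
  - apply: eq_big_nat => i /andP[_ im]; rewrite (linZ Lml) /Lm Lh; last first.
      by rewrite !size_cat size_map !size_take_min !size_drop sx; lia.
    rewrite !scalerA -!sgD; congr (_ *: _); apply: par_eq.
    have -> : size (take i x ++ map dM (take 1 (drop i x)) ++ drop i.+1 x) = m.
      by rewrite !size_cat size_map !size_take_min !size_drop sx; lia.
    by rewrite intS; par_solve.
  - apply: eq_big_nat => l /andP[l0 lm]; rewrite (linZ Lml) LQ /Lm Lh; last first.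
      by rewrite size_takel // sx ltnW.
    rewrite (linZ (qb.1 _)) !scalerA -!sgD size_takel ?sx; last exact: ltnW.
    by congr (_ *: _); apply: par_eq; rewrite !intS; par_solve.
  - apply: eq_big_nat => l /andP[l0 lm]; rewrite (lin_sum Lml) scaler_sumr.
    apply: eq_big_nat => i /andP[_ im]; rewrite (linZ Lml) /Lm Lh; last first.
      by rewrite size_cat /= addnS.
    rewrite !scalerA -!sgD; congr (_ *: _); apply: par_eq.
    have -> : (size (take i x ++ m_sym (id_mor A) phi (take l (drop i ss)) :: drop (i + l) x))%:Z = m%:Z - l%:Z + 1.
      by rewrite size_cat size_take_min /= size_drop sx; lia.
    by rewrite !intS; par_solve.
(* The terms in which m_l is applied to an initial block, that is, the summands [i = 0] of the last
   sum. *)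
have e3 : sg (m%:Z * D) *: (sg D *: \sum_(0 <= l < m) sg ((m - l.+1)%N%:Z * (D - l%:Z) + l%:Z * D) *:
    hn phi (m_sym (id_mor A) phi (s :: take l.+1 ss) :: V (drop l.+1 ss))) =
  \sum_(2 <= l < m.+2) sg (0%:Z + l%:Z * (m.+1%:Z - 0%:Z - l%:Z) + (2 - l%:Z) * 0) *:
    hn phi (m_sym (id_mor A) phi (take l (s :: ss)) :: drop l (bval s :: x)).
  rewrite !big_add1 /= scalerA scaler_sumr; apply: eq_big_nat => l /andP[_ lm].
  rewrite map_drop -/x scalerA -!sgD; congr (_ *: _); apply: par_eq.
  have -> : (m - l.+1)%N%:Z = m%:Z - l%:Z - 1 by lia.
  by rewrite !intS; par_solve.
rewrite !scalerDr !scalerN e1 e2 e3 e4 opprK.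
(* In return, each sum of the claim is split into its summands of lowest index and the rest. *)
have r1 : \sum_(0 <= i < m.+1) sg (\sum_(t <- take i (s :: ss)) bdeg t) *:
    hn phi (take i (bval s :: x) ++ map dM (take 1 (drop i (bval s :: x))) ++ drop i.+1 (bval s :: x)) =
  sg 0 *: hn phi (dM (bval s) :: x) + \sum_(0 <= i < m) sg (D + dI i) *:
      hn phi (bval s :: take i x ++ map dM (take 1 (drop i x)) ++ drop i.+1 x).
  rewrite big_nat_recl //; congr (_ + _); last by apply: eq_bigr => i _; rewrite dS.
  by rewrite /= big_nil take0 drop0.
have r2 : \sum_(1 <= l < m.+1) sg (l%:Z + (1 - (m.+1%:Z - l%:Z)) * (\sum_(t <- take l (s :: ss)) bdeg t)) *:
    Qm phi (hn phi (take l (bval s :: x))) (iotaR A (fn phi (drop l (bval s :: x)))) =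
  sg (1%:Z + (1 - (m.+1%:Z - 1%:Z)) * (D + dI 0%N)) *: Qm phi (hn phi [:: bval s]) (iotaR A (fn phi x))
  + \sum_(1 <= l < m) sg (l.+1%:Z + (1 - (m.+1%:Z - l.+1%:Z)) * (D + dI l)) *:
      Qm phi (hn phi (bval s :: take l x)) (iotaR A (fn phi (drop l x))).
  rewrite big_ltn // dS /= take0 drop0 big_add1; congr (_ + _).
  by apply: eq_bigr => l _; rewrite big_cons.
have r3 : \sum_(2 <= l < m.+2) \sum_(0 <= i < (m.+1 - l)%N.+1)
      sg (i%:Z + l%:Z * (m.+1%:Z - i%:Z - l%:Z) + (2 - l%:Z) * (\sum_(t <- take i (s :: ss)) bdeg t)) *:
      hn phi (take i (bval s :: x) ++ m_sym (id_mor A) phi (take l (drop i (s :: ss))) :: drop (i + l)%N (bval s :: x)) =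
  \sum_(2 <= l < m.+2) sg (0%:Z + l%:Z * (m.+1%:Z - 0%:Z - l%:Z) + (2 - l%:Z) * 0) *:
    hn phi (m_sym (id_mor A) phi (take l (s :: ss)) :: drop l (bval s :: x)) +
  \sum_(2 <= l < m.+1) \sum_(0 <= i < (m - l)%N.+1)
      sg (i.+1%:Z + l%:Z * (m.+1%:Z - i.+1%:Z - l%:Z) + (2 - l%:Z) * (D + dI i)) *:
      hn phi (bval s :: take i x ++ m_sym (id_mor A) phi (take l (drop i ss)) :: drop (i + l)%N x).
  under eq_bigr do rewrite big_nat_recl //.
  rewrite big_split /=; congr (_ + _).
    by apply: eq_bigr => l _; rewrite big_nil add0n.
  (* For [l = m.+1] the block fills the whole list and only [i = 0] occurs, so the remaining sum
     ends at [l = m]. *)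
  rewrite [LHS]big_nat_recr //= subnn [X in _ + X]big_geq // addr0; apply: eq_big_nat => l /andP[_ lm].
  by rewrite subSn //; apply: eq_bigr => i _; rewrite big_cons.
rewrite r1 r2 r3 scalerDr {e1 e2 e3 e4 r1 r2 r3 IH LQ}.
have AC (a b c d e f : M) : a + (b + c + d) + f + e = a + b + (e + c) + (f + d).
  by rewrite !addrA [LHS](ACl (1*2*6*3*5*4)).
exact: AC.
Qed.
End HnDiff.

(** * From symbols to homogeneous arguments *)

Section Multilinear.
Variables (k : comNzRingType) (V W : lmodType k).

(** The varying entry lies in front of the block, inside it or behind it. In the middle case
    linearity comes from the hypothesis on [g], in the others from that on [f]. *)
Lemma ml_block (f : seq V -> W) (g : seq V -> seq V) i j : multilinear f ->
  (forall u v, multilinear (fun z => f (u ++ g z ++ v))) ->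
  multilinear (fun x => f (take i x ++ g (take j (drop i x)) ++ drop (i + j) x)).
Proof.
move=> fm gm l r; have [li|il] := ltnP (size l) i.
  have E x : take i (l ++ x :: r) ++ g (take j (drop i (l ++ x :: r))) ++ drop (i + j) (l ++ x :: r) =
      l ++ x :: (take (i - size l).-1 r ++ g (take j (drop (i - size l).-1 r)) ++ drop ((i - size l).-1 + j) r).
    have iE : i = (size l + (i - size l).-1.+1)%N by lia.
    rewrite take_cat drop_cat [drop (i + j) _]drop_cat ltnNge (ltnW li) ltnNge (leq_trans (ltnW li) (leq_addr _ _)) /=.
    have -> : (i + j - size l = ((i - size l).-1 + j).+1)%N by lia.
    have -> : (i - size l = (i - size l).-1.+1)%N by lia.
    by rewrite /= -catA.
  by move=> c x y; rewrite !E; exact: fm.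
rewrite -(cat_take_drop i l); have : size (take i l) = i by rewrite size_takel.
move: (take i l) (drop i l) => {il l} l1 l2 s1.
have E0 x : take i ((l1 ++ l2) ++ x :: r) = l1 by rewrite -catA -s1 take_size_cat.
have E1 x : drop i ((l1 ++ l2) ++ x :: r) = l2 ++ x :: r by rewrite -catA -s1 drop_size_cat.
have E2 x : drop (i + j) ((l1 ++ l2) ++ x :: r) = drop j (l2 ++ x :: r) by rewrite addnC -drop_drop E1.
have [lj|jl] := ltnP (size l2) j.
  have E x : f (take i ((l1 ++ l2) ++ x :: r) ++ g (take j (drop i ((l1 ++ l2) ++ x :: r)))
      ++ drop (i + j) ((l1 ++ l2) ++ x :: r)) =
      f (l1 ++ g (l2 ++ x :: take (j - size l2).-1 r) ++ drop (j - size l2).-1 r).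
    rewrite E0 E1 E2 take_cat drop_cat ltnNge (ltnW lj) /=.
    by have -> : (j - size l2 = (j - size l2).-1.+1)%N by lia.
  by move=> c x y; rewrite !E; exact: gm.
have E x : f (take i ((l1 ++ l2) ++ x :: r) ++ g (take j (drop i ((l1 ++ l2) ++ x :: r)))
      ++ drop (i + j) ((l1 ++ l2) ++ x :: r)) = f ((l1 ++ g (take j l2) ++ drop j l2) ++ x :: r).
  rewrite E0 E1 E2 -!catA; congr (f (_ ++ _)); congr (g _ ++ _).
    by rewrite takel_cat.
  rewrite drop_cat; case: ltnP => // lj; have -> : j = size l2 by apply/eqP; rewrite eqn_leq jl lj.
  by rewrite subnn drop_size.
by move=> c x y; rewrite !E; exact: fm.
Qed.

End Multilinear.

Section HomEq.
Variables (k : comNzRingType) (A' A A'' : adga k) (N : lmodType k).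
Local Notation B := (bmod A' A A'').

(** Homogeneous arguments are replaced one by one by symbols of the same degree. The signs read the
    degrees from the separate list, which stays constant meanwhile. *)
Lemma multilinear_hom_eq0 (E : seq int -> seq B -> N) n : (forall ds, multilinear (E ds)) ->
  (forall ss, size ss = n -> E (map (@bdeg k A' A A'') ss) (map (@bval k A' A A'') ss) = 0) ->
  forall xs : seq (helt (@bar_hom k A' A A'')), size xs = n -> E (map (@hdeg _ _) xs) (hvals xs) = 0.
Proof.
move=> El E0 xs; suff H ss : (size ss + size xs)%N = n ->
    E (map (@bdeg k A' A A'') ss ++ map (@hdeg _ _) xs) (map (@bval k A' A A'') ss ++ hvals xs) = 0.
  exact: (H [::]).
elim: xs ss => [|x xs IH] ss; first by rewrite addn0 !cats0 => /E0.
move=> sn; rewrite /=; have El' := El (map (@bdeg k A' A A'') ss ++ hdeg x :: map (@hdeg _ _) xs)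
   (map (@bval k A' A A'') ss) (hvals xs).
apply: (bar_hom_ind (P := fun y => E _ (_ ++ y :: _) = 0) (hvalP x)).
- exact: (lin0 El').
- by move=> c y z Ey Ez; rewrite (El' c y z) Ey Ez scaler0 addr0.
- move=> s <-; have := IH (rcons ss s); rewrite !map_rcons !cat_rcons; apply.
  by rewrite size_rcons -sn addnS.
Qed.
End HomEq.

(** * The family f_n is an augmented morphism *)

Section Part1.
Variables (k : comNzRingType) (A A'' : hga_data k) (phi : adga_mor A A'').
Hypotheses (hA : is_hga A) (hA'' : is_hga A'') (hphi : is_hga_mor phi).
Local Notation K := (k_adga k).
Local Notation R := (bmod K A A'').
Local Notation M := (bmod A A A'').
Local Notation W w := (word (hvals (w : seq (helt (@bhom k A))))).
Local Notation wA := (helt (@bhom k A)).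
Local Notation dM := (bar_diff (id_mor A) phi).
Local Notation V ss := (map (@bval k A A A'') ss).
Local Notation mm := (mn (id_mor A) phi).
Let rb : bilin (rprod phi) := rprod_bilin phi hA hA''.
Let qb : bilin (Qm phi) := Qm_bilin rb.
Let sl := @Smap_linear k A A''.
Let fl := f1_linear phi.

Lemma fn_multilinear : multilinear (fn phi : seq M -> A'').
Proof. by move=> l r; exact: islin_comp fl (hn_multilinear rb l r). Qed.

Lemma mn_multilinear : multilinear mm.
Proof. by apply: mlift_multilinear => l r; exact: m_sym_slin. Qed.

Lemma mn_bval ss : mm (V ss) = m_sym (id_mor A) phi ss.
Proof. by apply: mlift_bval => l r; exact: m_sym_slin. Qed.

(** The difference of the two sides of the relation. The partial sums of degrees form a free
    argument [D], so that for fixed [D] the signs are constants and the expression is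
    multilinear. *)
Definition rel_defect n (D : nat -> int) (x : seq M) : A'' :=
  adiff A'' (fn phi x) - sg (1 - n%:Z) *: (\sum_(0 <= i < n) sg (D i) *:
      fn phi (take i x ++ map dM (take 1 (drop i x)) ++ drop i.+1 x))
  - (\sum_(1 <= l < n) sg (l%:Z + (1 - (n%:Z - l%:Z)) * D l) *: (fn phi (take l x) * fn phi (drop l x))
  + \sum_(2 <= l < n.+1) \sum_(0 <= i < (n - l)%N.+1)
      sg (i%:Z + l%:Z * (n%:Z - i%:Z - l%:Z) + (2 - l%:Z) * D i) *:
      fn phi (take i x ++ mm (take l (drop i x)) :: drop (i + l)%N x)).

Lemma rel_defect_multilinear n D : multilinear (rel_defect n D).
Proof.
have fm := fn_multilinear; have mlm := mn_multilinear.
have dl := @bar_diff_linear k A A A'' (id_mor A) phi.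
have h1 i : multilinear (fun x => fn phi (take i x ++ map dM (take 1 (drop i x)) ++ drop i.+1 x)).
  have := @ml_block k M A'' (fn phi) (map dM) i 1 fm; rewrite addn1; apply=> u v l r c x y.
  have E z : u ++ map dM (l ++ z :: r) ++ v = (u ++ map dM l) ++ dM z :: (map dM r ++ v).
    by rewrite map_cat /= -!catA.
  by rewrite !E dl; exact: fm.
have h2 i j : multilinear (fun x => fn phi (take i x ++ mm (take j (drop i x)) :: drop (i + j) x)).
  apply: (@ml_block k M A'' (fn phi) (fun z => [:: mm z]) i j fm) => u v l r c x y.
  by rewrite (mlm l r c x y); exact: fm.
have h3 i : multilinear (fun x => fn phi (take i x) * fn phi (drop i x)).
  move=> l r; have [li|il] := ltnP (size l) i.
    have E x : fn phi (take i (l ++ x :: r)) * fn phi (drop i (l ++ x :: r)) =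
        fn phi (l ++ x :: take (i - size l).-1 r) * fn phi (drop (i - size l).-1 r).
      rewrite take_cat drop_cat ltnNge (ltnW li) /=.
      by have -> : (i - size l = (i - size l).-1.+1)%N by lia.
    by move=> c x y; rewrite !E (fm _ _ c x y); exact: mul_linl.
  have E x : fn phi (take i (l ++ x :: r)) * fn phi (drop i (l ++ x :: r)) =
      fn phi (take i l) * fn phi (drop i l ++ x :: r).
    rewrite takel_cat // drop_cat; case: ltnP => // li.
    have -> : i = size l by apply/eqP; rewrite eqn_leq il li.
    by rewrite subnn drop_size.
  by move=> c x y; rewrite !E (fm _ _ c x y); exact: mul_linr.
move=> l r.
pose F1 x := adiff A'' (fn phi (l ++ x :: r)).
pose F2 i x := fn phi (take i (l ++ x :: r) ++ map dM (take 1 (drop i (l ++ x :: r))) ++ drop i.+1 (l ++ x :: r)).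
pose F3 i x := fn phi (take i (l ++ x :: r)) * fn phi (drop i (l ++ x :: r)).
pose F4 i j x := fn phi (take i (l ++ x :: r) ++ mm (take j (drop i (l ++ x :: r))) :: drop (i + j) (l ++ x :: r)).
have l1 : linear F1 by exact: islin_comp (@adiff_linear _ _) (fm l r).
have l2 i : linear (F2 i) by exact: (h1 i l r).
have l3 i : linear (F3 i) by exact: (h3 i l r).
have l4 i j : linear (F4 i j) by exact: (h2 i j l r).
apply: islin_add; first (apply: islin_add; first exact: l1).
  apply/islin_opp/islin_scale.
  by apply: (@islin_sum _ _ _ _ _ _ (fun i x => sg (D i) *: F2 i x)) => i; exact: islin_scale.
apply/islin_opp/islin_add.
  apply: (@islin_sum _ _ _ _ _ _ (fun i x => sg (i%:Z + (1 - (n%:Z - i%:Z)) * D i) *: F3 i x)) => i.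
  exact: islin_scale.
apply: (@islin_sum _ _ _ _ _ _ (fun j x => \sum_(0 <= i < (n - j)%N.+1)
      sg (i%:Z + j%:Z * (n%:Z - i%:Z - j%:Z) + (2 - j%:Z) * D i) *: F4 i j x)) => j.
apply: (@islin_sum _ _ _ _ _ _ (fun i x =>
      sg (i%:Z + j%:Z * (n%:Z - i%:Z - j%:Z) + (2 - j%:Z) * D i) *: F4 i j x)) => i.
exact: islin_scale.
Qed.

Lemma rel_defect_bval ss : (0 < size ss)%N ->
  rel_defect (size ss) (fun i => \sum_(d <- take i (map (@bdeg k A A A'') ss)) d) (V ss) = 0.
Proof.
move=> s0; rewrite /rel_defect /fn -(f1_diff phi) hn_diff // !(linD fl) (linZ fl) !(lin_sum fl).
have DE i : \sum_(d <- take i (map (@bdeg k A A A'') ss)) d = \sum_(t <- take i ss) bdeg t.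
  by rewrite -map_take big_map.
have AC (a b c x y z : A'') : a = x -> b = y -> c = z -> a + b + c - x - (y + z) = 0.
  by move=> -> -> ->; rewrite -(addrA x) (addrC x) addrK subrr.
apply: AC; [congr (_ *: _)| |]; apply: eq_bigr => l _.
- by rewrite (linZ fl) DE.
- by rewrite (linZ fl) (f1_Qm_iotaR phi hA hA'') DE.
- rewrite (lin_sum fl); apply: eq_bigr => i _.
  have -> : mm (take l (drop i (V ss))) = m_sym (id_mor A) phi (take l (drop i ss)).
    by rewrite -map_drop -map_take mn_bval.
  by rewrite (linZ fl) DE.
Qed.

Lemma fn_rel (xs : seq (helt (@bar_hom k A A A''))) : (0 < size xs)%N ->
  rel_defect (size xs) (fun i => hdegs (take i xs)) (hvals xs) = 0.
Proof.
move=> s0; pose D ds i : int := \sum_(d <- take i ds) d.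
have -> : (fun i => hdegs (take i xs)) = D (map (@hdeg _ _) xs).
  by apply: funext => i; rewrite /D -map_take big_map.
apply: (multilinear_hom_eq0 (fun ds => rel_defect_multilinear (size xs) (D ds)) _ (erefl _)) => ss ssE.
by rewrite -ssE rel_defect_bval // ssE.
Qed.

Lemma pR_Smap y : pR (Smap y : R) = 0.
Proof.
have pl := @pR_linear k A A''.
suff E : (fun y => pR (Smap y : R)) = fun=> 0 by exact: (congr1 (@^~ y) E).
apply: lin_bval_eq => [||[[a' w] a'']]; [by lin|exact: islin_zero|].
by rewrite bval_lact SmapE -ract_pre pR_ract pre_word eps_word scale0r.
Qed.

Lemma bsign_one : bsign (bt 1 [::] 1 : M) = bt 1 [::] 1.
Proof.
have h : bar_hom 0 (bt 1 [::] 1 : M).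
  by have := @bar_hom_bt k A A A'' 0 0 1 [::] 1 (ahom1 A) (ahom1 A''); rewrite wdeg_nil.
by rewrite (bsign_hom h) sg0 scale1r.
Qed.

Lemma hn_one xs : (0 < size xs)%N -> hn phi (bt 1 [::] 1 :: xs) = lact 1 (Smap (hn phi xs)) :> M.
Proof.
move=> s0; rewrite hn_cons // /bsg.
have -> : (if par (size xs) then bsign (bt 1 [::] 1) else bt 1 [::] 1) = bt 1 [::] 1 :> M.
  by case: par; rewrite ?bsign_one.
have := QmE rb (1 : A) (bt (1 : K) [::] 1) (Smap (hn phi xs)).
by rewrite lactE rprod1l.
Qed.

(** h_n of a list starting with the unit has the form 1 (x) z, and S kills it because 1 has
    reduction 0. Arguments in front only carry this zero outwards. *)
Lemma Smap_hn_one l r : Smap (hn phi (l ++ bt 1 [::] 1 :: r)) = 0 :> R.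
Proof.
elim: l => [|t l IH]; last first.
  by rewrite /= hn_cons ?size_cat ?addnS // IH (lin0 (qb.2 _)) (lin0 sl).
have S1 (z : R) : Smap (lact (1 : A) z : M) = 0 by rewrite SmapE red1 (lin0 (pre_linl _)).
have [/size0nil ->|s0] := posnP (size r); last by rewrite /= hn_one.
by have := S1 (bt (1 : K) [::] 1); rewrite lactE.
Qed.

(** A unit in a later place is covered by [Smap_hn_one]. In the first place f_1 meets an element in
    the image of S, a combination of words of positive length. *)
Lemma fn_unit l r : (0 < size l + size r)%N -> fn phi (l ++ bt 1 [::] 1 :: r : seq M) = 0.
Proof.
case: l => [|t l] s0; last first.
  by rewrite /fn /= hn_cons ?size_cat ?addnS // Smap_hn_one (lin0 (qb.2 _)) (lin0 fl).
by rewrite /fn /= hn_one // f1E pR_Smap mulr0.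
Qed.

Lemma f1_eps x : aeps A'' (f1 phi x) = bar_eps x.
Proof.
have el : linear (fun x => aeps A'' (f1 phi x) : k^o) by exact: islin_comp (@aeps_linear _ A'') fl.
have bl := @bar_eps_linear k A A A''.
suff E : (fun x => aeps A'' (f1 phi x) : k^o) = fun x => bar_eps x by exact: (congr1 (@^~ x) E).
apply: lin_bval_eq => [||[[a' w] a'']] //.
rewrite /bval f1_bt bar_epsE; case: w => [|b w] /=; last exact: raddf0.
by rewrite rmorphM; congr (_ * _); exact: amor_eps.
Qed.

(** f_1 keeps words of length 0, and the augmentation of a <| y is eps(y) eps(a). Each term of the
    product thus carries the counits of both pieces of a word of S(y), and that word has positive
    length. *)
Lemma f1_Qm_Smap_eps x y : aeps A'' (f1 phi (Qm phi x (Smap y))) = 0.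
Proof.
have pl := @pR_linear k A A''; have ae := @aeps_linear _ A''.
suff H s t : aeps A'' (f1 phi (Qm phi (bval s) (Smap (bval t)))) = 0.
  have el x' : linear (fun y => aeps A'' (f1 phi (Qm phi x' (Smap y))) : k^o).
    exact: islin_comp ae (islin_comp fl (islin_comp (qb.2 _) sl)).
  have el' y' : linear (fun x => aeps A'' (f1 phi (Qm phi x (Smap y'))) : k^o).
    exact: islin_comp ae (islin_comp fl (qb.1 _)).
  suff H' s : (fun y => aeps A'' (f1 phi (Qm phi (bval s) (Smap y))) : k^o) = fun=> 0.
    suff H'' : (fun x => aeps A'' (f1 phi (Qm phi x (Smap y))) : k^o) = fun=> 0.
      exact: (congr1 (@^~ x) H'').
    apply: lin_bval_eq => [||s] //; first exact: islin_zero.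
    exact: (congr1 (@^~ y) (H' s)).
  by apply: lin_bval_eq => [||t] //; first exact: islin_zero.
case: s t => [[a' w] a''] [[b v] b'']; rewrite !bval_lact SmapE QmE // f1E.
have aM c d : aeps A'' (c * d) = (aeps A'' c : k^o) * aeps A'' d by exact: rmorphM.
rewrite aM.
pose b0 : wA := Helt (bhom_red (hvalP b)).
have -> : pre (red (hval b)) (ract (W v) (hval b'')) = ract (W (b0 :: v)) (hval b'') :> R.
  by rewrite -ract_pre pre_word.
rewrite (rprod_words phi hA hA'' _ _ _ (hvalP a'')) (lin_sum pl) (lin_sum ae).
pose F (u _ : seq wA) : k^o := sg (hdeg a'' * wdeg u) *:
  ((bar_eps (W w) * bar_eps (W u)) *: ((aeps A'' (hval a'') : k) *: (aeps A'' (hval b'') : k^o))).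
(* [F] keeps the counit of the first piece; once the second piece is empty, this is the counit of
   the nonempty word [b0 :: v]. *)
rewrite (eq_bigr (fun p => bar_eps (W p.2) *: F p.1 p.2)) => [|p _].
  by rewrite splits_counitr /F (eps_word (hvals (_ :: _))) mulr0 scale0r scaler0 mulr0.
rewrite (linZ pl) (linZ ae) pR_ract (linZ ae) aM (hmu_bar_eps hA) wactE aeps_act pW_eps /F.
rewrite /GRing.scale /=; ring.
Qed.

Lemma aug_ainf_mor_fn : is_aug_ainf_mor (B := bar (id_mor A) phi) mm (fn phi).
Proof.
split.
- exact: fn_multilinear.
- by move=> xs s0; apply: f1_hom; apply: hn_hom => //; exact: rprod_hom.
- by move=> xs s0 n D x; have := fn_rel s0; rewrite /rel_defect => /eqP; rewrite subr_eq0 => /eqP.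
- by rewrite /fn hn1 f1_bt rmorph1 mulr1.
- exact: fn_unit.
- exact: f1_eps.
- move=> [|x [|y ys]] // _; rewrite /fn hn_cons //; exact: f1_Qm_Smap_eps.
Qed.
End Part1.

(** * Naturality *)

Section Compose.
Variable k : comNzRingType.

(** Each argument is expanded by the very decomposition that [mlift] has chosen. The source
    operation is thus met on symbols only, and multilinearity is asked of the target operation. *)
Lemma mlift_nat (A' A A'' : adga k) (V N P : lmodType k) (F : seq (bsym A' A A'') -> N) (T : seq V -> P)
    (L : N -> P) (h : bmod A' A A'' -> V) xs : linear L -> linear h -> multilinear T ->
  (forall ss, size ss = size xs -> T (map h (map (@bval k A' A A'') ss)) = L (F ss)) ->
  L (mlift F xs) = T (map h xs).
Proof.
move=> Ll hl; elim: xs F T => [|x xs IH] F T Tl TF; first by rewrite -(TF [::]) //.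
rewrite /= /hlift (lin_sum Ll) -[in RHS](decE x) (lin_sum hl) (lin_sum (Tl [::] (map h xs))).
apply: eq_bigr => p _; rewrite (linZ Ll) (linZ hl) (linZ (Tl [::] (map h xs))); congr (_ *: _).
apply: (IH _ (fun ys => T (h (bval p.2) :: ys))) => [l r|ss sE]; first exact: (Tl (_ :: l)).
by apply: (TF (p.2 :: ss)); rewrite /= sE.
Qed.

Lemma strict_comp_ainf (B C : cpx k) (m : seq B -> B) (m' : seq C -> C) (g : B -> C) (A : adga k) (f : seq C -> A) :
  is_strict_mor m m' g -> is_aug_ainf_mor m' f -> is_aug_ainf_mor m (fun xs => f (map g xs)).
Proof.
move=> [gl gh gd gm g1 ge] [fm fh fr f1 fu fe1 fe].
pose G (x : helt (@chom k B)) : helt (@chom k C) := Helt (gh _ _ (hvalP x)).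
have GE xs : hvals (map G xs) = map g (hvals xs) by rewrite /hvals -!map_comp.
have GD xs : hdegs (map G xs) = hdegs xs by rewrite /hdegs big_map.
split.
- by move=> l r c x y; rewrite !map_cat /= gl; exact: fm.
- by move=> xs s0; have := fh (map G xs); rewrite size_map GE GD; apply.
- move=> xs s0 n D x; have := fr (map G xs); rewrite size_map => /(_ s0) /=.
  rewrite GE -/n -/x => E.
  have DE i : hdegs (take i (map G xs)) = D i by rewrite -map_take GD.
  move: E; do ! (under eq_bigr do rewrite DE); move=> E.
  have E1 : \sum_(0 <= i < n) sg (D i) *: f (map g (take i x ++ map (@cdiff k B) (take 1 (drop i x)) ++ drop i.+1 x)) =
      \sum_(0 <= i < n) sg (D i) *: f (take i (map g x) ++ map (@cdiff k C) (take 1 (drop i (map g x))) ++ drop i.+1 (map g x)).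
    have e i : map g (map (@cdiff k B) (take 1 (drop i x))) = map (@cdiff k C) (take 1 (drop i (map g x))).
      by rewrite -map_drop -map_take -!map_comp; apply: eq_map => z; exact: gd.
    by apply: eq_bigr => i _; rewrite !map_cat e map_take map_drop.
  rewrite E1 E; congr (_ + _); first by apply: eq_bigr => l _; rewrite DE map_take map_drop.
  apply: eq_big_nat => l /andP[l2 ln]; apply: eq_big_nat => i /andP[_ il]; rewrite DE.
  rewrite map_cat /= map_take !map_drop gm ?map_take ?map_drop //.
  rewrite size_takel // size_drop /x size_map -/n; lia.
- by rewrite /= g1 f1.
- by move=> l r s0; rewrite map_cat /= g1 fu // !size_map.
- by move=> x; rewrite /= fe1 ge.
- by move=> xs s2; rewrite fe // size_map.
Qed.
End Compose.

Section BmapNat.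
Variables (k : comNzRingType) (A A'' B B'' : hga_data k) (f : adga_mor A B) (f'' : adga_mor A'' B'').
Variables (phi : adga_mor A A'') (psi : adga_mor B B'').
Hypotheses (hA : is_hga A) (hA'' : is_hga A'') (hB : is_hga B) (hB'' : is_hga B'').
Hypotheses (hf : is_hga_mor f) (hf'' : is_hga_mor f'') (hphi : is_hga_mor phi).
Hypothesis sq : forall a, psi (f a) = f'' (phi a).
Local Notation K := (k_adga k).
Local Notation gR := (bmap (id_mor K) f f'' : bmod K A A'' -> bmod K B B'').

Lemma gR_ract (x : BA A) a : gR (ract x a) = ract (pW f x) (f'' a).
Proof.
have gl : linear gR by exact: g_linear.
have pl := pW_linear f.
suff E : (fun x : BA A => gR (ract x a)) = fun x => ract (pW f x) (f'' a) by exact: (congr1 (@^~ x) E).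
apply: BA_lin_eq => [||w]; [exact: islin_comp gl (ract_linl _)|exact: islin_comp (ract_linl _) pl|].
by rewrite pW_word /word !ractE gE.
Qed.

Lemma pW_square y : pW psi (pW f y) = pW f'' (pW phi y).
Proof.
have p1 := pW_linear psi; have p2 := pW_linear f; have p3 := pW_linear f''; have p4 := pW_linear phi.
suff E : (fun y => pW psi (pW f y)) = fun y => pW f'' (pW phi y) by exact: (congr1 (@^~ y) E).
apply: BA_lin_eq => [||w]; [exact: islin_comp p1 p2|exact: islin_comp p3 p4|].
rewrite !pW_word -!map_comp; congr word; apply: eq_map => a.
by rewrite /= /fbar !aval_red_amor sq.
Qed.

(** The product in BA is natural by [pW_mu], and the action by [pW_act] together with the
    commutative square in the form [pW_square]. *)
Lemma rprod_nat x y : gR (rprod phi x y) = rprod psi (gR x) (gR y).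
Proof.
have gl : linear gR by exact: g_linear.
have rb := rprod_bilin phi hA hA''; have rb' := rprod_bilin psi hB hB''.
apply: (R_lin_eq2 (F := fun x y => gR (rprod phi x y)) (G := fun x y => rprod psi (gR x) (gR y))).
- by split=> z; [exact: islin_comp gl (rb.1 _)|exact: islin_comp gl (rb.2 _)].
- by split=> z; [exact: islin_comp (rb'.1 _) gl|exact: islin_comp (rb'.2 _) gl].
move=> u w a b; rewrite !gR_ract !pW_hvals (rprod_words psi hB hB'' _ _ _ (amor_hom f'' (hvalP a))).
rewrite (rprod_words phi hA hA'' _ _ _ (hvalP a)) (lin_sum gl) splits_map big_map.
apply: eq_bigr => p _; rewrite (linZ gl) gR_ract wdeg_fhelt (pW_mu hA hB hf) !pW_hvals; congr (_ *: ract _ _).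
by rewrite rmorphM !wactE /= (pW_act hf'') -pW_square !pW_hvals.
Qed.
End BmapNat.

Section HnNat.
Variables (k : comNzRingType) (A A'' B B'' : hga_data k) (f : adga_mor A B) (f'' : adga_mor A'' B'').
Variables (phi : adga_mor A A'') (psi : adga_mor B B'').
Local Notation K := (k_adga k).
Local Notation gR := (bmap (id_mor K) f f'' : bmod K A A'' -> bmod K B B'').
Local Notation g := (bmap f f f'' : bmod A A A'' -> bmod B B B'').
Hypotheses (rb : bilin (rprod phi)) (rb' : bilin (rprod psi)).
Hypothesis nat_rprod : forall x y, gR (rprod phi x y) = rprod psi (gR x) (gR y).

Lemma Smap_nat x : Smap (g x) = gR (Smap x).
Proof.
have gl : linear g by exact: g_linear.
have gl' : linear gR by exact: g_linear.
have [sA sB] := (@Smap_linear k A A'', @Smap_linear k B B'').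
suff E : (fun x => Smap (g x)) = fun x => gR (Smap x) by exact: (congr1 (@^~ x) E).
apply: lin_bval_eq => [||[[a' w] a'']]; [exact: islin_comp sB gl|exact: islin_comp gl' sA|].
rewrite /bval gE.
have SE (A1 A2 : hga_data k) a v c : Smap (bt a v c : bmod A1 A1 A2) = bt (1 : K) (red a :: v) c.
  by have [_ ->] := @Smap_spec k A1 A2.
by rewrite !SE gE /= red_amor.
Qed.

Lemma Qm_nat x r : g (Qm phi x r) = Qm psi (g x) (gR r).
Proof.
have gl : linear g by exact: g_linear.
have gl' : linear gR by exact: g_linear.
have [qA qB] := (Qm_bilin rb, Qm_bilin rb').
suff E : (fun x => g (Qm phi x r)) = fun x => Qm psi (g x) (gR r) by exact: (congr1 (@^~ x) E).
apply: lin_bval_eq => [||[[a' w] a'']]; [exact: islin_comp gl (qA.1 _)|exact: islin_comp (qB.1 _) gl|].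
have gla a (s : bmod K A A'') : g (lact a s) = lact (f a) (gR s).
  suff E : (fun s => g (lact a s)) = fun s => lact (f a) (gR s) by exact: (congr1 (@^~ s) E).
  apply: R_lin_eq => [||v c].
  - exact: islin_comp gl (@lact_linr _ _ _ _ _).
  - exact: islin_comp (@lact_linr _ _ _ _ _) gl'.
  by rewrite lactE !gE lactE.
by rewrite bval_lact (QmE rb) !gla nat_rprod (QmE rb').
Qed.

(** Naturality of the product is a section hypothesis: [aug_nat] supplies it for the left parts of
    cuts, over k, and [chi_nat] for the right parts. *)
Lemma hn_nat xs : (0 < size xs)%N -> g (hn phi xs) = hn psi (map g xs).
Proof.
elim: xs => // x xs IH _; have [/size0nil -> //|s0] := posnP (size xs).
by rewrite /= !hn_cons ?size_map // Qm_nat g_bsg -Smap_nat IH.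
Qed.

Lemma rprods_nat ys : (0 < size ys)%N -> gR (rprods phi ys) = rprods psi (map gR ys).
Proof.
case: ys => // y ys _.
by elim: ys y => //= z ys IH y; rewrite IH nat_rprod.
Qed.
End HnNat.

Lemma pW_id (k : comNzRingType) (A : adga k) (x : BA A) : pW (id_mor A) x = x.
Proof.
suff E : pW (id_mor A) = id by exact: (congr1 (@^~ x) E).
apply: BA_lin_eq => [||w]; [exact: pW_linear|exact: islin_id|].
by rewrite pW_word -[RHS](congr1 (@word k A) (map_id _)); congr word; apply: eq_map => a; exact: redK.
Qed.

Lemma id_hga_mor (k : comNzRingType) (A : hga_data k) : is_hga_mor (id_mor A).
Proof. by move=> x y; rewrite -[bmap _ _ _ x]/(pW _ x) -[bmap _ _ _ y]/(pW _ y) !pW_id. Qed.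

Lemma pW_comp (k : comNzRingType) (A B C : adga k) (h : adga_mor B C) (f : adga_mor A B) x :
  pW (comp_mor h f) x = pW h (pW f x).
Proof.
have [p1 p2] := (pW_linear h, pW_linear f).
suff E : pW (comp_mor h f) = fun x => pW h (pW f x) by exact: (congr1 (@^~ x) E).
apply: BA_lin_eq => [||w]; [exact: pW_linear|exact: islin_comp p1 p2|].
by rewrite !pW_word -map_comp; congr word; apply: eq_map => a; rewrite /= /fbar aval_red_amor.
Qed.

Lemma comp_hga_mor (k : comNzRingType) (A B C : hga_data k) (h : adga_mor B C) (f : adga_mor A B) :
  is_hga_mor h -> is_hga_mor f -> is_hga_mor (comp_mor h f).
Proof.
move=> hh hf x y; rewrite -[bmap _ _ _ x]/(pW _ x) -[bmap _ _ _ y]/(pW _ y) !pW_comp.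
by rewrite /= hf hh.
Qed.

(** * Naturality of the operations m_n *)

Section MSymNat.
Variables (k : comNzRingType) (A A' A'' T : hga_data k).
Variables (phi' : adga_mor A A') (phi'' : adga_mor A A'') (psi' : adga_mor A' T) (psi'' : adga_mor A'' T).
Hypotheses (hA : is_hga A) (hA' : is_hga A') (hA'' : is_hga A'') (hT : is_hga T).
Hypotheses (hphi' : is_hga_mor phi') (hphi'' : is_hga_mor phi'') (hpsi' : is_hga_mor psi') (hpsi'' : is_hga_mor psi'').
Hypothesis sq : forall a, psi' (phi' a) = psi'' (phi'' a).
Local Notation K := (k_adga k).
Local Notation chi := (comp_mor psi' phi').
Local Notation g := (bmap psi' chi psi'' : bmod A' A A'' -> bmod T T T).
Local Notation gR := (bmap (id_mor K) chi psi'' : bmod K A A'' -> bmod K T T).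
Local Notation gL := (bmap psi' psi' (id_mor K) : bmod A' A' (k_hga k) -> bmod T T (k_hga k)).
Local Notation augA := (aug_mor A' : adga_mor A' (k_hga k)).
Local Notation augT := (aug_mor T : adga_mor T (k_hga k)).

Definition gcut (c : cut A' A A'') : cut T T T :=
  ((ahelt psi' c.1.1, map (fhelt chi) c.1.2), (map (fhelt chi) c.2.1, ahelt psi'' c.2.2)).

Lemma cuts_gsym s : cuts (gsym psi' chi psi'' s) = map gcut (cuts s).
Proof.
case: s => [[a' w] a'']; rewrite /cuts /gsym size_map -[RHS]map_comp; apply: eq_map => i.
by rewrite /gcut /= map_take map_drop.
Qed.

Lemma all_cuts_gsym ss : all_cuts (map (gsym psi' chi psi'') ss) = map (map gcut) (all_cuts ss).
Proof.
elim: ss => // s ss IH; rewrite /= IH cuts_gsym map_allpairs allpairs_mapl allpairs_mapr.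
by [].
Qed.

Lemma gcut_ldeg c : cut_ldeg (gcut c) = cut_ldeg c.
Proof. by rewrite /cut_ldeg /= wdeg_fhelt. Qed.

Lemma gcut_rdeg c : cut_rdeg (gcut c) = cut_rdeg c.
Proof. by rewrite /cut_rdeg /= wdeg_fhelt. Qed.

Lemma cross_deg_gcut cs : cross_deg (map gcut cs) = cross_deg cs.
Proof.
elim: cs => //= c cs ->; rewrite gcut_rdeg big_map.
by congr (_ * _ + _); apply: eq_bigr => d _; exact: gcut_ldeg.
Qed.

Lemma push_gcut (w : seq (helt (@bhom k A))) :
  push_word (id_mor T) (map (fhelt chi) w) = map (fbar psi') (push_word phi' w).
Proof.
rewrite push_word_id hvals_fhelt /push_word -map_comp; apply: eq_map => a.
by rewrite /= /fbar aval_red_amor.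
Qed.

Lemma cut_left_gcut c : cut_left (id_mor T) (gcut c) = gL (cut_left phi' c).
Proof. by rewrite /cut_left gE push_gcut. Qed.

Lemma cut_right_gcut c : cut_right (gcut c) = gR (cut_right c).
Proof. by rewrite /cut_right gE hvals_fhelt /=. Qed.

Lemma chi_nat x y : gR (rprod phi'' x y) = rprod (id_mor T) (gR x) (gR y).
Proof.
apply: rprod_nat => //; exact: comp_hga_mor.
Qed.

Lemma aug_nat x y : bmap (id_mor K) psi' (id_mor K) (rprod augA x y) =
  rprod augT (bmap (id_mor K) psi' (id_mor K) x) (bmap (id_mor K) psi' (id_mor K) y).
Proof. by rewrite !rprod_aug //; exact: pW_mu. Qed.

Lemma lact_nat a r : g (lact a r) = lact (psi' a) (gR r).
Proof.
have gl : linear g by exact: g_linear.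
have gl' : linear gR by exact: g_linear.
suff E : (fun r => g (lact a r)) = fun r => lact (psi' a) (gR r) by exact: (congr1 (@^~ r) E).
apply: R_lin_eq => [||w b].
- exact: islin_comp gl (@lact_linr _ _ _ _ _).
- exact: islin_comp (@lact_linr _ _ _ _ _) gl'.
by rewrite lactE !gE lactE.
Qed.

(** Cutting commutes with [gsym]. Left parts are moved to [T] by [psi'] alone, since [phi'] has
    already been applied to their letters; right parts are moved by [chi] and [psi'']. *)
Lemma mtilde_nat ss : (1 < size ss)%N ->
  g (mtilde_sym phi' phi'' ss) = mtilde_sym (id_mor T) (id_mor T) (map (gsym psi' chi psi'') ss).
Proof.
move=> s1; have gl : linear g by exact: g_linear.
rewrite /mtilde_sym all_cuts_gsym big_map (lin_sum gl); apply: eq_all_cuts => -[|c cs] csE.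
  exact: lin0 gl.
have cs0 : (0 < size cs)%N by move: s1; rewrite -csE.
have wE : wdeg (gcut c).1.2 = wdeg c.1.2 by exact: wdeg_fhelt.
rewrite -[map gcut (c :: cs)]/(gcut c :: map gcut cs); cbv iota beta.
rewrite -[gcut c :: map gcut cs]/(map gcut (c :: cs)).
rewrite (linZ gl) lact_nat cross_deg_gcut size_map wE; congr (_ *: lact _ _).
  rewrite rmorphM /= hpsi'; congr (_ * hE _ _).
    by rewrite push_gcut -[bmap _ _ _ _]/(pW psi' _) pW_word.
  (* The left parts live over triples with right coefficients k, so naturality of S and h_n is used
     for the identity of k there. *)
  refine (etrans (esym (@Smap_nat k A' (k_hga k) T (k_hga k) psi' (id_mor K) _)) _).
  have := @hn_nat k A' (k_hga k) T (k_hga k) psi' (id_mor K) _ _ (rprod_aug_bilin hA') (rprod_aug_bilin hT) aug_nat.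
  move=> ->; rewrite ?size_map // -!map_comp.
  by congr (Smap (hn _ _)); apply: eq_map => d; exact/esym/cut_left_gcut.
rewrite (rprods_nat chi_nat) // -!map_comp; congr rprods.
by apply: eq_map => d; rewrite /= cut_right_gcut.
Qed.

Lemma m_sym_nat ss : (1 < size ss)%N ->
  g (m_sym phi' phi'' ss) = m_sym (id_mor T) (id_mor T) (map (gsym psi' chi psi'') ss).
Proof.
move=> s1; have gl : linear g by exact: g_linear.
rewrite /m_sym (linD gl) mtilde_nat //; congr (_ + _).
case: ss s1 => [|[[a1 w1] b1] [|[[a2 w2] b2] [|u ss]]] //= _; last exact: lin0 gl.
by rewrite lact_nat chi_nat !gE linearZ /= amor_eps !hvals_fhelt.
Qed.
End MSymNat.

Lemma strict_mor_bmap (k : comNzRingType) (A A' A'' T : hga_data k)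
    (phi' : adga_mor A A') (phi'' : adga_mor A A'') (psi' : adga_mor A' T) (psi'' : adga_mor A'' T) :
  is_hga A -> is_hga A' -> is_hga A'' -> is_hga T ->
  is_hga_mor phi' -> is_hga_mor phi'' -> is_hga_mor psi' -> is_hga_mor psi'' ->
  (forall a, psi' (phi' a) = psi'' (phi'' a)) ->
  is_strict_mor (B := bar phi' phi'') (C := bar (id_mor T) (id_mor T))
    (mn phi' phi'') (mn (id_mor T) (id_mor T)) (bmap psi' (comp_mor psi' phi') psi'').
Proof.
move=> hA hA' hA'' hT hp' hp'' hs' hs'' sq; have gl := @g_linear k A' A A'' T T T psi' (comp_mor psi' phi') psi''.
split=> //.
- by move=> n x; exact: g_hom.
- by move=> x; apply: g_diff => a; rewrite /= ?sq.
- move=> xs s2; apply: mlift_nat => //; first exact: (mn_multilinear hT hT (@id_hga_mor _ _)).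
  move=> ss sE; rewrite m_sym_nat ?sE //.
  have -> : map (bmap psi' (comp_mor psi' phi') psi'') (map (@bval k A' A A'') ss) =
      map (@bval k T T T) (map (gsym psi' (comp_mor psi' phi') psi'') ss).
    by rewrite -!map_comp; apply: eq_map => s; exact: g_bval.
  exact: (mn_bval hT hT (@id_hga_mor _ _) _).
- by have := @gE k A' A A'' T T T psi' (comp_mor psi' phi') psi'' 1 [::] 1; rewrite !rmorph1.
- by move=> x; exact: g_eps.
Qed.

Theorem proposition3p10 (k : comNzRingType) :
  (forall (A A'' : hga_data k) (phi : adga_mor A A''),
     is_hga A -> is_hga A'' -> is_hga_mor phi ->
     is_aug_ainf_mor (B := bar (id_mor A) phi) (mn (id_mor A) phi) (fn phi))
  /\
  (forall (A A' A'' At : hga_data k)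
      (phi' : adga_mor A A') (phi'' : adga_mor A A'')
      (psi' : adga_mor A' At) (psi'' : adga_mor A'' At),
     is_hga A -> is_hga A' -> is_hga A'' -> is_hga At ->
     is_hga_mor phi' -> is_hga_mor phi'' -> is_hga_mor psi' -> is_hga_mor psi'' ->
     (forall a : A, psi' (phi' a) = psi'' (phi'' a)) ->
     let g : bmod A' A A'' -> bmod At At At :=
       bmap psi' (fun a => psi' (phi' a)) psi'' in
     let F (xs : seq (bmod A' A A'')) : At := fn (id_mor At) (map g xs) in
     [/\ is_strict_mor (B := bar phi' phi'') (C := bar (id_mor At) (id_mor At))
           (mn phi' phi'') (mn (id_mor At) (id_mor At)) g,
         is_aug_ainf_mor (B := bar phi' phi'') (mn phi' phi'') F
       & forall (a' : A') (w : seq (abar A)) (a'' : A''),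
           F [:: bt a' w a''] =
             if w is [::] then psi' a' * psi'' a'' else 0]).
Proof.
split; first exact: aug_ainf_mor_fn.
move=> A A' A'' At phi' phi'' psi' psi'' hA hA' hA'' hAt hp' hp'' hs' hs'' sq g F.
have gs := strict_mor_bmap hA hA' hA'' hAt hp' hp'' hs' hs'' sq.
(* The middle map of [g] is convertible with [comp_mor psi' phi'], so [gs] speaks of [g] itself. *)
split; first exact: gs.
  exact: strict_comp_ainf gs (aug_ainf_mor_fn hAt hAt (@id_hga_mor _ At)).
move=> a' w a''; rewrite /F /= /fn hn1 /g.
rewrite -[bmap _ _ _ _]/(bmap psi' (comp_mor psi' phi') psi'' _) gE f1_bt.
by case: w.
Qed.
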